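(* Consider the Gaussian model described in the context, with data dimension $M$ and number of samples $n=n(M)$, and let $\lim_{M\to\infty}M/n(M)=\gamma\in(0,1)$. Then $\mathbb{E}_Y\left[\|\hat\Theta^\top Y-\Theta_*^\top Y\|_2^2\right]$ converges to $\operatorname{tr}(C_{EE})\,\gamma/(1-\gamma)$ in probability as $M\to\infty$.
   Context: Gaussian model. $X$ (values in $\mathbb{R}^N$) and $Z$ (values in $\mathbb{R}^M$) are independent zero-mean Gaussian random vectors with invertible covariance matrices $C_{XX}$, $C_{ZZ}$. $A\in\mathbb{R}^{M\times N}$ is a matrix and $Y:=AX+Z$. The matrix $\Theta_*\in\mathbb{R}^{M\times N}$ is defined by $\Theta_*^\top:=(A^\top C_{ZZ}^{-1}A+C_{XX}^{-1})^{-1}A^\top C_{ZZ}^{-1}$ (so $y\mapsto\Theta_*^\top y$ is the linear minimum mean squared error estimator of $X$ from $Y$), and $C_{EE}:=C_{XX}-C_{XX}A^\top(AC_{XX}A^\top+C_{ZZ})^{-1}AC_{XX}$. $\{(X_i,Y_i)\}_{i=1}^{n}$ are $n=n(M)$ independent samples of $(X,Y)$; $\boldsymbol{X}\in\mathbb{R}^{n\times N}$ and $\boldsymbol{Y}\in\mathbb{R}^{n\times M}$ have rows $X_i^\top$ and $Y_i^\top$. The least squares estimator is $y\mapsto\hat\Theta^\top y$, where $\hat\Theta$ is the minimizer of $\frac1n\|\boldsymbol{Y}\Theta-\boldsymbol{X}\|_F^2$ over $\Theta\in\mathbb{R}^{M\times N}$ ($\|\cdot\|_F$ is the Frobenius norm);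 if $\boldsymbol{Y}$ is injective (which holds almost surely for $n\ge M$) it is unique and $\hat\Theta=(\boldsymbol{Y}^\top\boldsymbol{Y})^{-1}\boldsymbol{Y}^\top\boldsymbol{X}$. $\|\cdot\|_2$ is the Euclidean norm and $\operatorname{tr}$ the trace. $\mathbb{E}_Y$ denotes expectation over a fresh $Y$ independent of the samples, with the samples held fixed; the resulting quantity is a random variable depending on the samples. *)

(* Defs.v *)
From HB Require Import structures.
From mathcomp Require Export all_boot all_order all_algebra.
From mathcomp Require Export all_classical all_reals all_analysis.

Set Implicit Arguments.
Unset Strict Implicit.
Unset Printing Implicit Defensive.

Import Order.TTheory GRing.Theory Num.Theory numFieldNormedType.Exports.

Local Open Scope classical_set_scope.
Local Open Scope ring_scope.

(* Random vectors are valued in [k.-tuple R], which carries the product Borel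
   sigma-algebra in the library; [colv] and [tuplev] go back and forth between
   tuples and the column vectors of matrix algebra. *)
Definition colv (R : realType) (k : nat) (v : k.-tuple R) : 'cV[R]_k :=
  \col_i tnth v i.

Definition tuplev (R : realType) (k : nat) (v : 'cV[R]_k) : k.-tuple R :=
  [tuple v i 0 | i < k].

Definition sqnorm2 (R : realType) (k : nat) (v : 'cV[R]_k) : R :=
  \sum_i v i 0 ^+ 2.

Definition sqnormF (R : realType) (m k : nat) (B : 'M[R]_(m, k)) : R :=
  \sum_i \sum_j B i j ^+ 2.

(* The case s = 0 is separate because the library's [normal_prob m 0] is not
   the point mass at m. *)
Definition gaussian_law (R : realType) (m s : R) (B : set R) : \bar R :=
  if s == 0 then \d_m B else normal_prob m s B.

(* Every linear combination of the coordinates has a (possibly degenerate)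
   one-dimensional Gaussian law. *)
Definition gaussian_vector d (T : measurableType d) (R : realType)
    (P : probability T R) (k : nat) (V : {RV P >-> k.-tuple R}) : Prop :=
  forall a : 'cV[R]_k, exists m s : R, forall B : set R, measurable B ->
    P [set w | B ((a^T *m colv (V w)) 0 0)] = gaussian_law m s B.

Definition zero_mean d (T : measurableType d) (R : realType)
    (P : probability T R) (k : nat) (V : {RV P >-> k.-tuple R}) : Prop :=
  forall i : 'I_k, 'E_P[fun w => tnth (V w) i]%E = 0%E.

Definition cov_mx d (T : measurableType d) (R : realType)
    (P : probability T R) (k : nat) (V : {RV P >-> k.-tuple R}) : 'M[R]_k :=
  \matrix_(i, j)
    fine (covariance P (fun w => tnth (V w) i) (fun w => tnth (V w) j)).

Definition independent2 d d1 d2 (T : measurableType d)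
    (T1 : measurableType d1) (T2 : measurableType d2) (R : realType)
    (P : probability T R) (V : {RV P >-> T1}) (W : {RV P >-> T2}) : Prop :=
  forall (B : set T1) (C : set T2), measurable B -> measurable C ->
    P (V @^-1` B `&` W @^-1` C) = (P (V @^-1` B) * P (W @^-1` C))%E.

(* Subfamilies need no separate clause: take [B i := setT] off the subfamily. *)
Definition mutually_independent d d1 (T : measurableType d)
    (T1 : measurableType d1) (R : realType) (P : probability T R) (n : nat)
    (V : 'I_n -> {RV P >-> T1}) : Prop :=
  forall B : 'I_n -> set T1, (forall i, measurable (B i)) ->
    P (\bigcap_i (V i @^-1` B i)) = (\prod_(i < n) P (V i @^-1` B i))%E.

Section model.
Variables (R : realType) (M N : nat).

Definition observation (A : 'M[R]_(M, N)) (x : N.-tuple R) (z : M.-tuple R) :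
    M.-tuple R :=
  tuplev (A *m colv x + colv z).

Definition Theta_star (A : 'M[R]_(M, N)) (CXX : 'M[R]_N) (CZZ : 'M[R]_M) :
    'M[R]_(M, N) :=
  (invmx (A^T *m invmx CZZ *m A + invmx CXX) *m A^T *m invmx CZZ)^T.

Definition C_EE (A : 'M[R]_(M, N)) (CXX : 'M[R]_N) (CZZ : 'M[R]_M) : 'M[R]_N :=
  CXX - CXX *m A^T *m invmx (A *m CXX *m A^T + CZZ) *m A *m CXX.

(* [S] consists of n independent copies of the pair (X, A X + Z); the samples
   and the pair (X, Z) may live on different probability spaces. *)
Definition iid_samples dO dT (Omega : measurableType dO) (T : measurableType dT)
    (Q : probability Omega R) (P : probability T R)
    (A : 'M[R]_(M, N)) (X : {RV Q >-> N.-tuple R}) (Z : {RV Q >-> M.-tuple R})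
    (n : nat) (S : 'I_n -> {RV P >-> (N.-tuple R * M.-tuple R)%type}) : Prop :=
  mutually_independent S /\
  forall (i : 'I_n) (B : set (N.-tuple R * M.-tuple R)), measurable B ->
    P (S i @^-1` B) = Q [set w | B (X w, observation A (X w) (Z w))].

Definition data_X n (s : 'I_n -> N.-tuple R * M.-tuple R) : 'M[R]_(n, N) :=
  \matrix_(i, j) tnth (s i).1 j.

Definition data_Y n (s : 'I_n -> N.-tuple R * M.-tuple R) : 'M[R]_(n, M) :=
  \matrix_(i, j) tnth (s i).2 j.

Definition least_squares n (bY : 'M[R]_(n, M)) (bX : 'M[R]_(n, N))
    (Theta : 'M[R]_(M, N)) : Prop :=
  forall Theta' : 'M[R]_(M, N),
    n%:R^-1 * sqnormF (bY *m Theta - bX) <= n%:R^-1 * sqnormF (bY *m Theta' - bX).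

(* For a fixed value [Theta] of the least squares estimator, the expectation of
   ||Theta^T Y - Theta_*^T Y||^2 over Y = A X + Z. Evaluating it at the
   estimator computed from samples on another space is the expectation over a
   fresh Y with the samples held fixed. *)
Definition excess_risk dO (Omega : measurableType dO) (Q : probability Omega R)
    (A : 'M[R]_(M, N)) (X : {RV Q >-> N.-tuple R}) (Z : {RV Q >-> M.-tuple R})
    (Theta : 'M[R]_(M, N)) : \bar R :=
  'E_Q[fun w => let Y := colv (observation A (X w) (Z w)) in
    sqnorm2 (Theta^T *m Y - (Theta_star A (cov_mx X) (cov_mx Z))^T *m Y)]%E.

End model.

(* Convergence in probability of [U M] to the deterministic [c M]: since the
   target may move with M, it is the difference that tends to 0. The U M may
   live on different probability spaces. *)
Definition cvg_in_probability (R : realType) (d : nat -> measure_display)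
    (T : forall M, measurableType (d M)) (P : forall M, probability (T M) R)
    (U : forall M, T M -> \bar R) (c : nat -> R) : Prop :=
  forall e : R, 0 < e ->
    P M [set w | (e%:E <= `|U M w - (c M)%:E|)%E] @[M --> \oo] --> 0%E.

(* Main.v *)
Require Import Defs.
From mathcomp Require Import measurable_realfun.
From mathcomp Require Import perm ring lra.

Set Implicit Arguments.
Unset Strict Implicit.
Unset Printing Implicit Defensive.

Import Order.TTheory GRing.Theory Num.Theory numFieldNormedType.Exports.

Local Open Scope classical_set_scope.
Local Open Scope ring_scope.

(** Let Theta be the optimal estimator and whiten the samples: if
    K C_YY K^T = 1 and J C_EE J^T = 1, then W = Y K^T and
    G = (X - Y Theta) J^T have independent standard Gaussian entries and, off
    the null event that W^T W is singular, the excess risk is tr (G^T H G C)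
    with H = W (W^T W)^-2 W^T and tr C = tr C_EE.  Conditionally on W its mean
    is tr C tr H and its variance is 2 tr (C^2) tr (H^2).
    Replace W^T W by W^T W + l, with inverse R.  Gaussian integration by parts
    yields a closed system of inequalities for E tr R, E (tr R)^2 and E tr R^2,
    so that the second moment of the regularised form around c tr C, where
    c = gamma / (1 - gamma), is at most (tr C)^2 times a quantity depending
    only on n, M and l.  After l -> 0 (Fatou) this quantity tends to 0 as
    M -> oo, and Chebyshev's inequality concludes.  Laws are identified through
    the integrals of cos (<t, V> + c). *)

(** The obstacle is that inverse moments of [W^T W] are not known to be finite, nor [W^T W] to be
    almost surely invertible. For [l > 0] the entries of the resolvent are bounded by [1 / l], every
    function in play has polynomial growth, and integration by parts is legitimate; the terms with a
    factor [l] that it produces have a sign, and dropping them leaves bounds uniform in [l].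
    Invertibility is a by-product: a singular [W^T W] forces [tr R^2 >= l^-2]. No conditional
    expectation is formed: integrating by parts in the entries of [G] alone, along which [H] is
    constant, has the same effect. At [l = 0] the solutions of the system for [E tr R], [E (tr R)^2]
    and [E tr R^2] tend to [c], [c^2] and 0, so the second moment around [c] tends to
    [c^2 - 2 c c + c^2 = 0] after division by [(tr C)^2]. Since [tr (C^2) <= (tr C)^2], the
    dimension of [X] does not enter. Cosines with a phase replace complex characteristic functions.
    They follow directly from a definition of Gaussian vectors by linear forms, degenerate forms
    included, and they avoid joint densities. *)

Notation "mu .-intble f" := (mu.-integrable setT (EFin \o f))
  (at level 2, f at next level, format "mu .-intble  f").

(** * Integration *)

Section integral_toolkit.
Context d (T : measurableType d) (R : realType) (mu : {measure set T -> \bar R}).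
Implicit Types f g : T -> R.

Lemma intble_le f g : measurable_fun setT f -> (forall x, `|f x| <= `|g x|) ->
  mu.-intble g -> mu.-intble f.
Proof.
move=> mf fg ig; apply: le_integrable ig => //; first exact/measurable_EFinP.
by move=> x _ /=; rewrite lee_fin.
Qed.

Lemma intbleD f g : mu.-intble f -> mu.-intble g ->
  mu.-intble (fun x => f x + g x).
Proof. by move=> mf mg; apply: (integrableD _ mf mg). Qed.

Lemma intbleB f g : mu.-intble f -> mu.-intble g ->
  mu.-intble (fun x => f x - g x).
Proof. by move=> mf mg; apply: (integrableB _ mf mg). Qed.

Lemma intbleZ k f : mu.-intble f -> mu.-intble (fun x => k * f x).
Proof. by move=> mf; apply: (integrableZl _ k mf). Qed.

Lemma intble_sum I (s : seq I) (p : pred I) (h : I -> T -> R) :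
  (forall i, p i -> mu.-intble (h i)) ->
  mu.-intble (fun x => \sum_(i <- s | p i) h i x).
Proof.
move=> ih.
have -> : EFin \o (fun x => \sum_(i <- s | p i) h i x) =
    (fun x => \sum_(i <- s | p i) (h i x)%:E)%E.
  by apply/funext => x /=; rewrite sumEFin.
exact: integrable_sum.
Qed.

Lemma Rintegral_sum I (s : seq I) (p : pred I) (h : I -> T -> R) :
  (forall i, p i -> mu.-intble (h i)) ->
  \int[mu]_x (\sum_(i <- s | p i) h i x) = \sum_(i <- s | p i) \int[mu]_x h i x.
Proof.
move=> ih; elim: s => [|j s IH].
  under eq_Rintegral do rewrite big_nil.
  by rewrite big_nil Rintegral_cst// mul0r.
under eq_Rintegral do rewrite big_cons.
rewrite big_cons; case: ifPn => // pj.
rewrite RintegralD ?IH//; first exact: ih.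
exact: intble_sum.
Qed.

Lemma EFin_Rintegral f : mu.-intble f ->
  ((\int[mu]_x f x)%:E = \int[mu]_x (f x)%:E)%E.
Proof. by move=> fi; rewrite fineK//; exact: integrable_fin_num. Qed.

Lemma Rintegral_abs_le f g : mu.-intble f -> mu.-intble g ->
  (forall x, `|f x| <= g x) -> `|\int[mu]_x f x| <= \int[mu]_x g x.
Proof.
move=> fi gi fg; apply: le_trans (le_normr_Rintegral _ fi) _ => //.
apply: le_Rintegral => //.
exact: integrable_norm.
Qed.

End integral_toolkit.

Section probability_toolkit.
Context d (T : measurableType d) (R : realType) (P : probability T R).
Implicit Types f g : T -> R.

Lemma intble_bounded f K : measurable_fun setT f -> (forall x, `|f x| <= K) ->
  P.-intble f.
Proof.
move=> mf fK; apply: measurable_bounded_integrable => //.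
  by rewrite [X in (X < _)%E](@probability_setT _ _ _ P) ltry.
exists K; split; first exact: num_real.
by move=> y Ky x _ /=; rewrite (le_trans (fK x))// ltW.
Qed.

Lemma intble_cst k : P.-intble (fun _ => k).
Proof. exact: (@intble_bounded _ `|k|). Qed.

Lemma Rintegral_cst1 k : \int[P]_x k = k.
Proof. by rewrite Rintegral_cst// [X in fine X](@probability_setT _ _ _ P) mulr1. Qed.

Lemma Rintegral_indic A : measurable A -> (\int[P]_w \1_A w)%:E = P A.
Proof.
by move=> mA; rewrite EFin_Rintegral ?integral_indic ?setIT//; exact: integrable_indic.
Qed.

Lemma Rintegral_indic_RV d' (T' : measurableType d') (V : {RV P >-> T'}) B :
  measurable B -> (\int[P]_w \1_B (V w))%:E = P (V @^-1` B).
Proof.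
by move=> mB; rewrite -Rintegral_indic//; exact: measurable_funPTI.
Qed.

End probability_toolkit.

Lemma norm_indic (R : realType) (T : Type) (A : set T) x : `|\1_A x : R| <= 1.
Proof. by rewrite indicE; case: (_ \in _); rewrite ?normr1 ?normr0. Qed.

Lemma measurable_superlevel d (T : measurableType d) (R : realType) (f : T -> R) s :
  measurable_fun setT f -> measurable [set x | s <= f x].
Proof.
move=> mf; rewrite -[X in measurable X]setTI.
have := mf measurableT `[s, +oo[%classic (measurable_itv _).
by congr (measurable (_ `&` _)); apply/seteqP; split => x /=; rewrite in_itv/= andbT.
Qed.

#[global] Hint Extern 0 (is_true (integrable _ _ (EFin \o (fun _ => _)))) => solve [exact: intble_cst] : core.

Section normal.
Variable R : realType.
Implicit Types m s : R.
Local Notation leb := (@lebesgue_measure R).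

(** The Radon-Nikodym derivative of [normal_prob] is almost everywhere its density: both have the
    same integral over every measurable set. *)
Lemma ge0_integral_normal m s (f : R -> \bar R) :
  measurable_fun setT f -> (forall x, 0 <= f x)%E ->
  (\int[normal_prob m s]_x f x =
   \int[leb]_x (f x * (normal_pdf m s x)%:E))%E.
Proof.
move=> mf f0.
have dom := normal_prob_dominates m s.
rewrite -(Radon_Nikodym_SigmaFinite.change_of_variables dom)//=.
apply: ae_eq_integral => //.
- apply: emeasurable_funM => //; apply: (measurable_int leb).
  exact: Radon_Nikodym_SigmaFinite.f_integrable.
- apply: emeasurable_funM => //=; apply/measurableT_comp => //=.
  exact: measurable_normal_pdf.
- apply: ae_eqe_mul2l => /=.
  apply: integral_ae_eq => //=.
  + exact: Radon_Nikodym_SigmaFinite.f_integrable.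
  + by apply/measurableT_comp =>//; exact: measurable_normal_pdf.
  + by move=> E _ mE; rewrite -Radon_Nikodym_SigmaFinite.f_integral.
Qed.

Lemma intble_normal m s (f : R -> R) : measurable_fun setT f ->
  leb.-intble (fun x => f x * normal_pdf m s x) ->
  (normal_prob m s).-intble f.
Proof.
move=> mf /integrableP[_ fi]; apply/integrableP; split.
  exact/measurable_EFinP.
rewrite ge0_integral_normal//=; last first.
  by apply/measurable_EFinP/measurableT_comp.
move: fi; congr (_ < _)%E; apply: eq_integral => x _ /=.
by rewrite normrM [X in _ * X]ger0_norm ?normal_pdf_ge0// EFinM.
Qed.

Lemma intble_normalV m s (f : R -> R) :
  (normal_prob m s).-intble f ->
  leb.-intble (fun x => f x * normal_pdf m s x).
Proof.
move=> /integrableP[/measurable_EFinP mf fi]; apply/integrableP; split.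
  by apply/measurable_EFinP; apply: measurable_funM => //; exact: measurable_normal_pdf.
move: fi; rewrite ge0_integral_normal//=; last first.
  by apply/measurable_EFinP/measurableT_comp.
congr (_ < _)%E; apply: eq_integral => x _ /=.
by rewrite normrM [X in _ = (_ * X)%:E]ger0_norm ?normal_pdf_ge0// EFinM.
Qed.

Lemma Rintegral_normal m s (f : R -> R) : (normal_prob m s).-intble f ->
  \int[normal_prob m s]_x f x = \int[leb]_x (f x * normal_pdf m s x).
Proof.
move=> fi; have fli := intble_normalV fi; rewrite /Rintegral; congr fine.
have [/measurable_EFinP mf _] := integrableP _ _ _ fi.
rewrite integralE [in RHS]integralE; congr (_ - _)%E.
- rewrite ge0_integral_normal//; last exact/measurable_funepos/measurable_EFinP.
  apply: eq_integral => x _; rewrite !funeposE/= -!EFin_max -EFinM; congr EFin.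
  by rewrite [RHS]maxC maxr_pMl ?normal_pdf_ge0// mul0r maxC.
- rewrite ge0_integral_normal//; last exact/measurable_funeneg/measurable_EFinP.
  apply: eq_integral => x _; rewrite !funenegE/= -!EFin_max -EFinM; congr EFin.
  by rewrite [RHS]maxC maxr_pMl ?normal_pdf_ge0// mul0r mulNr maxC.
Qed.

Lemma expr_le_expR (q : nat) (a : R) : 0 < a ->
  exists2 C, 0 < C & forall y, 0 <= y -> (1 + y) ^+ q <= C * expR (a * y).
Proof.
(* As [b <= 1], [(1 + y) * b <= 1 + b * y <= expR (b * y)]; as [q * b <= a], the [q]-th power of the
   right side is at most [expR (a * y)]. The denominator [q.+1] covers [q = 0]. *)
move=> a0; pose b := Num.min 1 (a / q.+1%:R).
have b0 : 0 < b by rewrite lt_min ltr01 divr_gt0.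
have b1 : b <= 1 by rewrite ge_min lexx.
exists (b ^- q) => [|y y0]; first by rewrite invr_gt0 exprn_gt0.
rewrite mulrC ler_pdivlMr ?exprn_gt0// -exprMn.
have h : (1 + y) * b <= expR (b * y).
  by apply: le_trans (expR_ge1Dx _); rewrite mulrDl mul1r (mulrC y) lerD2r.
apply: (@le_trans _ _ (expR (b * y) ^+ q)).
  by rewrite lerXn2r// ?nnegrE ?expR_ge0// mulr_ge0 ?addr_ge0// ltW.
rewrite -expRM_natl ler_expR mulrA ler_wpM2r//.
apply: (@le_trans _ _ (q%:R * (a / q.+1%:R))).
  by rewrite ler_wpM2l// ge_min lexx orbT.
by rewrite mulrCA ger_pMr// ler_pdivrMr// mul1r ler_nat.
Qed.

(** Half of the Gaussian exponent absorbs the polynomial; the other half is, up to a constant, the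
    density with standard deviation [Num.sqrt 2 * s]. *)
Lemma normal_poly_bound m s (q : nat) : s != 0 ->
  exists2 C, 0 < C & forall x,
    (1 + (x - m) ^+ 2) ^+ q * normal_pdf m s x <= C * normal_pdf m (Num.sqrt 2 * s) x.
Proof.
move=> s0.
have s20 : Num.sqrt 2 * s != 0 by rewrite mulf_neq0// sqrtr_eq0 -ltNge.
have a0 : 0 < (s ^+ 2 *+ 4)^-1 by rewrite invr_gt0 pmulrn_lgt0// exprn_even_gt0.
have [C C0 Ch] := expr_le_expR q a0.
exists (C * normal_peak s / normal_peak (Num.sqrt 2 * s)) => [|x].
  by rewrite divr_gt0 ?mulr_gt0 ?normal_peak_gt0.
rewrite (normal_pdfE _ s0) (normal_pdfE _ s20)/= [leRHS]mulrA divfK; last by rewrite gt_eqF// normal_peak_gt0.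
rewrite mulrCA [C * _]mulrC -[leRHS]mulrA ler_wpM2l ?normal_peak_ge0//.
apply: (@le_trans _ _ (C * expR ((s ^+ 2 *+ 4)^-1 * (x - m) ^+ 2) * normal_fun m s x)).
  by rewrite ler_wpM2r ?normal_fun_ge0// Ch// sqr_ge0.
rewrite -mulrA ler_wpM2l ?(ltW C0)// /normal_fun -expRD ler_expR exprMn sqr_sqrtr//.
rewrite le_eqVlt; apply/orP; left; apply/eqP.
rewrite -(mulr_natr (s ^+ 2) 4) -(mulr_natr (s ^+ 2) 2) -(mulr_natr (2 * _) 2).
by field.
Qed.

Lemma intble_normal_poly m s (q : nat) : s != 0 ->
  (normal_prob m s).-intble (fun x => (1 + (x - m) ^+ 2) ^+ q).
Proof.
move=> s0; apply: intble_normal => //.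
  by apply: measurable_funX; apply: measurable_funD => //; apply: measurable_funX; exact: measurable_funB.
have [C C0 h] := normal_poly_bound m q s0.
apply: (@intble_le _ _ _ leb _ (fun x => C * normal_pdf m (Num.sqrt 2 * s) x)).
- apply: measurable_funM; last exact: measurable_normal_pdf.
  by apply: measurable_funX; apply: measurable_funD => //; apply: measurable_funX; exact: measurable_funB.
- move=> x; rewrite ger0_norm ?mulr_ge0 ?normal_pdf_ge0 ?exprn_ge0// ?addr_ge0 ?sqr_ge0//.
  by rewrite (le_trans (h x))// ler_norm.
- apply: intbleZ; exact: integrable_normal_pdf.
Qed.

End normal.

(** * Stein's identity on the line *)

Section derive_rules.
Variable R : realType.
Implicit Types f g : R -> R.

Lemma is_derive_mul f g (x : R) (df dg : R) : is_derive x 1 f df -> is_derive x 1 g dg ->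
  is_derive x 1 (fun y => f y * g y) (df * g x + f x * dg).
Proof.
move=> hf hg; have := is_deriveM hf hg.
by rewrite /GRing.scale/= addrC [g x * df]mulrC.
Qed.

Lemma is_derive_add f g (x : R) (df dg : R) : is_derive x 1 f df -> is_derive x 1 g dg ->
  is_derive x 1 (fun y => f y + g y) (df + dg).
Proof. by move=> hf hg; exact: is_deriveD. Qed.

Lemma is_derive_scal (k : R) f (x : R) (df : R) : is_derive x 1 f df ->
  is_derive x 1 (fun y => k * f y) (k * df).
Proof. by move=> hf; have := is_deriveZ k hf. Qed.

Lemma is_derive_comp f g (x : R) (a b : R) : is_derive (g x) 1 f a -> is_derive x 1 g b ->
  is_derive x 1 (fun y => f (g y)) (a * b).
Proof. exact: is_derive1_comp. Qed.

Lemma is_derive_affine (a b x : R) : is_derive x 1 (fun y => a * y + b) a.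
Proof.
have h1 : is_derive x 1 (fun y : R => a * y) (a * 1).
  by apply: is_derive_scal; exact: is_derive_id.
have := is_derive_add h1 (is_derive_cst b x (1 : R)).
by rewrite mulr1 addr0.
Qed.

Lemma is_derive_continuous f (df : R -> R) : (forall x : R, is_derive x 1 f (df x)) ->
  continuous f.
Proof.
move=> h x; apply: differentiable_continuous; apply/derivable1_diffP.
by have [] := h x.
Qed.

End derive_rules.

Section stein.
Variable R : realType.
Variables m s : R.
Hypothesis s0 : s != 0.
Local Notation leb := (@lebesgue_measure R).
Local Notation N := (normal_prob m s).

Lemma is_derive_normal_pdf (x : R) :
  is_derive x 1 (normal_pdf m s) (- ((x - m) / s ^+ 2) * normal_pdf m s x).
Proof.
rewrite (normal_pdfE m s0) -[X in is_derive _ _ X](_ : (fun y => normal_peak s * expR (- (y - m) ^+ 2 / (s ^+ 2 *+ 2))) = _)//.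
have -> : - ((x - m) / s ^+ 2) * (normal_peak s * normal_fun m s x) =
  normal_peak s * (normal_fun m s x * ((- (s ^+ 2 *+ 2)^-1) * (1 * (x - m) + (x - m) * 1))).
  by rewrite -(mulr_natr _ 2); field.
have h : is_derive x 1 (fun y : R => y - m) 1.
  have := is_derive_affine 1 (- m) x.
  by under eq_fun do rewrite mul1r.
have h2 : is_derive x 1 (fun y => - (y - m) ^+ 2 / (s ^+ 2 *+ 2))
    ((- (s ^+ 2 *+ 2)^-1) * (1 * (x - m) + (x - m) * 1)).
  have -> : (fun y => - (y - m) ^+ 2 / (s ^+ 2 *+ 2)) =
      (fun y => (- (s ^+ 2 *+ 2)^-1) * ((y - m) * (y - m))).
    by apply/funext => y; rewrite expr2 mulNr mulrC mulNr.
  exact: is_derive_scal (is_derive_mul h h).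
exact: is_derive_scal (is_derive_comp (is_derive_expR _) h2).
Qed.

Variables (f f' : R -> R) (q : nat) (K : R).
Hypothesis ff' : forall x : R, is_derive x 1 f (f' x).
Hypothesis cf' : continuous f'.
Hypothesis fK : forall x, `|f x| <= K * (1 + (x - m) ^+ 2) ^+ q.
Hypothesis f'K : forall x, `|f' x| <= K * (1 + (x - m) ^+ 2) ^+ q.

Let cf : continuous f. Proof. exact: is_derive_continuous ff'. Qed.

Let Q x : R := 1 + (x - m) ^+ 2.
Let Q1 x : 1 <= Q x. Proof. by rewrite lerDl sqr_ge0. Qed.
Let Q0 x : 0 < Q x. Proof. exact: lt_le_trans (Q1 x). Qed.

Let K0 : 0 <= K.
Proof.
have := le_trans (normr_ge0 _) (fK m).
by rewrite subrr expr0n/= addr0 expr1n mulr1.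
Qed.

Lemma intble_stein_r : N.-intble f'.
Proof.
apply: (@intble_le _ _ _ N _ (fun x => K * Q x ^+ q)).
- exact: continuous_measurable_fun.
- by move=> x; apply: le_trans (f'K x) (ler_norm _).
- by apply: intbleZ; exact: intble_normal_poly.
Qed.

Lemma intble_stein_l : N.-intble (fun x => (x - m) * f x).
Proof.
apply: (@intble_le _ _ _ N _ (fun x => K * Q x ^+ q.+1)).
- apply: measurable_funM; first exact: measurable_funB.
  exact: continuous_measurable_fun.
- move=> x; apply: le_trans (ler_norm _); rewrite normrM exprS mulrCA.
  apply: ler_pM => //; rewrite /Q.
  have : 0 <= (`|x - m| - 1) ^+ 2 by rewrite sqr_ge0.
  have := normr_ge0 (x - m).
  by rewrite -(@real_normK _ (x - m)) ?num_real//; nra.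
- by apply: intbleZ; exact: intble_normal_poly.
Qed.

Let p := normal_pdf m s.
Let h x := f' x * p x + f x * (- ((x - m) / s ^+ 2) * p x).

Let hint : leb.-intble h.
Proof.
have -> : h = fun x => f' x * p x - (s ^+ 2)^-1 * ((x - m) * f x * p x).
  by apply/funext => x; rewrite /h; field.
apply: intbleB; first exact: (intble_normalV intble_stein_r).
by apply: intbleZ; exact: (intble_normalV intble_stein_l).
Qed.

Let dfp (x : R) : is_derive x 1 (fun y => f y * p y) (h x).
Proof. by apply: is_derive_mul => //; exact: is_derive_normal_pdf. Qed.

Let ch : continuous h.
Proof.
have cp := @continuous_normal_pdf _ m _ s0.
move=> x; apply: (@continuousD _ _ _ (fun x => f' x * p x) (fun x => f x * (- ((x - m) / s ^+ 2) * p x))).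
  by apply: continuousM; [exact: cf'|exact: cp].
apply: continuousM; first exact: cf.
apply: continuousM; last exact: cp.
apply: continuousN; apply: continuousM; last exact: cst_continuous.
by apply: continuousB => //; exact: cst_continuous.
Qed.

Let FTC a b : a < b ->
  (\int[leb]_(x in `[a, b]) (h x)%:E)%E = (f b * p b - f a * p a)%:E.
Proof.
move=> ab; rewrite EFinB; apply: (@continuous_FTC2 _ _ (fun y => f y * p y)) => //.
- exact/continuous_subspaceT.
- have cfp : continuous (fun y => f y * p y) by exact: is_derive_continuous dfp.
  split.
  + by move=> x _; case: (dfp x).
  + by apply: cvg_at_right_filter; exact: cfp.
  + by apply: cvg_at_left_filter; exact: cfp.
- by move=> x _; rewrite derive1E; case: (dfp x).
Qed.

(** Spending the power [q.+1] on the Gaussian leaves a spare factor [Q x], hence a decay that kills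
    the boundary terms. *)
Let tail : exists2 C, 0 <= C & forall x, `|f x * p x| <= C / Q x.
Proof.
have [C C0 hC] := normal_poly_bound m q.+1 s0.
exists (K * (C * normal_peak (Num.sqrt 2 * s))) => [|x].
  by rewrite !mulr_ge0 ?normal_peak_ge0// ltW.
rewrite ler_pdivlMr// normrM.
apply: (@le_trans _ _ (K * Q x ^+ q * `|p x| * Q x)).
  by rewrite ler_wpM2r ?(ltW (Q0 x))// ler_wpM2r.
rewrite (ger0_norm (normal_pdf_ge0 _ _ _)) -!mulrA ler_wpM2l//.
rewrite [p x * _]mulrC mulrA -exprSr; apply: le_trans (hC x) _.
rewrite ler_wpM2l ?(ltW C0)// normal_pdf_ub//.
by rewrite mulf_neq0// sqrtr_eq0 -ltNge.
Qed.

(** [h] is the derivative of [f p]. Over an interval centred at [m] its integral is a difference of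
    boundary values, small by [tail]; dominated convergence with bound [|h|] passes to the whole
    line. Stein's identity is this equality spelt out, because [p' = - (x - m) / s^2 * p]. *)
Let int_h0 : \int[leb]_x h x = 0.
Proof.
pose I (n : nat) : set R := [set` `[m - n.+1%:R, m + n.+1%:R]].
pose g n x : \bar R := ((h \_ (I n)) x)%:E.
have mh : measurable_fun setT h by exact: continuous_measurable_fun.
have [] := @dominated_convergence _ _ _ leb setT measurableT g (EFin \o h)
  (fun x => `|h x|%:E).
- move=> n; apply/measurable_EFinP; apply/measurable_restrict => //.
    exact: measurable_itv.
  exact: measurable_funTS.
- exact/measurable_EFinP.
- apply/aeW => x _; apply: cvg_near_cst.
  have [k hk] : exists k : nat, `|x - m| <= k%:R.
    by exists (Num.truncn `|x - m|).+1; rewrite ltW// truncnS_gt.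
  near=> n; rewrite /g patchE mem_set// /I/= in_itv/=.
  have : `|x - m| <= n.+1%:R.
    by apply: le_trans hk _; rewrite ler_nat; near: n; exists k => // n /= /leqW.
  by rewrite ler_norml => /andP[]; lra.
- exact: (integrable_norm hint).
- apply/aeW => x n _; rewrite /g patchE; case: ifPn => _ //=.
  by rewrite normr0 lee_fin.
move=> _ _; have -> : [sequence (\int[leb]_x g n x)%E]_n =
  (fun n : nat => (f (m + n.+1%:R) * p (m + n.+1%:R) - f (m - n.+1%:R) * p (m - n.+1%:R))%:E).
  apply/funext => n /=; rewrite -FTC; last first.
    have : (0 : R) < n.+1%:R by rewrite ltr0n.
    by lra.
  rewrite [RHS]integral_mkcond; apply: eq_integral => x _.
  by rewrite /g !patchE; case: ifPn.
move=> cv; rewrite /Rintegral -[RHS]/(fine 0%E); congr fine.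
apply: cvg_unique cv _ => //.
apply/cvg_EFin; first exact: nearW.
have [C C0 hC] := tail.
apply: norm_cvg0.
apply: (@squeeze_cvgr _ _ _ _ (cst 0) (fun n => (C + C) * n.+1%:R^-1)); last 2 first.
- exact: cvg_cst.
- rewrite -[X in _ --> X](mulr0 (C + C)); apply: cvgM; first exact: cvg_cst.
  exact: cvg_harmonic.
apply: nearW => n /=; rewrite normr_ge0/=.
have H x : (x - m) ^+ 2 = n.+1%:R ^+ 2 -> `|f x * p x| <= C * n.+1%:R^-1.
  move=> e; apply: le_trans (hC _) _; rewrite ler_wpM2l// lef_pV2 ?posrE//.
  rewrite /Q e expr2; have : (1 : R) <= n.+1%:R by rewrite ler1n.
  by nra.
rewrite (le_trans (ler_normB _ _))// mulrDl lerD// H//; last first.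
  by rewrite addrAC subrr sub0r sqrrN.
by rewrite addrAC subrr add0r.
Unshelve. all: end_near. Qed.

Lemma stein_normal :
  \int[N]_x ((x - m) * f x) = s ^+ 2 * \int[N]_x f' x.
Proof.
have := int_h0.
have i1 := intble_normalV intble_stein_r.
have i2 := intble_normalV intble_stein_l.
have -> : h = fun x => f' x * p x - (s ^+ 2)^-1 * ((x - m) * f x * p x).
  by apply/funext => x; rewrite /h; field.
rewrite RintegralB//; last exact: intbleZ.
rewrite RintegralZl// -(Rintegral_normal intble_stein_r) -(Rintegral_normal intble_stein_l).
move/eqP; rewrite subr_eq0 => /eqP ->; rewrite mulrA divff ?mul1r// expf_neq0//.
Qed.

End stein.

Section transfer.
Context d d' (T : measurableType d) (T' : measurableType d') (R : realType).
Variables (mu : {measure set T -> \bar R}) (nu : {measure set T' -> \bar R}).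
Variables (U : T -> T') (mU : measurable_fun setT U).
Hypothesis law : forall B, measurable B -> mu (U @^-1` B) = nu B.

Lemma ge0_integral_law (f : T' -> \bar R) : measurable_fun setT f ->
  (forall y, 0 <= f y)%E -> (\int[mu]_x f (U x) = \int[nu]_y f y)%E.
Proof.
move=> mf f0.
transitivity (\int[pushforward mu U]_y f y)%E.
  by rewrite ge0_integral_pushforward.
by apply: eq_measure_integral => B mB _; rewrite -law.
Qed.

Lemma intble_law (f : T' -> R) : nu.-intble f -> mu.-intble (fun x => f (U x)).
Proof.
move=> /integrableP[mf fi]; apply/integrableP; split.
  exact: (measurableT_comp mf mU).
by rewrite (ge0_integral_law (f := fun y => `|(f y)%:E|%E))//; exact: measurableT_comp.
Qed.

Lemma intble_lawV (f : T' -> R) : measurable_fun setT f ->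
  mu.-intble (fun x => f (U x)) -> nu.-intble f.
Proof.
move=> mf /integrableP[_ fi]; apply/integrableP; split.
  exact/measurable_EFinP.
rewrite -(ge0_integral_law (f := fun y => `|(f y)%:E|%E))//.
by apply: measurableT_comp => //; exact/measurable_EFinP.
Qed.

(** Positive and negative parts are transferred separately, so both sides agree even where the real
    integral is a default value. *)
Lemma Rintegral_law (f : T' -> R) : measurable_fun setT f ->
  \int[mu]_x f (U x) = \int[nu]_y f y.
Proof.
move=> mf; rewrite /Rintegral; congr fine.
rewrite integralE [in RHS]integralE; congr (_ - _)%E.
- have := @ge0_integral_law (fun y => (f y)%:E)^\+%E => <-//; last first.
    exact/measurable_funepos/measurable_EFinP.
  by apply: eq_integral => x _; rewrite !funeposE.
- have := @ge0_integral_law (fun y => (f y)%:E)^\-%E => <-//; last first.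
    exact/measurable_funeneg/measurable_EFinP.
  by apply: eq_integral => x _; rewrite !funenegE.
Qed.

End transfer.

(** * Characteristic functions of normal laws *)

Section normal_cos.
Variable R : realType.
Variables m s : R.
Hypothesis s0 : s != 0.
Local Notation N := (normal_prob m s).

Let mcos t c : measurable_fun setT (fun x : R => cos (t * (x - m) + c)).
Proof.
apply: continuous_measurable_fun => x.
apply: (@continuous_comp _ _ _ (fun x => t * (x - m) + c) cos); last exact: continuous_cos.
apply: continuousD; last exact: cst_continuous.
apply: continuousM; first exact: cst_continuous.
by apply: continuousB => //; exact: cst_continuous.
Qed.

Let dcos c (t x : R) : is_derive t 1 (fun t => cos (t * (x - m) + c)) (- (x - m) * sin (t * (x - m) + c)).
Proof.
have h1 : is_derive t 1 (fun t => t * (x - m) + c) (x - m).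
  have := is_derive_affine (x - m) c t.
  by under eq_fun do rewrite mulrC.
have := is_derive_comp (is_derive_cos _) h1.
by rewrite !mulNr mulrC.
Qed.

Let psi c t := \int[N]_x cos (t * (x - m) + c).

(** Differentiation under the integral, dominated by [|x - m|], brings down [- (x - m) * sin];
    Stein's identity turns this back into a multiple of the cosine, which closes a linear
    differential equation in [t]. *)
Let dpsi c (t : R) : is_derive t 1 (psi c) (- (s ^+ 2 * t) * psi c t).
Proof.
have dF (t' x : R) : partial1of2 (fun t x => cos (t * (x - m) + c)) t' x = - (x - m) * sin (t' * (x - m) + c).
  by rewrite partial1of2E; case: (dcos c t' x).
have -> : - (s ^+ 2 * t) * psi c t = \int[N]_x ((x - m) * (- sin (t * (x - m) + c))).
  have dsin (x : R) : is_derive x 1 (fun x => - sin (t * (x - m) + c)) (- t * cos (t * (x - m) + c)).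
    have h1 : is_derive x 1 (fun x => t * (x - m) + c) t.
      have := is_derive_affine t (- (t * m) + c) x.
      by under eq_fun do rewrite addrA -mulrBr.
    have := is_derive_scal (-1) (is_derive_comp (is_derive_sin _) h1).
    rewrite mulN1r mulrC -mulNr.
    by under [in X in X -> _]eq_fun do rewrite mulN1r.
  rewrite (@stein_normal _ m s s0 (fun x => - sin (t * (x - m) + c)) (fun x => - t * cos (t * (x - m) + c)) 0 (`|t| + 1)) => //.
  - rewrite RintegralZl ?mulrA ?mulrN//.
    by apply: (@intble_bounded _ _ _ N _ 1) => [|?]; [exact: mcos|exact: cos_max].
  - move=> x; apply: (@continuousM _ _ (fun=> - t) (fun x => cos (t * (x - m) + c))); first exact: cst_continuous.
    apply: (@continuous_comp _ _ _ (fun x => t * (x - m) + c) cos); last exact: continuous_cos.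
    apply: continuousD; last exact: cst_continuous.
    apply: continuousM; first exact: cst_continuous.
    by apply: continuousB => //; exact: cst_continuous.
  - move=> x; rewrite expr0 mulr1 normrN (le_trans (sin_max _))// lerDr//.
  - move=> x; rewrite expr0 mulr1 normrM normrN.
    by rewrite (@le_trans _ _ `|t|) ?lerDl// ler_piMr// cos_max.
have tI : `]t - 1, t + 1[%classic t by rewrite /= in_itv/=; apply/andP; lra.
have iF x : N.-intble (fun y => cos (x * (y - m) + c)).
  by apply: (@intble_bounded _ _ _ N _ 1) => [|?]; [exact: mcos|exact: cos_max].
have iG : N.-intble (fun x => `|x - m|).
  apply: (@intble_le _ _ _ N _ (fun x => (1 + (x - m) ^+ 2) ^+ 1)).
  - by apply: measurableT_comp => //; exact: measurable_funB.
  - move=> x; rewrite normr_id [leRHS]ger0_norm; last by rewrite expr1 addr_ge0// sqr_ge0.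
    have : 0 <= (`|x - m| - 1) ^+ 2 by rewrite sqr_ge0.
    have := normr_ge0 (x - m).
    by rewrite expr1 -(@real_normK _ (x - m)) ?num_real//; nra.
  - exact: intble_normal_poly.
have dF1 : forall x y : R, `]t - 1, t + 1[%classic x -> [set: R] y ->
  derivable (fun x : R => cos (x * (y - m) + c)) x 1.
  by move=> x y _ _; case: (dcos c x y).
have dFG : forall x y : R, `]t - 1, t + 1[%classic x -> [set: R] y ->
    `|partial1of2 (fun t x : R => cos (t * (x - m) + c)) x y| <= `|y - m|.
  by move=> x y _ _; rewrite dF normrM normrN ler_piMr// sin_max.
apply: DeriveDef.
  exact: (@derivable_under_integral _ _ _ N (fun t x => cos (t * (x - m) + c)) setT
    measurableT t (t - 1) (t + 1) tI (fun x _ => iF x) dF1 (fun x => `|x - m|)).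
rewrite -derive1E.
rewrite (@differentiation_under_integral _ _ _ N (fun t x => cos (t * (x - m) + c)) setT
    measurableT t (t - 1) (t + 1) tI (fun x _ => iF x) dF1 (fun x => `|x - m|))//.
by apply: eq_Rintegral => x _; rewrite dF mulNr mulrN.
Qed.

(** By [dpsi], the product of [psi c t] and [expR (s^2 t^2 / 2)] has zero derivative, and its value
    at [t = 0] is [cos c]. The phase stands in for a complex exponential: [c = 0] and [c = - pi / 2]
    give the real and the imaginary part. *)
Lemma normal_cos t c :
  \int[N]_x cos (t * (x - m) + c) = expR (- (s ^+ 2 * t ^+ 2 / 2)) * cos c.
Proof.
pose chi (t : R) := psi c t * expR (s ^+ 2 / 2 * (t * t)).
have dchi (x : R) : is_derive x 1 chi 0.
  have h : is_derive x 1 (fun t : R => s ^+ 2 / 2 * (t * t)) (s ^+ 2 / 2 * (1 * x + x * 1)).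
    apply: is_derive_scal.
    exact: is_derive_mul (is_derive_id _ _) (is_derive_id _ _).
  have := is_derive_mul (dpsi c x) (is_derive_comp (is_derive_expR _) h).
  by rewrite [X in is_derive _ _ _ X](_ : _ = 0)//; field.
have : chi t = chi 0 := is_derive_0_is_cst t 0 dchi.
rewrite /chi mulr0 mulr0 expR0 mulr1 /psi.
under [X in _ = X -> _]eq_Rintegral do rewrite mul0r add0r.
rewrite Rintegral_cst1 => <-.
rewrite mulrCA -expRD.
have -> : - (s ^+ 2 * t ^+ 2 / 2) + s ^+ 2 / 2 * (t * t) = 0 by field.
by rewrite expR0 mulr1.
Qed.

(** Stein's identity for the constant 1 yields the mean; the next lemma prepares it for [x - m],
    which yields the variance. *)
Let one_hyps (x : R) : [/\ is_derive x 1 (fun=> 1 : R) (0 : R),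
  `|1 : R| <= 1 * (1 + (x - m) ^+ 2) ^+ 0 & `|0 : R| <= 1 * (1 + (x - m) ^+ 2) ^+ 0].
Proof.
by split; [exact: is_derive_cst|rewrite expr0 mulr1 normr1|rewrite expr0 normr0 mulr1].
Qed.

Let sq_hyps (x : R) : [/\ is_derive x 1 (fun x => x - m) 1,
  `|x - m| <= 1 * (1 + (x - m) ^+ 2) ^+ 1 & `|1 : R| <= 1 * (1 + (x - m) ^+ 2) ^+ 1].
Proof.
split.
- have := is_derive_affine 1 (- m) x.
  by under eq_fun do rewrite mul1r.
- have : 0 <= (`|x - m| - 1) ^+ 2 by rewrite sqr_ge0.
  have := normr_ge0 (x - m).
  by rewrite mul1r expr1 -(@real_normK _ (x - m)) ?num_real//; nra.
- by rewrite normr1 expr1 mul1r lerDl sqr_ge0.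
Qed.

Let i1 : N.-intble (fun x => (x - m) * 1).
Proof.
have h1 x := let: And3 a _ _ := one_hyps x in a.
have h2 x := let: And3 _ a _ := one_hyps x in a.
exact: (intble_stein_l s0 h1 h2).
Qed.

Lemma intble_normal1 : N.-intble (fun x => x).
Proof.
have -> : (fun x => x) = (fun x => (x - m) * 1 + m) by apply/funext => x; rewrite mulr1 subrK.
exact: intbleD.
Qed.

Lemma normal_mean : \int[N]_x x = m.
Proof.
transitivity (\int[N]_x ((x - m) * 1 + m)).
  by apply: eq_Rintegral => x _; rewrite mulr1 subrK.
have h1 x := let: And3 a _ _ := one_hyps x in a.
have h2 x := let: And3 _ a _ := one_hyps x in a.
have h3 x := let: And3 _ _ a := one_hyps x in a.
rewrite RintegralD// Rintegral_cst1 (stein_normal s0 h1 _ h2 h3)//.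
  by rewrite Rintegral_cst1 mulr0 add0r.
by move=> x; exact: cst_continuous.
Qed.

Lemma intble_normal2 : N.-intble (fun x => (x - m) * (x - m)).
Proof.
have h1 x := let: And3 a _ _ := sq_hyps x in a.
have h2 x := let: And3 _ a _ := sq_hyps x in a.
exact: (intble_stein_l s0 h1 h2).
Qed.

Lemma normal_variance : \int[N]_x ((x - m) * (x - m)) = s ^+ 2.
Proof.
have h1 x := let: And3 a _ _ := sq_hyps x in a.
have h2 x := let: And3 _ a _ := sq_hyps x in a.
have h3 x := let: And3 _ _ a := sq_hyps x in a.
rewrite (stein_normal s0 h1 _ h2 h3)//.
  by rewrite Rintegral_cst1 mulr1.
by move=> x; exact: cst_continuous.
Qed.

End normal_cos.

Section gaussian_law.
Context d (T : measurableType d) (R : realType) (P : probability T R).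
Variables (U : T -> R) (m s : R).
Hypothesis mU : measurable_fun setT U.
Hypothesis law : forall B, measurable B -> P [set w | B (U w)] = gaussian_law m s B.

Let deg : s = 0 -> forall f : R -> R, measurable_fun setT f ->
  P.-intble (fun w => f (U w)) /\ \int[P]_w f (U w) = f m.
Proof.
move=> s0 f mf.
have law0 B : measurable B -> P (U @^-1` B) = dirac m B.
  by move=> mB; rewrite [LHS]law// /gaussian_law s0 eqxx.
split.
  apply: (intble_law mU law0).
  apply/integrableP; split; first exact/measurable_EFinP.
  rewrite integral_dirac//; last by apply: measurableT_comp => //; exact/measurable_EFinP.
  by rewrite diracT mul1e ltry.
rewrite (Rintegral_law mU law0 mf) /Rintegral integral_dirac//; last exact/measurable_EFinP.
by rewrite diracT mul1e.
Qed.

Let mU' : measurable_fun setT (U : T -> measurableTypeR R).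
Proof. exact: mU. Qed.

Let ndeg : s != 0 -> forall B : set (measurableTypeR R), measurable B -> P (U @^-1` B) = normal_prob m s B.
Proof. by move=> s0 B mB; rewrite [LHS]law// /gaussian_law (negbTE s0). Qed.

Lemma gaussian_intble1 : P.-intble U.
Proof.
have [s0|s0] := eqVneq s 0.
  by have [] := deg s0 (f := fun x => x).
exact: (intble_law mU' (ndeg s0) (intble_normal1 m s0)).
Qed.

Lemma gaussian_mean : \int[P]_w U w = m.
Proof.
have [s0|s0] := eqVneq s 0.
  by have [] := deg s0 (f := fun x => x).
by rewrite (Rintegral_law mU' (ndeg s0) (f := fun x => x))// normal_mean.
Qed.

Hypothesis m0 : \int[P]_w U w = 0.
Let mE : m = 0. Proof. by rewrite -gaussian_mean. Qed.

Lemma gaussian_intble2 : P.-intble (fun w => U w * U w).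
Proof.
have mm : measurable_fun setT (fun x : R => x * x) by exact: measurable_funM.
have [s0|s0] := eqVneq s 0.
  by have [] := deg s0 mm.
have := intble_normal2 m s0; rewrite mE.
under [X in _.-intble X -> _]eq_fun do rewrite !subr0.
by rewrite -mE; exact: (intble_law mU' (ndeg s0)).
Qed.

Lemma gaussian_variance : \int[P]_w (U w * U w) = s ^+ 2.
Proof.
have mm : measurable_fun setT (fun x : R => x * x) by exact: measurable_funM.
have [s0|s0] := eqVneq s 0.
  by have [_ ->] := deg s0 mm; rewrite mE mulr0 s0 expr0n.
rewrite (Rintegral_law mU' (ndeg s0) mm) -(normal_variance m s0).
by apply: eq_Rintegral => x _; rewrite mE !subr0.
Qed.

Lemma gaussian_cos c : \int[P]_w cos (U w + c) = expR (- (s ^+ 2 / 2)) * cos c.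
Proof.
have mm : measurable_fun setT (fun x : R => cos (x + c)).
  apply: continuous_measurable_fun => x.
  apply: (@continuous_comp _ _ _ (fun x => x + c) cos); last exact: continuous_cos.
  by apply: continuousD => //; exact: cst_continuous.
have [s0|s0] := eqVneq s 0.
  have [_ ->] := deg s0 mm.
  by rewrite mE s0 expr0n mul0r oppr0 expR0 mul1r add0r.
rewrite (Rintegral_law mU' (ndeg s0) mm).
have := normal_cos m s0 1 c; rewrite expr1n mulr1 => <-.
by apply: eq_Rintegral => x _; rewrite mE subr0 mul1r.
Qed.

End gaussian_law.

Lemma measurable_cos (R : realType) : measurable_fun setT (@cos R).
Proof. by apply: continuous_measurable_fun; exact: continuous_cos. Qed.

Lemma measurable_cosf d (T : measurableType d) (R : realType) (f : T -> R) :
  measurable_fun setT f -> measurable_fun setT (fun x => cos (f x)).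
Proof. by move=> mf; apply: measurableT_comp => //; exact: measurable_cos. Qed.

Lemma cvg_Rintegral_bounded d (T : measurableType d) (R : realType)
    (P : probability T R) (f_ : nat -> T -> R) (f : T -> R) (K : R) :
  (forall n, measurable_fun setT (f_ n)) -> measurable_fun setT f ->
  (forall n x, `|f_ n x| <= K) -> (forall x, f_ n x @[n --> \oo] --> f x) ->
  \int[P]_x f_ n x @[n --> \oo] --> \int[P]_x f x.
Proof.
move=> mf_ mf fK ff.
have [] := @dominated_convergence _ _ _ P setT measurableT
  (fun n x => (f_ n x)%:E) (EFin \o f) (fun=> K%:E).
- by move=> n; exact/measurable_EFinP.
- exact/measurable_EFinP.
- by apply/aeW => x _; apply/cvg_EFin; [exact: nearW|exact: ff].
- exact: (intble_cst P K).
- by apply/aeW => x n _ /=; rewrite lee_fin.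
move=> fi _ cv; apply: fine_cvg; rewrite fineK//.
exact: integrable_fin_num.
Qed.

Lemma measurable_sum_fun d (T : measurableType d) (R : realType) I (s : seq I)
    (h : I -> T -> R) : (forall i, measurable_fun setT (h i)) ->
  measurable_fun setT (fun x => \sum_(i <- s) h i x).
Proof.
move=> mh; elim: s => [|i s IH].
  by rewrite [X in measurable_fun _ X](_ : _ = cst 0)//; apply/funext => x; rewrite big_nil.
rewrite [X in measurable_fun _ X](_ : _ = fun x => h i x + \sum_(j <- s) h j x); last first.
  by apply/funext => x; rewrite big_cons.
exact: measurable_funD.
Qed.

Lemma measurable_prod_fun d (T : measurableType d) (R : realType) I (s : seq I)
    (h : I -> T -> R) : (forall i, measurable_fun setT (h i)) ->
  measurable_fun setT (fun x => \prod_(i <- s) h i x).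
Proof.
move=> mh; elim: s => [|i s IH].
  by rewrite [X in measurable_fun _ X](_ : _ = cst 1)//; apply/funext => x; rewrite big_nil.
rewrite [X in measurable_fun _ X](_ : _ = fun x => h i x * \prod_(j <- s) h j x); last first.
  by apply/funext => x; rewrite big_cons.
exact: measurable_funM.
Qed.

(** * Fubini's theorem for real-valued integrals *)

Section Rfubini.
Context d1 d2 (T1 : measurableType d1) (T2 : measurableType d2) (R : realType).
Variables (m1 : {sigma_finite_measure set T1 -> \bar R}).
Variables (m2 : {sigma_finite_measure set T2 -> \bar R}).
Variable f : T1 * T2 -> R.
Hypothesis fi : (m1 \x m2)%E.-intble f.

Lemma Rintegral_prod12 : (forall x, m2.-intble (fun y => f (x, y))) ->
  \int[(m1 \x m2)%E]_z f z = \int[m1]_x \int[m2]_y f (x, y).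
Proof.
move=> i2; rewrite /Rintegral; congr fine.
rewrite -[LHS](@integral12_prod_meas1 _ _ _ _ _ m1 m2 (EFin \o f))//.
by apply: eq_integral => x _; symmetry; exact: EFin_Rintegral.
Qed.

Lemma Rintegral_prod21 : (forall y, m1.-intble (fun x => f (x, y))) ->
  \int[(m1 \x m2)%E]_z f z = \int[m2]_y \int[m1]_x f (x, y).
Proof.
move=> i2; rewrite /Rintegral; congr fine.
rewrite -[LHS](@integral21_prod_meas1 _ _ _ _ _ m1 m2 (EFin \o f))//.
by apply: eq_integral => x _; symmetry; exact: EFin_Rintegral.
Qed.

End Rfubini.

Section Rfubini_dom.
Context d1 d2 (T1 : measurableType d1) (T2 : measurableType d2) (R : realType).
Variables (P : probability T1 R).
Variables (m2 : {sigma_finite_measure set T2 -> \bar R}).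
Variables (f : T1 * T2 -> R) (h : T2 -> R).
Hypothesis mf : measurable_fun setT f.
Hypothesis hi : m2.-intble h.
Hypothesis fh : forall x y, `|f (x, y)| <= h y.

Let mf2 x : measurable_fun setT (fun y => f (x, y)).
Proof. exact: (measurableT_comp mf (pair1_measurable x)). Qed.

Let mf1 y : measurable_fun setT (fun x => f (x, y)).
Proof. exact: (measurableT_comp mf (pair2_measurable y)). Qed.

Lemma intble_dom2 x : m2.-intble (fun y => f (x, y)).
Proof. by apply: intble_le hi => // y; rewrite (le_trans (fh _ _))// ler_norm. Qed.

Lemma intble_dom1 y : P.-intble (fun x => f (x, y)).
Proof. exact: (@intble_bounded _ _ _ P _ (h y)). Qed.

(** A bound by a function of [y] alone suffices because [P] has mass one. *)
Lemma intble_dom_prod : (P \x m2)%E.-intble f.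
Proof.
apply/integrable12ltyP; first exact/measurable_EFinP.
apply: (@le_lt_trans _ _ (\int[P]_x (\int[m2]_y (h y)%:E))%E).
  apply: ge0_le_integral => //.
  - by move=> x _; apply: integral_ge0.
  - apply: (measurable_fun_fubini_tonelli_F (fun z => `|(f z)%:E|%E)) => //.
    by apply: measurableT_comp => //; exact/measurable_EFinP.
  - move=> x _; apply: ge0_le_integral => //=.
    + by apply/measurable_EFinP; apply: measurableT_comp.
    + exact: (measurable_int m2 hi).
    + by move=> y _; rewrite lee_fin.
rewrite integral_cst// [X in (_ * X)%E](@probability_setT _ _ _ P) mule1.
apply: (@integrable_lty _ _ _ m2 setT) => //.
Qed.

Lemma Rfubini_dom : \int[P]_x \int[m2]_y f (x, y) = \int[m2]_y \int[P]_x f (x, y).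
Proof.
rewrite -Rintegral_prod12//; [|exact: intble_dom_prod|exact: intble_dom2].
by rewrite Rintegral_prod21//; [exact: intble_dom_prod|exact: intble_dom1].
Qed.

Lemma measurable_Rfubini : measurable_fun setT (fun x => \int[m2]_y f (x, y)).
Proof.
have mF := measurable_fubini_F (m1 := P) (m2 := m2) (f := EFin \o f) intble_dom_prod.
by apply: (measurableT_comp (f := fine) _ mF); exact: fine_measurable.
Qed.

End Rfubini_dom.

(** * Uniqueness of laws from trigonometric integrals *)

Section trig_kernel.
Variable R : realType.
Local Notation leb := (@lebesgue_measure R).
Implicit Types a b v x : R.

(** Half-open intervals match the generator [ocitv] of the Borel sets used in [law_unique]. *)
Definition ind a b x : R := ((a < x <= b)%R)%:R.

Lemma ind01 a b x : 0 <= ind a b x <= 1.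
Proof. by rewrite /ind ler0n lern1 leq_b1. Qed.

Lemma norm_ind a b x : `|ind a b x| <= 1.
Proof. by have /andP[h0 h1] := ind01 a b x; rewrite ger0_norm. Qed.

Lemma indE a b : ind a b = \1_[set` `]a, b]] :> (R -> R).
Proof.
by apply/funext => x; rewrite /ind indicE/= mem_setE in_itv.
Qed.

Lemma measurable_ind a b : measurable_fun setT (ind a b).
Proof. by rewrite indE; exact: measurable_indic. Qed.

Lemma normal_fun_le1 e v x : normal_fun v e x <= 1.
Proof.
rewrite /normal_fun -expR0 ler_expR mulNr oppr_le0 mulr_ge0 ?sqr_ge0//.
by rewrite invr_ge0 mulrn_wge0// sqr_ge0.
Qed.

(** The Gaussian function is its own characteristic function, so a Gaussian kernel is a mixture of
    cosines of [v - x]. This is the bridge from trigonometric integrals to indicators. *)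
Lemma normal_fun_trig e v x : e != 0 ->
  normal_fun v e x = \int[normal_prob 0 1]_g cos (g / e * (v - x)).
Proof.
move=> e0; have := normal_cos 0 (oner_neq0 R) ((v - x) / e) 0.
rewrite cos0 mulr1 expr1n mul1r => h.
transitivity (expR (- (((v - x) / e) ^+ 2 / 2))).
  rewrite /normal_fun; congr expR.
  by rewrite -(mulr_natr _ 2); field.
rewrite -h; apply: eq_Rintegral => g _; congr cos.
by rewrite subr0 addr0; field.
Qed.

(** The convolution of the indicator with a normal density of standard deviation [e]. *)
Definition smooth_ind e a b v : R :=
  \int[leb]_x (ind a b x * normal_pdf v e x).

Lemma intble_ind_pdf e a b v : leb.-intble (fun x => ind a b x * normal_pdf v e x).
Proof.
apply: (@intble_le _ _ _ leb _ (normal_pdf v e)).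
- by apply: measurable_funM; [exact: measurable_ind|exact: measurable_normal_pdf].
- by move=> x; rewrite normrM ler_piMl// norm_ind.
- exact: integrable_normal_pdf.
Qed.

Lemma smooth_indE e a b v : smooth_ind e a b v = \int[normal_prob v e]_x ind a b x.
Proof.
rewrite [RHS]Rintegral_normal//.
apply: (@intble_bounded _ _ _ (normal_prob v e) _ 1).
  exact: measurable_ind.
exact: norm_ind.
Qed.

Lemma smooth_ind_bound e a b v : `|smooth_ind e a b v| <= 1.
Proof.
have mi := measurable_ind a b.
rewrite smooth_indE -[leRHS](Rintegral_cst1 (normal_prob v e)).
apply: Rintegral_abs_le => //.
  apply: (@intble_bounded _ _ _ (normal_prob v e) _ 1) => //; exact: norm_ind.
exact: norm_ind.
Qed.

(* Chebyshev around the centre [v] of the kernel. *)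
Lemma smooth_ind_dist e r a b v : e != 0 -> 0 < r ->
  (forall x, `|x - v| <= r -> ind a b x = ind a b v) ->
  `|smooth_ind e a b v - ind a b v| <= e ^+ 2 / r ^+ 2.
Proof.
move=> e0 r0 h.
have ii : (normal_prob v e).-intble (ind a b).
  apply: (@intble_bounded _ _ _ (normal_prob v e) _ 1) => //; last exact: norm_ind.
  exact: measurable_ind.
rewrite smooth_indE -(Rintegral_cst1 (normal_prob v e) (ind a b v)) -RintegralB//.
have -> : e ^+ 2 / r ^+ 2 = \int[normal_prob v e]_x (r ^- 2 * ((x - v) * (x - v))).
  rewrite RintegralZl//; last exact: intble_normal2.
  by rewrite normal_variance// mulrC.
apply: Rintegral_abs_le; first exact: intbleB.
  by apply: intbleZ; exact: intble_normal2.
move=> x; have [xr|xr] := leP `|x - v| r.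
  by rewrite h// subrr normr0 mulr_ge0 ?invr_ge0 ?sqr_ge0// -expr2 sqr_ge0.
apply: (@le_trans _ _ 1).
  have /andP[? ?] := ind01 a b x; have /andP[? ?] := ind01 a b v.
  by rewrite ler_norml; apply/andP; lra.
rewrite mulrC ler_pdivlMr ?exprn_gt0// mul1r -expr2 -[leRHS]real_normK ?num_real//.
by rewrite lerXn2r ?nnegrE// ltW.
Qed.

(** Moving the interval to the right by [2 r] gives [v] a margin on the correct side of each end
    point: [v <= a] leaves [x <= a + r], and [v >= a + 4 r] leaves [x >= a + 3 r]. The half-open
    indicator is then approximated at every point, the end points included. *)
Lemma ind_shift a b v x r : 0 < r -> `|x - v| <= r ->
  (v <= a \/ a + r * 4 <= v) -> (v <= b \/ b + r * 4 <= v) ->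
  ind (a + r * 2) (b + r * 2) x = ind a b v.
Proof.
move=> r0; rewrite ler_norml => /andP[h1 h2] ha hb; rewrite /ind.
have -> : (a + r * 2 < x) = (a < v) by case: ha => ?; apply/idP/idP; lra.
by have -> : (x <= b + r * 2) = (v <= b) by case: hb => ?; apply/idP/idP; lra.
Qed.

(** The kernel width [(n + 1)^-2] is small against the margin [(n + 1)^-1], so the Chebyshev error
    [e^2 / r^2] is [(n + 1)^-2]. *)
Lemma cvg_smooth_ind a b v :
  smooth_ind (n.+1%:R ^- 2) (a + n.+1%:R^-1 * 2) (b + n.+1%:R^-1 * 2) v
    @[n --> \oo] --> ind a b v.
Proof.
have cn : (n.+1%:R^-1 : R) @[n --> \oo] --> (0 : R) by exact: cvg_harmonic.
have near_small (z : R) : 0 < z -> \forall n \near \oo, n.+1%:R^-1 <= z.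
  move=> z0; have /cvgr0_norm_le/(_ z z0) := cn.
  by apply: filterS => n; apply: le_trans; exact: ler_norm.
apply/subr_cvg0; apply: norm_cvg0.
apply: (@squeeze_cvgr _ _ _ _ (cst 0) (fun n => n.+1%:R^-1)); last 2 first.
- exact: cvg_cst.
- exact: cn.
have far (z : R) : \forall n \near \oo, v <= z \/ z + n.+1%:R^-1 * 4 <= v.
  have [vz|zv] := leP v z; first by apply: nearW => n; left.
  have z0 : 0 < (v - z) / 4 by rewrite divr_gt0// subr_gt0.
  apply: filterS (near_small _ z0) => n; rewrite ler_pdivlMr// => h; right.
  by rewrite addrC -lerBrDr.
have key : \forall n \near \oo, forall x, `|x - v| <= n.+1%:R^-1 ->
  ind (a + n.+1%:R^-1 * 2) (b + n.+1%:R^-1 * 2) x = ind a b v.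
  apply: filterS2 (far a) (far b) => n ha hb x xv.
  by apply: ind_shift => //; rewrite invr_gt0.
near=> n; rewrite normr_ge0/=.
have n0 : (0 : R) < n.+1%:R^-1 by rewrite invr_gt0.
have H : forall x, `|x - v| <= n.+1%:R^-1 ->
  ind (a + n.+1%:R^-1 * 2) (b + n.+1%:R^-1 * 2) x = ind a b v.
  by near: n.
have Hv : ind (a + n.+1%:R^-1 * 2) (b + n.+1%:R^-1 * 2) v = ind a b v.
  by apply: H; rewrite subrr normr0 ltW.
rewrite -Hv; apply: le_trans (smooth_ind_dist _ n0 _) _.
- by rewrite invr_neq0// expf_neq0// pnatr_eq0.
- by move=> x /H ->; rewrite Hv.
have -> : n.+1%:R ^- 2 ^+ 2 / n.+1%:R^-1 ^+ 2 = n.+1%:R^-1 * n.+1%:R^-1 :> R.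
  by field; rewrite nat1r pnatr_eq0.
by rewrite ler_piMl ?(ltW n0)// invf_le1// ler1n.
Unshelve. all: end_near. Qed.

End trig_kernel.

Section trig_to_ind.
Context d (T : measurableType d) (R : realType) (P : probability T R).
Local Notation leb := (@lebesgue_measure R).
Variables (U v : T -> R).
Hypotheses (mU : measurable_fun setT U) (mv : measurable_fun setT v).
Hypothesis U1 : forall w, `|U w| <= 1.

Let trig (s x : R) := \int[P]_w (U w * cos (s * (v w - x))).

Let trig_normal e x : e != 0 ->
  \int[P]_w (U w * normal_fun (v w) e x) = \int[normal_prob 0 1]_g trig (g / e) x.
Proof.
move=> e0.
rewrite -(@Rfubini_dom _ _ _ _ _ P (normal_prob 0 1)
  (fun z => U z.1 * cos (z.2 / e * (v z.1 - x))) (fun=> 1)) //=; first last.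
- move=> w g /=; rewrite normrM -[leRHS]mulr1 ler_pM//; exact: cos_max.
- apply: measurable_funM; first exact: (measurableT_comp mU measurable_fst).
  apply: measurable_cosf.
  apply: measurable_funM; first by apply: measurable_funM => //; exact: measurable_snd.
  by apply: measurable_funB => //; exact: (measurableT_comp mv measurable_fst).
apply: eq_Rintegral => w _; rewrite normal_fun_trig// RintegralZl//.
apply: (@intble_bounded _ _ _ (normal_prob 0 1) _ 1) => [|g]; last exact: cos_max.
apply: measurable_cosf.
by apply: measurable_funM => //; exact: measurable_funM.
Qed.

Let smooth_f e a b (z : T * measurableTypeR R) : R :=
  U z.1 * (ind a b z.2 * (normal_peak e * normal_fun (v z.1) e z.2)).

Let mnf e x : measurable_fun setT (fun w => normal_fun (v w) e x).
Proof.
apply: measurableT_comp => //; apply: measurable_funM => //; apply: measurableT_comp => //.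
by apply: measurable_funX; exact: measurable_funB.
Qed.

Let msf e a b : measurable_fun setT (smooth_f e a b).
Proof.
have mi := measurable_ind a b.
apply: measurable_funM; first exact: (measurableT_comp mU measurable_fst).
apply: measurable_funM; first exact: (measurableT_comp mi measurable_snd).
apply: measurable_funM => //; apply: measurableT_comp => //.
apply: measurable_funM => //; apply: measurableT_comp => //.
apply: measurable_funX; apply: measurable_funB; first exact: measurable_snd.
exact: (measurableT_comp mv measurable_fst).
Qed.

Let hi e a b : leb.-intble (fun x => normal_peak e * ind a b x).
Proof. by apply: intbleZ; rewrite indE; exact: integrable_indic_itv. Qed.

Let sfh e a b w x : `|smooth_f e a b (w, x)| <= normal_peak e * ind a b x.
Proof.
rewrite /smooth_f/= normrM -[leRHS]mul1r ler_pM// !normrM mulrC.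
have /andP[h0 _] := ind01 a b x.
rewrite (ger0_norm h0) ler_wpM2r// (ger0_norm (normal_peak_ge0 _)).
by rewrite ler_piMr ?normal_peak_ge0// ger0_norm ?normal_fun_ge0// normal_fun_le1.
Qed.

Let smooth_fE e a b w : e != 0 ->
  U w * smooth_ind e a b (v w) = \int[leb]_x smooth_f e a b (w, x).
Proof.
move=> e0; rewrite /smooth_ind -RintegralZl//; last exact: intble_ind_pdf.
by apply: eq_Rintegral => x _; rewrite normal_pdfE.
Qed.

Let trig_smooth e a b : e != 0 ->
  \int[P]_w (U w * smooth_ind e a b (v w)) =
  \int[leb]_x (ind a b x * (normal_peak e * \int[normal_prob 0 1]_g trig (g / e) x)).
Proof.
move=> e0.
transitivity (\int[P]_w \int[leb]_x smooth_f e a b (w, x)).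
  by apply: eq_Rintegral => w _; exact: smooth_fE.
rewrite (@Rfubini_dom _ _ _ _ _ P leb _ _ (msf e a b) (hi e a b) (sfh e a b)).
apply: eq_Rintegral => x _.
have i1 : P.-intble (fun w => U w * normal_fun (v w) e x).
  apply: (@intble_bounded _ _ _ P _ 1); first exact: measurable_funM.
  move=> w; rewrite normrM -[leRHS]mul1r ler_pM//.
  by rewrite ger0_norm ?normal_fun_ge0// normal_fun_le1.
rewrite -trig_normal// -RintegralZl// -RintegralZl//; last exact: intbleZ.
by apply: eq_Rintegral => w _; rewrite /smooth_f/=; ring.
Qed.

(** Two exchanges of integrals express the smoothed integral through [trig] alone. The bounded
    weight [U] is there for an induction on coordinates, where it carries the factors of the other
    coordinates. *)
Lemma cvg_trig_ind a b :
  \int[leb]_x (ind (a + n.+1%:R^-1 * 2) (b + n.+1%:R^-1 * 2) x *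
    (normal_peak (n.+1%:R ^- 2) *
     \int[normal_prob 0 1]_g trig (g / n.+1%:R ^- 2) x)) @[n --> \oo] -->
  \int[P]_w (U w * ind a b (v w)).
Proof.
have e0 (n : nat) : (n.+1%:R ^- 2 : R) != 0 by rewrite invr_neq0// expf_neq0// pnatr_eq0.
rewrite [X in X @ _ --> _](_ : _ = fun n : nat => \int[P]_w (U w *
  smooth_ind (n.+1%:R ^- 2) (a + n.+1%:R^-1 * 2) (b + n.+1%:R^-1 * 2) (v w))); last first.
  by apply/funext => n; rewrite trig_smooth.
apply: (@cvg_Rintegral_bounded _ _ _ _ _ _ 1).
- move=> n; under eq_fun do rewrite smooth_fE//.
  exact: (measurable_Rfubini P (msf _ _ _) (hi _ _ _) (sfh _ _ _)).
- apply: measurable_funM => //; apply: (measurableT_comp _ mv).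
  exact: measurable_ind.
- by move=> n x; rewrite normrM -[leRHS]mulr1 ler_pM// smooth_ind_bound.
- by move=> x; apply: cvgM; [exact: cvg_cst|exact: cvg_smooth_ind].
Qed.

End trig_to_ind.

Section uniqueness.
Context d d' (T : measurableType d) (T' : measurableType d') (R : realType).
Variables (P : probability T R) (P' : probability T' R).

(** The approximants of [cvg_trig_ind] see the weight and the variable only through the
    trigonometric integrals, and limits are unique. *)
Lemma trig_ind_eq (U v : T -> R) (U' v' : T' -> R) :
  measurable_fun setT U -> measurable_fun setT v ->
  measurable_fun setT U' -> measurable_fun setT v' ->
  (forall w, `|U w| <= 1) -> (forall w, `|U' w| <= 1) ->
  (forall s x, \int[P]_w (U w * cos (s * (v w - x))) =
               \int[P']_w (U' w * cos (s * (v' w - x)))) ->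
  forall a b, \int[P]_w (U w * ind a b (v w)) = \int[P']_w (U' w * ind a b (v' w)).
Proof.
move=> mU mv mU' mv' U1 U1' h a b.
pose F (phi : R -> R -> R) (n : nat) : R :=
  \int[lebesgue_measure]_x (ind (a + n.+1%:R^-1 * 2) (b + n.+1%:R^-1 * 2) x *
    (normal_peak (n.+1%:R ^- 2) * \int[normal_prob 0 1]_g phi (g / n.+1%:R ^- 2) x)).
pose phi s x := \int[P]_w (U w * cos (s * (v w - x))).
pose phi' s x := \int[P']_w (U' w * cos (s * (v' w - x))).
have c1 : F phi n @[n --> \oo] --> \int[P]_w (U w * ind a b (v w)).
  exact: cvg_trig_ind.
have c2 : F phi' n @[n --> \oo] --> \int[P']_w (U' w * ind a b (v' w)).
  exact: cvg_trig_ind.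
have e : phi = phi' by apply/funext => s; apply/funext => x; exact: h.
by rewrite e in c1; apply: cvg_unique c1 c2.
Qed.

Variables (k : nat) (V : T -> k.-tuple R) (V' : T' -> k.-tuple R).
Hypotheses (mV : measurable_fun setT V) (mV' : measurable_fun setT V').

Let lin (v : k.-tuple R) (s : seq ('I_k * R)) : R := \sum_(q <- s) q.2 * tnth v q.1.

Hypothesis charE : forall s c,
  \int[P]_w cos (lin (V w) s + c) = \int[P']_w cos (lin (V' w) s + c).

Let box (v : k.-tuple R) (s : seq ('I_k * R * R)) : R :=
  \prod_(p <- s) ind p.1.2 p.2 (tnth v p.1.1).

Let mlin s : measurable_fun setT (lin ^~ s).
Proof.
apply: measurable_sum_fun => q; apply: measurable_funM => //.
exact: measurable_tnth.
Qed.

Let mbox s : measurable_fun setT (box ^~ s).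
Proof.
apply: measurable_prod_fun => q.
by apply: measurableT_comp; [exact: measurable_ind|exact: measurable_tnth].
Qed.

Let box1 v s : `|box v s| <= 1.
Proof.
rewrite /box; elim: s => [|p s IH]; first by rewrite big_nil normr1.
by rewrite big_cons normrM -[leRHS]mulr1 ler_pM// norm_ind.
Qed.

(** Induction on the number of interval constraints: one at a time, a cosine is traded for an
    indicator by [trig_ind_eq]. The linear form [s2] and the phase [c] stay universally quantified
    because each step appends a frequency; linear forms are lists of pairs for the same reason. *)
Let boxE s1 : forall s2 c, \int[P]_w (box (V w) s1 * cos (lin (V w) s2 + c)) =
  \int[P']_w (box (V' w) s1 * cos (lin (V' w) s2 + c)).
Proof.
elim: s1 => [|p s1 IH] s2 c.
  rewrite /box; under eq_Rintegral do rewrite big_nil mul1r.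
  by under [RHS]eq_Rintegral do rewrite big_nil mul1r.
pose u v := box v s1 * cos (lin v s2 + c).
have mu : measurable_fun setT u.
  apply: measurable_funM; first exact: mbox.
  by apply: measurable_cosf; apply: measurable_funD => //; exact: mlin.
have u1 v : `|u v| <= 1 by rewrite normrM -[leRHS]mulr1 ler_pM// cos_max.
have mt := @measurable_tnth _ R k p.1.1.
transitivity (\int[P]_w (u (V w) * ind p.1.2 p.2 (tnth (V w) p.1.1))).
  by apply: eq_Rintegral => w _; rewrite /u /box big_cons; ring.
transitivity (\int[P']_w (u (V' w) * ind p.1.2 p.2 (tnth (V' w) p.1.1))); last first.
  by apply: eq_Rintegral => w _; rewrite /u /box big_cons; ring.
apply: trig_ind_eq => //.
- exact: (measurableT_comp mu mV).
- exact: (measurableT_comp mt mV).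
- exact: (measurableT_comp mu mV').
- exact: (measurableT_comp mt mV').
move=> s x.
(* product-to-sum: [2 cos A cos B = cos (A + B) + cos (A - B)] *)
have prodsum v : u v * cos (s * (tnth v p.1.1 - x)) =
    2^-1 * (box v s1 * cos (lin v ((p.1.1, s) :: s2) + (c - s * x)) +
            box v s1 * cos (lin v ((p.1.1, - s) :: s2) + (c + s * x))).
  rewrite /u /lin !big_cons /=.
  set A := s * (_ - x); set B := \sum_(_ <- _) _ + c.
  have -> : s * tnth v p.1.1 + \sum_(q <- s2) q.2 * tnth v q.1 + (c - s * x) = A + B.
    by rewrite /A /B; ring.
  have -> : - s * tnth v p.1.1 + \sum_(q <- s2) q.2 * tnth v q.1 + (c + s * x) = - A + B.
    by rewrite /A /B; ring.
  by rewrite !cosD cosN sinN; field.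
have ii d0 (T0 : measurableType d0) (P0 : probability T0 R) (V0 : T0 -> k.-tuple R) s0 c0 :
    measurable_fun setT V0 ->
    P0.-intble (fun w => box (V0 w) s1 * cos (lin (V0 w) s0 + c0)).
  move=> mV0; apply: (@intble_bounded _ _ _ P0 _ 1).
    apply: measurable_funM; first exact: (measurableT_comp (mbox s1) mV0).
    apply: measurable_cosf; apply: measurable_funD => //.
    exact: (measurableT_comp (mlin s0) mV0).
  by move=> w; rewrite normrM -[leRHS]mulr1 ler_pM// cos_max.
under eq_Rintegral do rewrite prodsum.
under [RHS]eq_Rintegral do rewrite prodsum.
rewrite !RintegralZl//; [|by apply: intbleD; exact: ii..].
rewrite !RintegralD//; [|exact: ii..].
by rewrite !IH.
Qed.

Let B0 (s : seq ('I_k * R * R)) : set (k.-tuple R) :=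
  [set v | forall p, p \in s -> p.1.2 < tnth v p.1.1 <= p.2].

Let box_indic s v : box v s = \1_(B0 s) v.
Proof.
rewrite indicE; have [vs|vs] := boolP (v \in B0 s).
  move: vs; rewrite inE /B0/= => vs; rewrite /box big1_seq// => p /andP[_ ps].
  by rewrite /ind vs.
have : ~~ all (fun p => p.1.2 < tnth v p.1.1 <= p.2) s.
  apply: contra vs => /allP h; rewrite inE; exact: h.
rewrite -has_predC => /hasP[p ps /= pv].
rewrite /box; move: ps; elim: s {vs} => // q s IH; rewrite inE big_cons.
by move=> /predU1P[<-|/IH ->]; rewrite ?mulr0// /ind (negbTE pv) mul0r.
Qed.

Let mB0 s : measurable (B0 s).
Proof.
have -> : B0 s = (box ^~ s) @^-1` [set 1].
  apply/seteqP; split => v; rewrite /= box_indic indicE.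
    by move=> h; rewrite mem_set.
  by case: (boolP (v \in B0 s)) => [/set_mem//|_ /esym/eqP]; rewrite oner_eq0.
by rewrite -[X in measurable X]setTI; apply: mbox.
Qed.

(** Boxes form a pi-system: concatenating lists intersects them and the empty list is the whole
    space. They generate the product sigma-algebra because a single constraint is the preimage of a
    half-open interval under a coordinate. Two measures that agree on them are equal. *)
Lemma law_unique : forall B, measurable B -> P (V @^-1` B) = P' (V' @^-1` B).
Proof.
pose G := [set B | exists s, B = B0 s].
have key : forall A, G A -> P (V @^-1` A) = P' (V' @^-1` A).
  move=> _ [s ->].
  have h d0 (T0 : measurableType d0) (P0 : probability T0 R) (V0 : T0 -> k.-tuple R) :
    measurable_fun setT V0 -> (\int[P0]_w (box (V0 w) s * cos (lin (V0 w) [::] + 0)))%:E = P0 (V0 @^-1` B0 s).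
    move=> mV0; have mp : measurable (V0 @^-1` B0 s).
      by rewrite -[X in measurable X]setTI; apply: mV0.
    rewrite (_ : (fun w => _) = \1_(V0 @^-1` B0 s)); last first.
      by apply/funext => w; rewrite /lin big_nil addr0 cos0 mulr1 box_indic.
    rewrite EFin_Rintegral; last exact: integrable_indic.
    by rewrite integral_indic// setIT.
  by rewrite -h// -h// boxE.
move=> B mB.
have mcoor (i : 'I_k) : measurable_fun (setT : set (g_sigma_algebraType G))
    (fun v => tnth v i : measurableTypeR R).
  apply: (@measurability _ _ _ _ _ _ (R.-ocitv.-measurable)) => //.
  move=> _ [_ [x _ <-] <-]; apply: sub_sigma_algebra; exists [:: (i, x.1, x.2)].
  apply/seteqP; split => v /=.
    by move=> [_]; rewrite in_itv/= => h p; rewrite inE => /eqP ->.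
  by move=> /(_ _ (mem_head _ _)) h; split=> //; rewrite in_itv.
have mG : measurable = <<s G >>.
  apply/seteqP; split; last first.
    apply: smallest_sub; first exact: sigma_algebra_measurable.
    by move=> _ [s ->]; exact: mB0.
  move=> A mA; have mid : measurable_fun (setT : set (g_sigma_algebraType G)) (id : _ -> k.-tuple R).
    by apply/measurable_fun_tnthP => i; exact: mcoor.
  by have := mid measurableT _ mA; rewrite setTI.
have GT : G setT.
  by exists [::]; apply/seteqP; split => v //= _ p; rewrite in_nil.
have GI : setI_closed G.
  move=> _ _ [s1 ->] [s2 ->]; exists (s1 ++ s2); apply/seteqP; split => v /=.
    by move=> [h1 h2] p; rewrite mem_cat => /orP[/h1|/h2].
  by move=> h; split=> p ps; apply: h; rewrite mem_cat ps ?orbT.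
have cov : \bigcup_(_ : nat) [set: k.-tuple R] = setT.
  by apply/seteqP; split => v // _; exists 0%N.
have fin (_ : nat) : (pushforward P V setT < +oo)%E.
  by rewrite /pushforward preimage_setT probability_setT ltry.
exact: (@measure_unique _ _ _ G (fun=> setT) mG GI (fun=> GT) cov
  (pushforward P V) (pushforward P' V') key fin B mB).
Qed.

End uniqueness.

(** * Standard Gaussian matrices *)

Section matrix_tuple.
Variables (R : realType) (m p : nat).

Definition tuplemx (t : (m * p).-tuple R) : 'M[R]_(m, p) :=
  vec_mx (\row_i tnth t i).

Definition mxtuple (v : 'M[R]_(m, p)) : (m * p).-tuple R :=
  [tuple mxvec v 0 i | i < m * p].

Lemma mxtupleK : cancel mxtuple tuplemx.
Proof.
move=> v; rewrite /tuplemx (_ : \row_i _ = mxvec v) ?mxvecK//.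
by apply/rowP => i; rewrite mxE tnth_mktuple.
Qed.

Lemma tuplemxE t i j : tuplemx t i j = tnth t (mxvec_index i j).
Proof. by rewrite /tuplemx !mxE. Qed.

Lemma tnth_mxtuple v i j : tnth (mxtuple v) (mxvec_index i j) = v i j.
Proof. by rewrite tnth_mktuple mxvecE. Qed.

(** Measurability of a function of a matrix is read on the flattened tuple, which carries the
    product sigma-algebra. *)
Definition mfun (f : 'M[R]_(m, p) -> R) := measurable_fun setT (f \o tuplemx).

Definition measurable_mx d (T : measurableType d) (V : T -> 'M[R]_(m, p)) :=
  forall i j, measurable_fun setT (fun w => V w i j).

Lemma measurable_mxtuple d (T : measurableType d) (V : T -> 'M[R]_(m, p)) :
  measurable_mx V -> measurable_fun setT (mxtuple \o V).
Proof.
move=> mV; apply/measurable_fun_tnthP => k.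
case: (mxvec_indexP k) => i j.
rewrite [X in measurable_fun _ X](_ : _ = fun w => V w i j)//.
by apply/funext => w /=; rewrite tnth_mxtuple.
Qed.

Lemma mfun_comp d (T : measurableType d) (V : T -> 'M[R]_(m, p)) f :
  mfun f -> measurable_mx V -> measurable_fun setT (fun w => f (V w)).
Proof.
move=> mf mV; rewrite [X in measurable_fun _ X](_ : _ = (f \o tuplemx) \o (mxtuple \o V)).
  by apply: measurableT_comp => //; exact: measurable_mxtuple.
by apply/funext => w /=; rewrite mxtupleK.
Qed.

Definition mdot (t v : 'M[R]_(m, p)) : R := \sum_i \sum_j t i j * v i j.

Definition char_std d (T : measurableType d) (P : probability T R)
    (V : T -> 'M[R]_(m, p)) :=
  forall t c, \int[P]_w cos (mdot t (V w) + c) = expR (- (mdot t t / 2)) * cos c.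

(** The standard Gaussian law is encoded by its characteristic function, which is what linear forms
    of the samples provide; by [law_unique] it determines the law. *)
Definition std_gauss d (T : measurableType d) (P : probability T R)
    (V : T -> 'M[R]_(m, p)) := measurable_mx V /\ char_std P V.

Definition shift_mx (i : 'I_m) (j : 'I_p) (v : 'M[R]_(m, p)) (x : R) :=
  v + x *: delta_mx i j.

Lemma shift_mxE i j v x i' j' :
  shift_mx i j v x i' j' = v i' j' + x * ((i' == i) && (j' == j))%:R.
Proof. by rewrite !mxE. Qed.

Lemma shift_mxD i j v x y : shift_mx i j (shift_mx i j v x) y = shift_mx i j v (x + y).
Proof. by rewrite /shift_mx scalerDl addrA. Qed.

Lemma mdotC (t v : 'M[R]_(m, p)) : mdot t v = mdot v t.
Proof. by apply: eq_bigr => i' _; apply: eq_bigr => j' _; rewrite mulrC. Qed.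

Lemma mdot_shift i j t v x : mdot t (shift_mx i j v x) = mdot t v + x * t i j.
Proof.
rewrite /mdot (eq_bigr (fun i' => \sum_j' t i' j' * v i' j' + (i' == i)%:R * (x * t i j))).
  rewrite big_split/= (bigD1 i)//= [X in _ + X](bigD1 i)//= eqxx mul1r.
  by rewrite [X in _ + (_ + X)]big1 ?addr0// => i' /negbTE ->; rewrite mul0r.
move=> i' _; rewrite (eq_bigr (fun j' => t i' j' * v i' j' + ((i' == i) && (j' == j))%:R * (x * t i j))).
  rewrite big_split/=; congr (_ + _); rewrite (bigD1 j)//= eqxx andbT big1 ?addr0//.
  by move=> j' /negbTE ->; rewrite andbF mul0r.
move=> j' _; rewrite shift_mxE mulrDr; congr (_ + _).
case: eqP => [->|_]; case: eqP => [->|_]; rewrite ?andbF ?mulr0 ?mulr1 ?mul0r ?mul1r//=.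
by rewrite mulrC.
Qed.

Lemma lin_mdot (s : seq ('I_(m * p) * R)) : exists t, forall v,
  \sum_(q <- s) q.2 * tnth (mxtuple v) q.1 = mdot t v.
Proof.
elim: s => [|[k a] s [t ht]].
  exists 0 => v; rewrite big_nil /mdot.
  by rewrite big1// => i _; rewrite big1// => j _; rewrite mxE mul0r.
case: (mxvec_indexP k) => i j.
exists (shift_mx i j t a) => v.
by rewrite big_cons ht /= tnth_mxtuple addrC [RHS]mdotC mdot_shift mdotC.
Qed.

Section law.
Context d d' (T : measurableType d) (T' : measurableType d').
Variables (P : probability T R) (P' : probability T' R).
Variables (V : T -> 'M[R]_(m, p)) (V' : T' -> 'M[R]_(m, p)).
Hypotheses (sV : std_gauss P V) (sV' : std_gauss P' V').

Let lawE B : measurable B ->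
  P ((mxtuple \o V) @^-1` B) = P' ((mxtuple \o V') @^-1` B).
Proof.
move: B; apply: law_unique; [exact: measurable_mxtuple sV.1|exact: measurable_mxtuple sV'.1|].
move=> s c; have [t ht] := lin_mdot s.
under eq_Rintegral do rewrite /= ht.
under [RHS]eq_Rintegral do rewrite /= ht.
by rewrite sV.2 sV'.2.
Qed.

Lemma Rintegral_std f : mfun f -> \int[P]_w f (V w) = \int[P']_w f (V' w).
Proof.
move=> mf; have mV := measurable_mxtuple sV.1; have mV' := measurable_mxtuple sV'.1.
have := Rintegral_law (nu := pushforward P' (mxtuple \o V')) mV lawE mf.
have := Rintegral_law (nu := pushforward P' (mxtuple \o V')) mV' (fun _ _ => erefl) mf.
rewrite /=; under eq_Rintegral do rewrite mxtupleK.
by move=> ->; under eq_Rintegral do rewrite mxtupleK.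
Qed.

Lemma intble_std f : mfun f -> P.-intble (fun w => f (V w)) ->
  P'.-intble (fun w => f (V' w)).
Proof.
move=> mf fi; have mV := measurable_mxtuple sV.1; have mV' := measurable_mxtuple sV'.1.
have h : (fun w => f (V' w)) = (fun w => (f \o tuplemx) ((mxtuple \o V') w)).
  by apply/funext => w /=; rewrite mxtupleK.
rewrite h; apply: (intble_law (nu := pushforward P' (mxtuple \o V')) mV' (fun _ _ => erefl)).
apply: (intble_lawV (nu := pushforward P' (mxtuple \o V')) mV lawE mf).
rewrite (_ : (fun x => _) = (fun w => f (V w)))//.
by apply/funext => w /=; rewrite mxtupleK.
Qed.

End law.

End matrix_tuple.

Section replace.
Variables (R : realType) (m p : nat).
Context d (T : measurableType d) (P : probability T R) (V : T -> 'M[R]_(m, p)).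
Hypothesis sV : std_gauss P V.
Variables (i : 'I_m) (j : 'I_p).
Local Notation N := (normal_prob (0 : R) 1).

Definition replace_mx (z : T * R) := shift_mx i j (V z.1) (z.2 - V z.1 i j).

Lemma measurable_replace_mx : measurable_mx (replace_mx : T * measurableTypeR R -> _).
Proof.
move=> i' j'; rewrite [X in measurable_fun _ X](_ : _ = fun z =>
   V z.1 i' j' + (z.2 - V z.1 i j) * ((i' == i) && (j' == j))%:R); last first.
  by apply/funext => z; rewrite shift_mxE.
have mV i0 j0 : measurable_fun setT (fun z : T * measurableTypeR R => V z.1 i0 j0).
  apply: (@measurableT_comp _ _ _ _ _ _ (fun w => V w i0 j0) _ fst) => //.
  exact: sV.1.
apply: measurable_funD => //; apply: measurable_funM => //.
by apply: measurable_funB => //; exact: measurable_snd.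
Qed.

(** Resampling one entry by a fresh normal variable keeps the law. This gives the product structure
    on which Fubini and the one-dimensional Stein identity act, without first splitting the matrix
    into independent entries. *)
Lemma replace_std : std_gauss (P \x N)%E (replace_mx : T * measurableTypeR R -> _).
Proof.
split; first exact: measurable_replace_mx.
move=> t c.
(* [t0] is [t] with the entry [(i, j)] erased, so the pairing splits into the fresh normal variable
   times [t i j] and a term that ignores the overwritten entry. *)
pose t0 := shift_mx i j t (- t i j).
have mdE z : mdot t (replace_mx z) + c = t i j * (z.2 - 0) + (mdot t0 (V z.1) + c).
  by rewrite mdot_shift mdotC /t0 (mdotC (shift_mx _ _ _ _)) mdot_shift subr0; ring.
have mf : measurable_fun setT (fun z : T * measurableTypeR R => cos (mdot t (replace_mx z) + c)).
  apply: measurable_cosf; apply: measurable_funD => //.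
  apply: measurable_sum_fun => i'; apply: measurable_sum_fun => j'.
  by apply: measurable_funM => //; exact: measurable_replace_mx.
have hi : N.-intble (fun=> 1 : R) by [].
have fh (x : T) (y : measurableTypeR R) : `|cos (mdot t (replace_mx (x, y)) + c)| <= 1 by exact: cos_max.
rewrite Rintegral_prod12; last 2 first.
- exact: (@intble_dom_prod _ _ _ _ _ P N _ _ mf hi fh).
- by move=> x; exact: (@intble_dom2 _ _ _ _ _ N _ _ mf hi fh).
transitivity (\int[P]_w (expR (- (t i j ^+ 2 / 2)) * cos (mdot t0 (V w) + c))).
  apply: eq_Rintegral => w _.
  under eq_Rintegral do rewrite mdE /=.
  by rewrite normal_cos ?oner_neq0// expr1n mul1r.
rewrite RintegralZl//; last first.
  apply: (@intble_bounded _ _ _ P _ 1) => [|?]; last exact: cos_max.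
  apply: measurable_cosf; apply: measurable_funD => //.
  apply: measurable_sum_fun => i'; apply: measurable_sum_fun => j'.
  by apply: measurable_funM => //; exact: sV.1.
rewrite sV.2 mulrA -expRD; congr (expR _ * _).
rewrite /t0 mdot_shift (mdotC (shift_mx _ _ _ _)) mdot_shift shift_mxE !eqxx mulr1.
by field.
Qed.

End replace.

(** * Integration by parts for standard Gaussian matrices *)

Section nice.
Variables (R : realType) (m p : nat).
Implicit Types (f g : 'M[R]_(m, p) -> R) (v : 'M[R]_(m, p)).

Definition qf v : R := 1 + mdot v v.

Lemma mdot_ge0 v : 0 <= mdot v v.
Proof. by apply: sumr_ge0 => i _; apply: sumr_ge0 => j _; rewrite -expr2 sqr_ge0. Qed.

Lemma qf_ge1 v : 1 <= qf v. Proof. by rewrite lerDl mdot_ge0. Qed.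
Lemma qf_gt0 v : 0 < qf v. Proof. exact: lt_le_trans (qf_ge1 v). Qed.

Lemma qf_replace i j v x : qf (shift_mx i j v (x - v i j)) <= qf v * (1 + x ^+ 2).
Proof.
rewrite /qf mdot_shift mdotC mdot_shift shift_mxE !eqxx mulr1.
have := mdot_ge0 v; have := sqr_ge0 x; have := sqr_ge0 (v i j).
by move: (mdot v v) (v i j) => D y; nra.
Qed.

(** An algebra of functions to which integration by parts applies: polynomial growth yields
    integrability, and continuity is asked only along single entries, since each fibre is treated as
    a function on the line. *)
Definition nice f := [/\ mfun f,
  exists K q, forall v, `|f v| <= K * qf v ^+ q &
  forall i j v, continuous (fun x => f (shift_mx i j v x))].

Lemma nice_growth f : nice f -> exists K q, 0 <= K /\
  forall v, `|f v| <= K * qf v ^+ q.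
Proof.
move=> [_ [K [q h]] _]; exists K, q; split=> //.
have := le_trans (normr_ge0 _) (h 0).
by rewrite pmulr_lge0// exprn_gt0// qf_gt0.
Qed.

Lemma nice_cst k : nice (fun=> k).
Proof.
split; first exact: measurable_cst.
- by exists `|k|, 0%N => v; rewrite expr0 mulr1.
- by move=> i j v x; exact: cst_continuous.
Qed.

Lemma mfun_entry i j : mfun (fun v => v i j).
Proof.
rewrite /mfun (_ : _ \o _ = fun t => tnth t (mxvec_index i j)).
  exact: measurable_tnth.
by apply/funext => t /=; rewrite tuplemxE.
Qed.

Lemma nice_entry i j : nice (fun v => v i j).
Proof.
split; first exact: mfun_entry.
- exists 1, 1%N => v; rewrite mul1r expr1.
  have h : (v i j) ^+ 2 <= mdot v v.
    rewrite /mdot (bigD1 i)//= (bigD1 j)//= -addrA -expr2 lerDl addr_ge0//.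
      by apply: sumr_ge0 => k _; rewrite -expr2 sqr_ge0.
    by apply: sumr_ge0 => k _; apply: sumr_ge0 => l _; rewrite -expr2 sqr_ge0.
  rewrite /qf; have : 0 <= (`|v i j| - 1) ^+ 2 by rewrite sqr_ge0.
  by have := normr_ge0 (v i j); rewrite -real_normK ?num_real// in h; nra.
- move=> i' j' v x.
  rewrite (_ : (fun x => _) = fun x => ((i == i') && (j == j'))%:R * x + v i j); last first.
    by apply/funext => y; rewrite shift_mxE addrC mulrC.
  exact: (is_derive_continuous (is_derive_affine _ _)).
Qed.

Lemma niceD f g : nice f -> nice g -> nice (fun v => f v + g v).
Proof.
move=> nf ng; have [K [q [K0 hK]]] := nice_growth nf.
have [L [r [L0 hL]]] := nice_growth ng.
case: nf ng => [mf _ cf] [mg _ cg]; split; first exact: measurable_funD.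
- exists (K + L), (q + r)%N => v; rewrite mulrDl (le_trans (ler_normD _ _))// lerD//.
    by rewrite (le_trans (hK v))// ler_wpM2l// ler_weXn2l ?qf_ge1// leq_addr.
  by rewrite (le_trans (hL v))// ler_wpM2l// ler_weXn2l ?qf_ge1// leq_addl.
- by move=> i j v x; apply: continuousD; [exact: cf|exact: cg].
Qed.

Lemma niceM f g : nice f -> nice g -> nice (fun v => f v * g v).
Proof.
move=> nf ng; have [K [q [K0 hK]]] := nice_growth nf.
have [L [r [L0 hL]]] := nice_growth ng.
case: nf ng => [mf _ cf] [mg _ cg]; split; first exact: measurable_funM.
- exists (K * L), (q + r)%N => v; rewrite normrM exprD mulrACA ler_pM//.
- by move=> i j v x; apply: continuousM; [exact: cf|exact: cg].
Qed.

Lemma niceZ k f : nice f -> nice (fun v => k * f v).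
Proof. by move=> nf; apply: niceM => //; exact: nice_cst. Qed.

Lemma niceN f : nice f -> nice (fun v => - f v).
Proof.
move=> nf; rewrite (_ : (fun v => _) = fun v => -1 * f v); first exact: niceZ.
by apply/funext => v; rewrite mulN1r.
Qed.

Lemma niceB f g : nice f -> nice g -> nice (fun v => f v - g v).
Proof. by move=> nf ng; apply: niceD => //; exact: niceN. Qed.

Lemma nice_sum I (s : seq I) (pr : pred I) (F : I -> 'M[R]_(m, p) -> R) :
  (forall i, nice (F i)) -> nice (fun v => \sum_(i <- s | pr i) F i v).
Proof.
move=> nF; elim: s => [|i s IH].
  rewrite (_ : (fun v => _) = fun=> 0); first exact: nice_cst.
  by apply/funext => v; rewrite big_nil.
case e: (pr i).
  rewrite (_ : (fun v => _) = fun v => F i v + \sum_(j <- s | pr j) F j v); first exact: niceD.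
  by apply/funext => v; rewrite big_cons e.
by rewrite (_ : (fun v => _) = fun v => \sum_(j <- s | pr j) F j v)//; apply/funext => v; rewrite big_cons e.
Qed.

End nice.

(** It reduces polynomial growth in all entries jointly to moments of single entries, which
    resampling makes normal moments. *)
Lemma sum_expr_bound (R : realType) (q : nat) (I : Type) (s : seq I) :
  exists2 C : R, 0 <= C & forall a : I -> R, (forall i, 0 <= a i) ->
  (1 + \sum_(i <- s) a i) ^+ q <= C * (1 + \sum_(i <- s) (1 + a i) ^+ q).
Proof.
have pm (x y : R) : 0 <= x -> 0 <= y -> (x + y) ^+ q <= 2 ^+ q * (x ^+ q + y ^+ q).
  wlog xy : x y / x <= y => [hw x0 y0|x0 y0].
    have /orP[xy|yx] := le_total x y; first exact: hw.
    by rewrite addrC [X in _ * X]addrC hw.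
  apply: (@le_trans _ _ ((2 * y) ^+ q)).
    by rewrite lerXn2r ?nnegrE ?addr_ge0// ?mulr_ge0//; lra.
  by rewrite exprMn ler_wpM2l ?exprn_ge0// lerDr exprn_ge0.
elim: s => [|k s [C C0 hC]].
  by exists 1 => // a _; rewrite !big_nil addr0 expr1n mulr1.
exists (2 ^+ q * (C + 1)) => [|a a0]; first by rewrite mulr_ge0 ?exprn_ge0 ?addr_ge0.
rewrite !big_cons addrCA addrC.
have S0 : 0 <= \sum_(i <- s) a i by apply: sumr_ge0.
have S1 : 0 <= \sum_(i <- s) (1 + a i) ^+ q.
  by apply: sumr_ge0 => i _; rewrite exprn_ge0// addr_ge0.
apply: le_trans (pm _ _ _ (a0 k)) _; first by rewrite addr_ge0.
rewrite -[leRHS]mulrA ler_wpM2l ?exprn_ge0//.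
have h1 := hC a a0.
have h2 : a k ^+ q <= (1 + a k) ^+ q.
  by rewrite lerXn2r ?nnegrE ?addr_ge0// lerDr.
have h3 : 0 <= a k ^+ q by rewrite exprn_ge0.
have := mulr_ge0 C0 (le_trans h3 h2).
by nra.
Qed.

Section stein_mx.
Variables (R : realType) (m p : nat).
Context d (T : measurableType d) (P : probability T R) (V : T -> 'M[R]_(m, p)).
Hypothesis sV : std_gauss P V.
Local Notation N := (normal_prob (0 : R) 1).

Let intble_entry q i j : P.-intble (fun w => (1 + V w i j ^+ 2) ^+ q).
Proof.
have mf : mfun (fun v : 'M[R]_(m, p) => (1 + v i j ^+ 2) ^+ q).
  apply: measurable_funX; apply: measurable_funD => //.
  by apply: measurable_funX; exact: mfun_entry.
apply: (intble_std (replace_std sV i j) sV mf).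
have hi : N.-intble (fun y => (1 + y ^+ 2) ^+ q).
  have := intble_normal_poly (0 : R) q (oner_neq0 R).
  by under [in X in X -> _]eq_fun do rewrite subr0.
apply: (@intble_dom_prod _ _ _ _ _ P N _ _ _ hi) => [|x y].
  apply: measurable_funX; apply: measurable_funD => //.
  by apply: measurable_funX; exact: (measurable_replace_mx sV).
rewrite /replace_mx shift_mxE !eqxx mulr1 /= subrKC.
by rewrite ger0_norm// exprn_ge0// addr_ge0// sqr_ge0.
Qed.

Lemma intble_nice f : nice f -> P.-intble (fun w => f (V w)).
Proof.
move=> nf; have [K [q [K0 hK]]] := nice_growth nf; have [mf _ _] := nf.
have [C C0 hC] := sum_expr_bound R q (index_enum ('I_m * 'I_p)%type).
apply: (@intble_le _ _ _ P _ (fun w => K * (C * (1 + \sum_(k : 'I_m * 'I_p) (1 + V w k.1 k.2 ^+ 2) ^+ q)))).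
- exact: mfun_comp sV.1.
- move=> w; apply: le_trans (hK _) _; apply: le_trans (ler_norm _).
  rewrite ler_wpM2l//; apply: le_trans (hC _ (fun k => sqr_ge0 (V w k.1 k.2))).
  by rewrite /qf /mdot pair_bigA.
- apply: intbleZ; apply: intbleZ; apply: intbleD => //.
  by apply: intble_sum => k _; exact: intble_entry.
Qed.

Lemma stein_mx i j f f' : nice f -> nice f' ->
  (forall v, is_derive (0 : R) 1 (fun x => f (shift_mx i j v x)) (f' v)) ->
  \int[P]_w (V w i j * f (V w)) = \int[P]_w f' (V w).
Proof.
move=> nf nf' ff'.
have sV' := replace_std sV i j.
have mf : mfun f by case: nf.
have mf' : mfun f' by case: nf'.
have ng : nice (fun v => v i j * f v) by apply: niceM => //; exact: nice_entry.
have mg : mfun (fun v => v i j * f v) by case: ng.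
rewrite (Rintegral_std sV sV' mg) (Rintegral_std sV sV' mf').
have ig := intble_std sV sV' mg (intble_nice ng).
have if' := intble_std sV sV' mf' (intble_nice nf').
(* Each fibre over [w] is a smooth function of polynomial growth of one
   normal variable, to which the one-dimensional identity applies. *)
pose F w x := f (replace_mx V i j (w, x)).
pose F' w x := f' (replace_mx V i j (w, x)).
(* The hypothesis gives a derivative at 0 from every base point; recentring at [x] makes it a
   derivative of the fibre at every point. *)
have dF w (x : R) : is_derive x 1 (F w) (F' w x).
  have h0 := ff' (replace_mx V i j (w, x)).
  have hx : is_derive x 1 (fun y : R => y - x) 1.
    have := is_derive_affine 1 (- x) x.
    by under eq_fun do rewrite mul1r.
  have h1 : is_derive (x - x) 1 (fun y => f (shift_mx i j (replace_mx V i j (w, x)) y)) (F' w x).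
    by rewrite subrr.
  have := @is_derive_comp _ (fun y => f (shift_mx i j (replace_mx V i j (w, x)) y)) (fun y => y - x) x _ _ h1 hx.
  rewrite mulr1.
  rewrite (_ : (fun y => _) = F w)//; apply/funext => y.
  by rewrite /F /replace_mx shift_mxD/=; congr (f (shift_mx _ _ _ _)); ring.
have cF' w : continuous (F' w).
  have [_ _ c'] := nf'; move=> x.
  have h := c' i j (shift_mx i j (V w) (- V w i j)).
  rewrite (_ : F' w = fun y => f' (shift_mx i j (shift_mx i j (V w) (- V w i j)) y)); first exact: h.
  by apply/funext => y; rewrite /F' /replace_mx shift_mxD/= addrC.
have [K [q [K0 hK]]] := nice_growth nf.
have [K' [q' [K0' hK']]] := nice_growth nf'.
pose L w := K * qf (V w) ^+ q + K' * qf (V w) ^+ q'.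
have x1 (x : R) : 1 <= 1 + (x - 0) ^+ 2 by rewrite lerDl sqr_ge0.
have x0 (x : R) : 0 <= 1 + (x - 0) ^+ 2 by rewrite (le_trans _ (x1 x)).
have bound w x (g : 'M[R]_(m, p) -> R) L1 r : 0 <= L1 -> (forall v, `|g v| <= L1 * qf v ^+ r) ->
    `|g (replace_mx V i j (w, x))| <= L1 * qf (V w) ^+ r * (1 + (x - 0) ^+ 2) ^+ r.
  move=> L10 h; apply: le_trans (h _) _; rewrite -mulrA ler_wpM2l// -exprMn.
  rewrite lerXn2r ?nnegrE ?mulr_ge0 ?(ltW (qf_gt0 _))//.
  by rewrite subr0; exact: qf_replace.
have q0 w r : 0 <= qf (V w) ^+ r by rewrite exprn_ge0// ltW// qf_gt0.
have bF w x : `|F w x| <= L w * (1 + (x - 0) ^+ 2) ^+ (q + q').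
  apply: le_trans (bound w x f K q K0 hK) _; apply: ler_pM.
  - by rewrite mulr_ge0.
  - by rewrite exprn_ge0.
  - by rewrite lerDl mulr_ge0.
  - by rewrite ler_weXn2l// leq_addr.
have bF' w x : `|F' w x| <= L w * (1 + (x - 0) ^+ 2) ^+ (q + q').
  apply: le_trans (bound w x f' K' q' K0' hK') _; apply: ler_pM.
  - by rewrite mulr_ge0.
  - by rewrite exprn_ge0.
  - by rewrite lerDr mulr_ge0.
  - by rewrite ler_weXn2l// leq_addl.
have eF w x : replace_mx V i j (w, x) i j * f (replace_mx V i j (w, x)) = (x - 0) * F w x.
  by rewrite {1}/replace_mx shift_mxE !eqxx mulr1 /= subrKC subr0.
rewrite Rintegral_prod12//; last first.
  move=> w; under eq_fun do rewrite eF.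
  exact: (intble_stein_l (oner_neq0 R) (dF w) (bF w)).
rewrite Rintegral_prod12//; last first.
  by move=> w; exact: (intble_stein_r (oner_neq0 R) (cF' w) (bF' w)).
apply: eq_Rintegral => w _.
under eq_Rintegral do rewrite eF.
by rewrite (stein_normal (oner_neq0 R) (dF w) (cF' w) (bF w) (bF' w)) expr1n mul1r.
Qed.

End stein_mx.

Section posdef.
Variable R : realType.

Definition posdef k (A : 'M[R]_k) :=
  A^T = A /\ forall u : 'rV[R]_k, u != 0 -> 0 < (u *m A *m u^T) 0 0.

Lemma mdot_tr m p (A B : 'M[R]_(m, p)) : mdot A B = \tr (A *m B^T).
Proof.
by rewrite /mdot; apply: eq_bigr => i _; rewrite mxE; apply: eq_bigr => j _; rewrite mxE.
Qed.

Lemma mdot_trC m p (A B : 'M[R]_(m, p)) : mdot A B = \tr (A^T *m B).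
Proof. by rewrite mdotC mdot_tr mxtrace_mulC. Qed.

Lemma mdot_row m (u : 'rV[R]_m) : mdot u u = (u *m u^T) 0 0.
Proof. by rewrite mdot_tr /mxtrace big_ord1. Qed.

Lemma mdot_gt0 m p (A : 'M[R]_(m, p)) : A != 0 -> 0 < mdot A A.
Proof.
move=> A0; rewrite lt_neqAle mdot_ge0 andbT; apply: contra A0 => /eqP e.
apply/eqP/matrixP => i j; rewrite mxE.
move/eqP: e; rewrite eq_sym psumr_eq0; last first.
  by move=> k _; apply: sumr_ge0 => l _; rewrite -expr2 sqr_ge0.
move=> /allP/(_ i (mem_index_enum _))/=; rewrite psumr_eq0; last first.
  by move=> k _; rewrite -expr2 sqr_ge0.
by move=> /allP/(_ j (mem_index_enum _))/=; rewrite mulf_eq0 orbb => /eqP.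
Qed.

Lemma posdef_unit k (A : 'M[R]_k) : posdef A -> A \in unitmx.
Proof.
move=> [_ pA]; rewrite -row_free_unit; apply: inj_row_free => v vA.
by apply/eqP/negPn/negP => /pA; rewrite vA mul0mx mxE ltxx.
Qed.

Lemma posdef_gram n m (W : 'M[R]_(n, m)) (l : R) : 0 < l ->
  posdef (W^T *m W + l%:M).
Proof.
move=> l0; split; first by rewrite linearD/= trmx_mul trmxK tr_scalar_mx.
move=> u u0; rewrite mulmxDr mulmxDl mxE.
have -> : u *m (W^T *m W) *m u^T = (u *m W^T) *m (u *m W^T)^T.
  by rewrite trmx_mul trmxK !mulmxA.
rewrite -mdot_row mul_mx_scalar -scalemxAl mxE -mdot_row.
by rewrite ltr_wpDl ?mdot_ge0// mulr_gt0// mdot_gt0.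
Qed.

End posdef.

(** * Derivatives and measurability of matrix-valued functions *)

Section derivable_matrix.
Variable R : realType.
Implicit Types x : R.

Lemma derivable_bigsum I (s : seq I) (F : I -> R -> R) x :
  (forall i, derivable (F i) x 1) -> derivable (fun y => \sum_(i <- s) F i y) x 1.
Proof.
move=> dF; elim: s => [|i s IH].
  have -> : (fun y => \sum_(j <- [::]) F j y) = cst 0 by apply/funext => y; rewrite big_nil.
  exact: derivable_cst.
have -> : (fun y => \sum_(j <- i :: s) F j y) = F i + (fun y => \sum_(j <- s) F j y).
  by apply/funext => y; rewrite big_cons.
exact: derivableD.
Qed.

Lemma derivable_bigprod I (s : seq I) (F : I -> R -> R) x :
  (forall i, derivable (F i) x 1) -> derivable (fun y => \prod_(i <- s) F i y) x 1.
Proof.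
move=> dF; elim: s => [|i s IH].
  have -> : (fun y => \prod_(j <- [::]) F j y) = cst 1 by apply/funext => y; rewrite big_nil.
  exact: derivable_cst.
have -> : (fun y => \prod_(j <- i :: s) F j y) = F i * (fun y => \prod_(j <- s) F j y).
  by apply/funext => y; rewrite big_cons.
exact: derivableM.
Qed.

Lemma derivable_det k (S : R -> 'M[R]_k) x :
  (forall i j, derivable (fun y => S y i j) x 1) ->
  derivable (fun y => \det (S y)) x 1.
Proof.
move=> dS; rewrite /determinant; apply: derivable_bigsum => s.
apply: (@derivableM _ _ (cst _)); first exact: derivable_cst.
by apply: derivable_bigprod => i; exact: dS.
Qed.

Lemma derivable_cofactor k (S : R -> 'M[R]_k) x i j :
  (forall i j, derivable (fun y => S y i j) x 1) ->
  derivable (fun y => cofactor (S y) i j) x 1.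
Proof.
move=> dS; rewrite /cofactor.
apply: (@derivableM _ _ (cst _)); first exact: derivable_cst.
apply: derivable_det => k' l.
by under eq_fun do rewrite !mxE; exact: dS.
Qed.

Lemma derivable_invmx k (S : R -> 'M[R]_k) x :
  (forall y, S y \in unitmx) ->
  (forall i j, derivable (fun y => S y i j) x 1) ->
  forall i j, derivable (fun y => invmx (S y) i j) x 1.
Proof.
move=> uS dS i j.
rewrite (_ : (fun y => _) = (fun y => (\det (S y))^-1) *
   (fun y => cofactor (S y) j i)); last first.
  by apply/funext => y /=; rewrite /invmx uS !mxE.
apply: derivableM.
  apply: derivableV; last exact: derivable_det.
  by rewrite -unitfE -unitmxE.
exact: derivable_cofactor.
Qed.

Definition is_derive_mx m p (x : R) (F : R -> 'M[R]_(m, p)) (F' : 'M[R]_(m, p)) :=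
  forall i j, is_derive x 1 (fun y => F y i j) (F' i j).

Lemma is_derive_bigsum I (s : seq I) (F : I -> R -> R) (F' : I -> R) x :
  (forall i, is_derive x 1 (F i) (F' i)) ->
  is_derive x 1 (fun y => \sum_(i <- s) F i y) (\sum_(i <- s) F' i).
Proof.
move=> dF; elim: s => [|i s IH].
  rewrite (_ : (fun y => _) = cst 0) ?big_nil; first exact: is_derive_cst.
  by apply/funext => y; rewrite big_nil.
rewrite (_ : (fun y => _) = fun y => F i y + (\sum_(j <- s) F j y)); last first.
  by apply/funext => y; rewrite big_cons.
by rewrite big_cons; exact: is_derive_add.
Qed.

Lemma is_derive_mulmx m p q x (F : R -> 'M[R]_(m, p)) (G : R -> 'M[R]_(p, q)) F' G' :
  is_derive_mx x F F' -> is_derive_mx x G G' ->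
  is_derive_mx x (fun y => F y *m G y) (F' *m G x + F x *m G').
Proof.
move=> dF dG i j.
rewrite (_ : (fun y => _) = fun y => \sum_k F y i k * G y k j); last first.
  by apply/funext => y; rewrite mxE.
rewrite !mxE -big_split/=; apply: is_derive_bigsum => k.
exact: is_derive_mul.
Qed.

(** Existence of the derivative comes from the cofactor formula; its value is then forced by
    differentiating the constant [S *m invmx S]. *)
Lemma is_derive_invmx k x (S : R -> 'M[R]_k) S' :
  (forall y, S y \in unitmx) -> is_derive_mx x S S' ->
  is_derive_mx x (fun y => invmx (S y)) (- (invmx (S x) *m S' *m invmx (S x))).
Proof.
move=> uS dS.
pose L : 'M[R]_k := \matrix_(i, j) 'D_1 (fun y => invmx (S y) i j) x.
have dL : is_derive_mx x (fun y => invmx (S y)) L.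
  move=> i j; rewrite mxE; apply: DeriveDef => //.
  apply: derivable_invmx => // i' j'.
  by have [] := dS i' j'.
have h := is_derive_mulmx dS dL.
have h0 : S' *m invmx (S x) + S x *m L = 0.
  apply/matrixP => i j; have [_ <-] := h i j.
  rewrite (_ : (fun y => _) = cst ((1%:M : 'M[R]_k) i j)); last first.
    by apply/funext => y; rewrite mulmxV.
  by rewrite derive_cst mxE.
suff -> : - (invmx (S x) *m S' *m invmx (S x)) = L by [].
move/(congr1 (mulmx (invmx (S x)))): h0.
rewrite mulmx0 mulmxDr !mulmxA mulVmx// mul1mx => /eqP.
by rewrite addrC addr_eq0 => /eqP ->.
Qed.

End derivable_matrix.

Section directional.
Variables (R : realType) (m p : nat).
Local Notation vec := 'M[R]_(m, p).

Definition nice_mx a b (F : vec -> 'M[R]_(a, b)) :=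
  forall i j, nice (fun v => F v i j).

Definition has_dir a b (F F' : vec -> 'M[R]_(a, b)) (i : 'I_m) (k : 'I_p) :=
  forall v, is_derive_mx (0 : R) (fun x => F (shift_mx i k v x)) (F' v).

Lemma nice_mulmx a b c (F : vec -> 'M[R]_(a, b)) (G : vec -> 'M[R]_(b, c)) :
  nice_mx F -> nice_mx G -> nice_mx (fun v => F v *m G v).
Proof.
move=> nF nG i j.
rewrite (_ : (fun y => _) = fun v => \sum_k F v i k * G v k j); last first.
  by apply/funext => y; rewrite mxE.
by apply: nice_sum => k; exact: niceM.
Qed.

Lemma nice_addmx a b (F G : vec -> 'M[R]_(a, b)) :
  nice_mx F -> nice_mx G -> nice_mx (fun v => F v + G v).
Proof. by move=> nF nG i j; under eq_fun do rewrite mxE; exact: niceD. Qed.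

Lemma nice_oppmx a b (F : vec -> 'M[R]_(a, b)) :
  nice_mx F -> nice_mx (fun v => - F v).
Proof. by move=> nF i j; under eq_fun do rewrite mxE; exact: niceN. Qed.

Lemma nice_trmx a b (F : vec -> 'M[R]_(a, b)) :
  nice_mx F -> nice_mx (fun v => (F v)^T).
Proof. by move=> nF i j; under eq_fun do rewrite mxE; exact: nF. Qed.

Lemma nice_cstmx a b (A : 'M[R]_(a, b)) : nice_mx (fun=> A).
Proof. by move=> i j; exact: nice_cst. Qed.

Lemma nice_mxtrace a (F : vec -> 'M[R]_a) :
  nice_mx F -> nice (fun v => \tr (F v)).
Proof. by move=> nF; apply: nice_sum => i; exact: nF. Qed.

Lemma nice_scalemx a b f (F : vec -> 'M[R]_(a, b)) :
  nice f -> nice_mx F -> nice_mx (fun v => f v *: F v).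
Proof. by move=> nf nF i j; under eq_fun do rewrite mxE; exact: niceM. Qed.

Lemma shift_mx0 (v : vec) i k : shift_mx i k v 0 = v.
Proof. by rewrite /shift_mx scale0r addr0. Qed.

Lemma dir_mulmx a b c (F F' : vec -> 'M[R]_(a, b)) (G G' : vec -> 'M[R]_(b, c)) i k :
  has_dir F F' i k -> has_dir G G' i k ->
  has_dir (fun v => F v *m G v) (fun v => F' v *m G v + F v *m G' v) i k.
Proof.
by move=> dF dG v; have := is_derive_mulmx (dF v) (dG v); rewrite shift_mx0.
Qed.

Lemma dir_addmx a b (F F' G G' : vec -> 'M[R]_(a, b)) i k :
  has_dir F F' i k -> has_dir G G' i k ->
  has_dir (fun v => F v + G v) (fun v => F' v + G' v) i k.
Proof.
move=> dF dG v r c; rewrite mxE (_ : (fun x => _) =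
  fun x => F (shift_mx i k v x) r c + G (shift_mx i k v x) r c).
  exact: is_derive_add (dF v r c) (dG v r c).
by apply/funext => x; rewrite mxE.
Qed.

Lemma dir_trmx a b (F F' : vec -> 'M[R]_(a, b)) i k :
  has_dir F F' i k -> has_dir (fun v => (F v)^T) (fun v => (F' v)^T) i k.
Proof. by move=> dF v r c; rewrite mxE; under eq_fun do rewrite mxE; exact: dF. Qed.

Lemma dir_cstmx a b (A : 'M[R]_(a, b)) i k : has_dir (fun=> A) (fun=> 0) i k.
Proof. by move=> v r c; rewrite mxE; exact: is_derive_cst. Qed.

Lemma dir_invmx a (S S' : vec -> 'M[R]_a) i k : (forall v, S v \in unitmx) ->
  has_dir S S' i k ->
  has_dir (fun v => invmx (S v)) (fun v => - (invmx (S v) *m S' v *m invmx (S v))) i k.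
Proof.
move=> uS dS v.
have := is_derive_invmx (S := fun x => S (shift_mx i k v x)) (fun x => uS _) (dS v).
by rewrite shift_mx0.
Qed.

Lemma dir_shift a b (F F' : vec -> 'M[R]_(a, b)) i k v (x : R) :
  has_dir F F' i k ->
  is_derive_mx x (fun y => F (shift_mx i k v y)) (F' (shift_mx i k v x)).
Proof.
move=> dF r c.
have hx : is_derive x 1 (fun y : R => y - x) 1.
  have := is_derive_affine 1 (- x) x.
  by under eq_fun do rewrite mul1r.
have h1 : is_derive (x - x) 1 (fun y => F (shift_mx i k (shift_mx i k v x) y) r c)
    (F' (shift_mx i k v x) r c).
  by rewrite subrr; exact: dF.
have := @is_derive_comp _ (fun y => F (shift_mx i k (shift_mx i k v x) y) r c) (fun y => y - x) x _ _ h1 hx.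
rewrite mulr1 (_ : (fun y => _) = fun y => F (shift_mx i k v y) r c)//.
by apply/funext => y; rewrite shift_mxD subrKC.
Qed.

Definition mfun_mx a b (F : vec -> 'M[R]_(a, b)) := forall i j, mfun (fun v => F v i j).

Lemma mfun_det a (S : vec -> 'M[R]_a) : mfun_mx S -> mfun (fun v => \det (S v)).
Proof.
move=> mS; rewrite /determinant.
apply: (@measurable_sum_fun _ _ _ _ _ (fun (s : 'S_a) t => (-1) ^+ s * \prod_i S (tuplemx t) i (s i))) => s.
apply: measurable_funM => //.
apply: (@measurable_prod_fun _ _ _ _ _ (fun i t => S (tuplemx t) i (s i))) => i.
exact: mS.
Qed.

(** [1 / f = f / f^2], and [1 / f^2 = expR (- ln (f^2))] is a composition of measurable
    functions. *)
Lemma measurable_inv_fun d (T : measurableType d) (f : T -> R) :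
  (forall x, f x != 0) -> measurable_fun setT f ->
  measurable_fun setT (fun x => (f x)^-1).
Proof.
move=> f0 mf.
rewrite (_ : (fun x => _) = fun x => f x * expR (- ln (f x ^+ 2))).
  apply: measurable_funM => //; apply: (measurableT_comp (f := expR)); first exact: measurable_expR.
  apply: measurableT_comp => //.
  apply: (measurableT_comp (f := @ln R)); first exact: measurable_ln.
  exact: measurable_funX.
apply/funext => x; rewrite expRN lnK; last by rewrite posrE exprn_even_gt0//= f0.
by rewrite expr2 invfM mulrA divff ?mul1r.
Qed.

Lemma mfun_invmx a (S : vec -> 'M[R]_a) : (forall v, S v \in unitmx) ->
  mfun_mx S -> mfun_mx (fun v => invmx (S v)).
Proof.
move=> uS mS i j; rewrite /mfun.
rewrite (_ : _ \o _ = fun t => (\det (S (tuplemx t)))^-1 * cofactor (S (tuplemx t)) j i); last first.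
  by apply/funext => t /=; rewrite /invmx uS !mxE.
apply: measurable_funM.
  apply: measurable_inv_fun; last exact: mfun_det.
  by move=> t; rewrite -unitfE -unitmxE.
rewrite /cofactor; apply: measurable_funM => //.
apply: (@mfun_det _ (fun v => row' j (col' i (S v)))) => k l.
by under eq_fun do rewrite !mxE; exact: mS.
Qed.

End directional.

(** * Resolvent of the Gram matrix *)

Section resolvent.
Variables (R : realType) (n M : nat) (l : R).
Hypothesis l0 : 0 < l.
Implicit Types W : 'M[R]_(n, M).

Definition reg W : 'M[R]_M := W^T *m W + l%:M.
Definition res W : 'M[R]_M := invmx (reg W).

Lemma reg_unit W : reg W \in unitmx.
Proof. exact: posdef_unit (posdef_gram _ l0). Qed.

Lemma res_sym W : (res W)^T = res W.
Proof. by rewrite trmx_inv; congr invmx; case: (posdef_gram W l0). Qed.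

(** Everything in this section rests on [W^T W = reg W - l]: a Gram matrix next to a resolvent is
    traded for [1 - l R]. *)
Lemma gram_res W : W^T *m W *m res W = 1%:M - l *: res W.
Proof.
apply/eqP; rewrite eq_sym subr_eq -mul_scalar_mx -mulmxDl.
by rewrite mulmxV// reg_unit.
Qed.

Lemma res_gram W : res W *m (W^T *m W) = 1%:M - l *: res W.
Proof.
apply/eqP; rewrite eq_sym subr_eq -mul_mx_scalar -mulmxDr.
by rewrite mulVmx// reg_unit.
Qed.

Lemma mul_res_gram_r p (A : 'M[R]_(M, p)) W :
  res W *m W^T *m W *m A = A - l *: (res W *m A).
Proof. by rewrite -(mulmxA _ W^T) res_gram mulmxBl mul1mx -scalemxAl. Qed.

Definition rtr1 W := \tr (res W).
Definition rtr2 W := \tr (res W *m res W).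
Definition rtr3 W := \tr (res W *m res W *m res W).

Lemma tr_gram_res W : \tr (W^T *m W *m res W) = M%:R - l * rtr1 W.
Proof. by rewrite gram_res linearB/= mxtrace1 linearZ. Qed.

Lemma mdot_WR_W W : mdot W (W *m res W) = M%:R - l * rtr1 W.
Proof. by rewrite mdot_trC mulmxA tr_gram_res. Qed.

Lemma tr_WRW W : \tr (W *m res W *m W^T) = M%:R - l * rtr1 W.
Proof. by rewrite mxtrace_mulC mulmxA tr_gram_res. Qed.

Lemma mul_res_gram p (A : 'M[R]_(p, M)) W :
  A *m res W *m W^T *m W = A - l *: (A *m res W).
Proof. by rewrite -!mulmxA res_gram mulmxBr mulmx1 -scalemxAr. Qed.

Lemma mdot_WR_WR W : mdot (W *m res W) (W *m res W) = rtr1 W - l * rtr2 W.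
Proof.
rewrite mdot_trC trmx_mul res_sym mulmxA -(mulmxA (res W)) res_gram.
by rewrite mulmxBl mul1mx -scalemxAl linearB/= linearZ.
Qed.

Lemma mdot_W_WRR W : mdot W (W *m res W *m res W) = rtr1 W - l * rtr2 W.
Proof.
by rewrite mdot_trC !mulmxA gram_res mulmxBl mul1mx -scalemxAl linearB/= linearZ.
Qed.

Lemma tr_WRRW W : \tr (W *m res W *m res W *m W^T) = rtr1 W - l * rtr2 W.
Proof.
rewrite mxtrace_mulC !mulmxA gram_res.
by rewrite mulmxBl mul1mx -scalemxAl linearB/= linearZ.
Qed.

Lemma mdot_WRR_WR W :
  mdot (W *m res W *m res W) (W *m res W) = rtr2 W - l * rtr3 W.
Proof.
rewrite mdot_trC !trmx_mul res_sym !mulmxA mul_res_gram.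
by rewrite mulmxBl -scalemxAl linearB/= linearZ.
Qed.

Lemma mdot_WRR_WRR W : mdot (W *m res W *m res W) (W *m res W *m res W) =
  rtr3 W - l * \tr (res W *m res W *m res W *m res W).
Proof.
rewrite mdot_trC !trmx_mul res_sym !mulmxA mul_res_gram.
by rewrite !mulmxBl -!scalemxAl linearB/= linearZ.
Qed.

Lemma rtr2_mdot W : rtr2 W = mdot (res W) (res W).
Proof. by rewrite mdot_tr res_sym. Qed.

Lemma rtr2_ge0 W : 0 <= rtr2 W.
Proof. by rewrite rtr2_mdot mdot_ge0. Qed.

(** [R = l R^2 + (W R)^T (W R)] is a sum of two Gram matrices. *)
Lemma rtr1_ge0 W : 0 <= rtr1 W.
Proof.
have -> : rtr1 W = l * rtr2 W + mdot (W *m res W) (W *m res W).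
  by rewrite mdot_WR_WR; ring.
by rewrite addr_ge0 ?mdot_ge0// mulr_ge0 ?(ltW l0)// rtr2_ge0.
Qed.

Let rtr4 W := \tr (res W *m res W *m res W *m res W).

Let rtr4_ge0 W : 0 <= rtr4 W.
Proof.
have -> : rtr4 W = mdot (res W *m res W) (res W *m res W).
  by rewrite mdot_tr trmx_mul res_sym !mulmxA.
exact: mdot_ge0.
Qed.

Lemma rtr3_ge0 W : 0 <= rtr3 W.
Proof.
have -> : rtr3 W = l * rtr4 W + mdot (W *m res W *m res W) (W *m res W *m res W).
  by rewrite mdot_WRR_WRR /rtr4; ring.
by rewrite addr_ge0 ?mdot_ge0// mulr_ge0 ?(ltW l0)// rtr4_ge0.
Qed.

Definition hat W : 'M[R]_n := W *m res W *m res W *m W^T.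

Lemma hat_sym W : (hat W)^T = hat W.
Proof. by rewrite /hat !trmx_mul trmxK res_sym !mulmxA. Qed.

Lemma tr_hat_ge0 W : 0 <= \tr (hat W).
Proof. by rewrite tr_WRRW -mdot_WR_WR mdot_ge0. Qed.

Lemma tr_hat_le W : \tr (hat W) <= rtr1 W.
Proof. by rewrite tr_WRRW gerBl mulr_ge0 ?rtr2_ge0 ?(ltW l0). Qed.

(** Two uses of [1 - l R] give [tr R^2 - l tr R^3 - l |W R^2|^2], and both subtracted terms are
    nonnegative. *)
Lemma tr_hat2_le W : \tr (hat W *m hat W) <= rtr2 W.
Proof.
have -> : \tr (hat W *m hat W) = rtr2 W - l * rtr3 W - l * (rtr3 W - l * rtr4 W).
  rewrite -mdot_WRR_WR -mdot_WRR_WRR mdot_tr mdot_tr /hat !mulmxA mul_res_gram.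
  by rewrite !mulmxBl -!scalemxAl linearB/= linearZ/= !trmx_mul res_sym !mulmxA.
rewrite -mdot_WRR_WRR.
have := mulr_ge0 (ltW l0) (mdot_ge0 (W *m res W *m res W)).
have := mulr_ge0 (ltW l0) (rtr3_ge0 W).
lra.
Qed.

(** The diagonal of [R = R W^T W R + l R R] gives [l R_ab^2 <= R_aa]. With [b = a] this bounds
    [R_aa] by [1 / l], and then every entry. It makes the resolvent of growth degree 0. *)
Lemma res_bound W i j : `|res W i j| <= l^-1.
Proof.
have key a b : l * (res W a b) ^+ 2 <= res W a a.
  have -> : res W a a = \sum_k (res W *m W^T) a k ^+ 2 + l * \sum_k res W a k ^+ 2.
    have {1}-> : res W = (res W *m W^T) *m (res W *m W^T)^T + l *: (res W *m (res W)^T).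
      rewrite trmx_mul trmxK res_sym !mulmxA mul_res_gram_r.
      by rewrite subrK.
    have sq p (Y : 'M[R]_(M, p)) : (Y *m Y^T) a a = \sum_k Y a k ^+ 2.
      by rewrite mxE; apply: eq_bigr => k _; rewrite [Y^T _ _]mxE expr2.
    by rewrite mxE [X in _ + X]mxE !sq.
  rewrite (bigD1 b)//= mulrDr addrCA lerDl addr_ge0//.
    by apply: sumr_ge0 => k _; exact: sqr_ge0.
  by rewrite mulr_ge0 ?(ltW l0)// sumr_ge0// => k _; exact: sqr_ge0.
have d0 : 0 <= res W i i.
  by apply: le_trans (key i i); rewrite mulr_ge0 ?(ltW l0)// sqr_ge0.
have d1 : res W i i <= l^-1.
  have [->|d] := eqVneq (res W i i) 0; first by rewrite invr_ge0 ltW.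
  have d2 : 0 < res W i i by rewrite lt_neqAle eq_sym d.
  have := key i i; rewrite expr2 mulrA ger_pMl// => h.
  by rewrite -[l^-1]mul1r ler_pdivlMr// mulrC.
rewrite -(@ler_pXn2r _ 2)// ?nnegrE ?invr_ge0 ?(ltW l0)//.
rewrite real_normK ?num_real//.
by have := le_trans (key i j) d1; rewrite mulrC -ler_pdivlMr.
Qed.

End resolvent.

Section deltas.
Variable R : realType.

Lemma addmxE m n (A B : 'M[R]_(m, n)) i j : (A + B) i j = A i j + B i j.
Proof. by rewrite mxE. Qed.

Lemma oppmxE m n (A : 'M[R]_(m, n)) i j : (- A) i j = - A i j.
Proof. by rewrite mxE. Qed.

Lemma scalemxE m n k (A : 'M[R]_(m, n)) i j : (k *: A) i j = k * A i j.
Proof. by rewrite mxE. Qed.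

Lemma trmxE m n (A : 'M[R]_(m, n)) i j : A^T i j = A j i.
Proof. by rewrite mxE. Qed.

Lemma mdotZr m n k (A B : 'M[R]_(m, n)) : mdot A (k *: B) = k * mdot A B.
Proof. by rewrite !mdot_trC -scalemxAr linearZ. Qed.

Lemma mul_delta_entry a m n b (A : 'M[R]_(a, m)) (C : 'M[R]_(n, b)) i j r c :
  (A *m delta_mx i j *m C) r c = A r i * C j c.
Proof.
rewrite mxE (bigD1 j)//= big1 ?addr0 => [|k /negbTE kj].
  rewrite mxE (bigD1 i)//= big1 ?addr0 => [|k /negbTE ki].
    by rewrite mxE !eqxx mulr1.
  by rewrite mxE ki mulr0.
by rewrite mxE big1 ?mul0r// => k' _; rewrite mxE kj andbF mulr0.
Qed.

(** Every divergence computed below reduces to one of two contractions: [delta_mx i j] yields a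
    product of two traces, its transpose a Frobenius product. *)
Lemma sum_mul_delta m n (A : 'M[R]_m) (C : 'M[R]_n) :
  \sum_i \sum_j (A *m delta_mx i j *m C) i j = \tr A * \tr C.
Proof.
rewrite /mxtrace big_distrl/=; apply: eq_bigr => i _.
by rewrite big_distrr/=; apply: eq_bigr => j _; rewrite mul_delta_entry.
Qed.

Lemma sum_mul_deltaT m n (A C : 'M[R]_(m, n)) :
  \sum_i \sum_j (A *m (delta_mx i j)^T *m C) i j = mdot A C.
Proof.
by apply: eq_bigr => i _; apply: eq_bigr => j _; rewrite trmx_delta mul_delta_entry.
Qed.

Lemma tr_mul_delta a m n (A : 'M[R]_(a, m)) (C : 'M[R]_(n, a)) i j :
  \tr (A *m delta_mx i j *m C) = (C *m A) j i.
Proof.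
rewrite mxE /mxtrace; apply: eq_bigr => k _.
by rewrite mul_delta_entry mulrC.
Qed.

Lemma sum2_linear m n (F G : 'I_m -> 'I_n -> R) (a b : R) :
  \sum_i \sum_j (a * F i j + b * G i j) =
  a * (\sum_i \sum_j F i j) + b * (\sum_i \sum_j G i j).
Proof.
rewrite !mulr_sumr -big_split/=; apply: eq_bigr => i _.
by rewrite !mulr_sumr -big_split.
Qed.

End deltas.

(** * Integration by parts in the observation block [W] and the error block [G] *)

Section blocks.
Variables (R : realType) (n M N : nat) (l : R).
Hypothesis l0 : 0 < l.
Local Notation vec := 'M[R]_(n, M + N).
Let W (v : vec) : 'M[R]_(n, M) := lsubmx v.
Let G (v : vec) : 'M[R]_(n, N) := rsubmx v.
Let Rs (v : vec) := res l (W v).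

Lemma nice_lsubmx : nice_mx (@lsubmx R n M N).
Proof. by move=> i j; under eq_fun do rewrite mxE; exact: nice_entry. Qed.

Lemma nice_rsubmx : nice_mx (@rsubmx R n M N).
Proof. by move=> i j; under eq_fun do rewrite mxE; exact: nice_entry. Qed.

Let dir_entry i k (v : vec) r c :
  is_derive (0 : R) 1 (fun x => shift_mx i k v x r c) ((r == i) && (c == k))%:R.
Proof.
rewrite (_ : (fun x => _) = fun x => ((r == i) && (c == k))%:R * x + v r c).
  exact: is_derive_affine.
by apply/funext => x; rewrite shift_mxE addrC mulrC.
Qed.

Lemma dir_lsubmx_l i j : has_dir (@lsubmx R n M N) (fun=> delta_mx i j) i (lshift N j).
Proof.
move=> v r c; rewrite mxE -(inj_eq (@lshift_inj M N)).
by under eq_fun do rewrite mxE; exact: dir_entry.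
Qed.

Lemma dir_lsubmx_r i j : has_dir (@lsubmx R n M N) (fun=> 0) i (rshift M j).
Proof.
move=> v r c; rewrite mxE; under eq_fun do rewrite mxE.
by have := dir_entry i (rshift M j) v r (lshift N c); rewrite eq_lrshift andbF.
Qed.

Lemma dir_rsubmx_r i j : has_dir (@rsubmx R n M N) (fun=> delta_mx i j) i (rshift M j).
Proof.
move=> v r c; rewrite mxE -(inj_eq (@rshift_inj M N)).
by under eq_fun do rewrite mxE; exact: dir_entry.
Qed.

Let dir_res i k (D : 'M[R]_(n, M)) : has_dir (@lsubmx R n M N) (fun=> D) i k ->
  has_dir Rs (fun v => - (Rs v *m (D^T *m W v + (W v)^T *m D) *m Rs v)) i k.
Proof.
move=> dW.
have dS := dir_addmx (dir_mulmx (dir_trmx dW) dW) (dir_cstmx (l%:M : 'M[R]_M) i k).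
have := dir_invmx (S := fun v => reg l (W v)) (fun v => reg_unit l0 (W v)) dS.
by move=> h v r c; have := h v r c; rewrite addr0.
Qed.

(** Growth is [res_bound], measurability the cofactor formula, and continuity along an entry follows
    from the derivative there. *)
Lemma nice_res : nice_mx Rs.
Proof.
move=> i j; split.
- apply: (@mfun_invmx _ _ _ _ (fun v => reg l (W v)) (fun v => reg_unit l0 (W v))).
  move=> r c; have : nice_mx (fun v => reg l (W v)).
    apply: nice_addmx; last exact: nice_cstmx.
    by apply: nice_mulmx; [apply: nice_trmx|]; exact: nice_lsubmx.
  by move=> /(_ r c) [].
- by exists l^-1, 0%N => v; rewrite expr0 mulr1 res_bound.
- move=> r k v.
  have [D dW] : exists D, has_dir (@lsubmx R n M N) (fun=> D) r k.
    case: (split_ordP k) => k' ->.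
      by exists (delta_mx r k'); exact: dir_lsubmx_l.
    by exists 0; exact: dir_lsubmx_r.
  apply: (@is_derive_continuous _ _ (fun x => - (Rs (shift_mx r k v x) *m (D^T *m W (shift_mx r k v x) + (W (shift_mx r k v x))^T *m D) *m Rs (shift_mx r k v x)) i j)) => x.
  have := dir_shift v x (dir_res dW) i j.
  by rewrite mxE.
Qed.

Lemma dir_res_l i j : has_dir Rs
  (fun v => - (Rs v *m ((delta_mx i j)^T *m W v + (W v)^T *m delta_mx i j) *m Rs v)) i (lshift N j).
Proof. by apply: dir_res; exact: dir_lsubmx_l. Qed.

Lemma dir_res_r i j : has_dir Rs (fun=> 0) i (rshift M j).
Proof.
move=> v r c; have := dir_res (@dir_lsubmx_r i j) v r c.
by rewrite trmx0 mul0mx mulmx0 addr0 mulmx0 mul0mx oppr0.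
Qed.

Lemma dir_trace a (F F' : vec -> 'M[R]_a) i k : has_dir F F' i k ->
  forall v, is_derive (0 : R) 1 (fun x => \tr (F (shift_mx i k v x))) (\tr (F' v)).
Proof. by move=> dF v; apply: is_derive_bigsum => r; exact: dF. Qed.

Lemma dir_scalemx a b (f f' : vec -> R) (F F' : vec -> 'M[R]_(a, b)) i k :
  (forall v, is_derive (0 : R) 1 (fun x => f (shift_mx i k v x)) (f' v)) ->
  has_dir F F' i k ->
  has_dir (fun v => f v *: F v) (fun v => f' v *: F v + f v *: F' v) i k.
Proof.
move=> df dF v r c.
have := is_derive_mul (df v) (dF v r c); rewrite !shift_mx0 !mxE.
by under [in X in _ -> X]eq_fun do rewrite mxE.
Qed.

Section expectation.
Context d (T : measurableType d) (P : probability T R) (V : T -> vec).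
Hypothesis sV : std_gauss P V.

(** The divergence form of integration by parts, for a matrix field [F] and the entries of [W]
    only. *)
Lemma stein_l (F : vec -> 'M[R]_(n, M)) (F' : 'I_n -> 'I_M -> vec -> 'M[R]_(n, M)) :
  nice_mx F -> (forall i j, nice_mx (F' i j)) ->
  (forall i j, has_dir F (F' i j) i (lshift N j)) ->
  \int[P]_w mdot (W (V w)) (F (V w)) = \int[P]_w \sum_i \sum_j F' i j (V w) i j.
Proof.
move=> nF nF' dF.
have n1 i j : nice (fun v : vec => W v i j * F v i j) by apply: niceM; [exact: nice_lsubmx|exact: nF].
rewrite /mdot [LHS]Rintegral_sum; last first.
  move=> i _; apply: intble_sum => j _; exact: (intble_nice sV (n1 i j)).
rewrite [RHS]Rintegral_sum; last first.
  move=> i _; apply: intble_sum => j _; exact: (intble_nice sV (nF' i j i j)).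
apply: eq_bigr => i _.
rewrite [LHS]Rintegral_sum; last by move=> j _; exact: (intble_nice sV (n1 i j)).
rewrite [RHS]Rintegral_sum; last by move=> j _; exact: (intble_nice sV (nF' i j i j)).
apply: eq_bigr => j _.
have <- := stein_mx sV (nF i j) (nF' i j i j) (fun v => dF i j v i j).
by apply: eq_Rintegral => w _; rewrite mxE.
Qed.

Lemma stein_r (F : vec -> 'M[R]_(n, N)) (F' : 'I_n -> 'I_N -> vec -> 'M[R]_(n, N)) :
  nice_mx F -> (forall i j, nice_mx (F' i j)) ->
  (forall i j, has_dir F (F' i j) i (rshift M j)) ->
  \int[P]_w mdot (G (V w)) (F (V w)) = \int[P]_w \sum_i \sum_j F' i j (V w) i j.
Proof.
move=> nF nF' dF.
have n1 i j : nice (fun v : vec => G v i j * F v i j) by apply: niceM; [exact: nice_rsubmx|exact: nF].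
rewrite /mdot [LHS]Rintegral_sum; last first.
  move=> i _; apply: intble_sum => j _; exact: (intble_nice sV (n1 i j)).
rewrite [RHS]Rintegral_sum; last first.
  move=> i _; apply: intble_sum => j _; exact: (intble_nice sV (nF' i j i j)).
apply: eq_bigr => i _.
rewrite [LHS]Rintegral_sum; last by move=> j _; exact: (intble_nice sV (n1 i j)).
rewrite [RHS]Rintegral_sum; last by move=> j _; exact: (intble_nice sV (nF' i j i j)).
apply: eq_bigr => j _.
have <- := stein_mx sV (nF i j) (nF' i j i j) (fun v => dF i j v i j).
by apply: eq_Rintegral => w _; rewrite mxE.
Qed.

Let t v := rtr1 l (W v).
Let s v := rtr2 l (W v).
Let r3 v := rtr3 l (W v).
Let E (f : vec -> R) := \int[P]_w f (V w).

Lemma nice_rtr1 : nice (fun v : vec => rtr1 l (lsubmx v)).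
Proof. by apply: nice_mxtrace; exact: nice_res. Qed.

Lemma nice_rtr2 : nice (fun v : vec => rtr2 l (lsubmx v)).
Proof. by apply: nice_mxtrace; apply: nice_mulmx; exact: nice_res. Qed.

Lemma nice_rtr3 : nice (fun v : vec => rtr3 l (lsubmx v)).
Proof. by apply: nice_mxtrace; do ![apply: nice_mulmx]; exact: nice_res. Qed.

Ltac nmx := repeat first
  [ exact: nice_lsubmx | exact: nice_rsubmx | exact: nice_res | exact: nice_cstmx
  | exact: nice_rtr1 | exact: nice_rtr2 | exact: nice_rtr3
  | apply: nice_mulmx | apply: nice_addmx | apply: nice_oppmx | apply: nice_trmx
  | apply: nice_scalemx | apply: nice_mxtrace ].

Let dR i j v := - (Rs v *m ((delta_mx i j)^T *m W v + (W v)^T *m delta_mx i j) *m Rs v).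

Let nice_dR i j : nice_mx (dR i j).
Proof. by rewrite /dR; nmx. Qed.

Ltac nmxd := repeat first
  [ exact: nice_lsubmx | exact: nice_rsubmx | exact: nice_res | exact: nice_cstmx
  | exact: nice_rtr1 | exact: nice_rtr2 | exact: nice_rtr3 | exact: nice_dR
  | apply: nice_mulmx | apply: nice_addmx | apply: nice_oppmx | apply: nice_trmx
  | apply: nice_scalemx | apply: nice_mxtrace ].

Let WdR (v : vec) p (A : 'M[R]_(M, p)) i j : W v *m dR i j v *m A =
  - (W v *m Rs v *m (delta_mx i j)^T *m (W v *m Rs v *m A)
     + W v *m Rs v *m (W v)^T *m delta_mx i j *m (Rs v *m A)).
Proof.
by rewrite /dR mulmxN mulNmx mulmxDr mulmxDl mulmxDr mulmxDl !mulmxA.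
Qed.

(** The field is [W R]. Differentiating its factor [W] gives [n tr R]; the two halves of [dR] give
    [|W R|^2 = tr R - l tr R^2] and [tr (W R W^T) tr R]. These are regularised forms of Haff's
    identities for Wishart matrices. *)
Lemma haff1 : E (fun v => M%:R - l * t v) =
  E (fun v => n%:R * t v - (t v - l * s v) - (M%:R - l * t v) * t v).
Proof.
have := @stein_l (fun v => W v *m Rs v)
  (fun i j v => delta_mx i j *m Rs v + W v *m dR i j v).
move=> h; rewrite /E.
transitivity (\int[P]_w mdot (W (V w)) (W (V w) *m Rs (V w))).
  by apply: eq_Rintegral => w _; rewrite mdot_WR_W.
rewrite h; first last.
- by move=> i j; apply: dir_mulmx; [exact: dir_lsubmx_l|exact: dir_res_l].
- by move=> i j; nmxd.
- by nmx.
apply: eq_Rintegral => w _; move: (V w) => v.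
rewrite (eq_bigr (fun i => \sum_j (1 * (1%:M *m delta_mx i j *m Rs v) i j +
  (-1) * (1 * (W v *m Rs v *m (delta_mx i j)^T *m (W v *m Rs v)) i j +
    1 * (W v *m Rs v *m (W v)^T *m delta_mx i j *m Rs v) i j)))); last first.
  move=> i _; apply: eq_bigr => j _.
  have := WdR v 1%:M i j; rewrite !mulmx1 => ->.
  by rewrite mul1mx addmxE oppmxE addmxE !mul1r mulN1r.
rewrite sum2_linear sum2_linear sum_mul_delta sum_mul_deltaT sum_mul_delta.
by rewrite mxtrace1 mdot_WR_WR// tr_WRW// /t /s /rtr1; ring.
Qed.

Let tr_dR i j v : \tr (dR i j v) = - 2 * (W v *m Rs v *m Rs v) i j.
Proof.
rewrite /dR linearN/= mulmxDr mulmxDl linearD/= !mulmxA tr_mul_delta.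
rewrite -mxtrace_tr !trmx_mul trmxK res_sym// !mulmxA tr_mul_delta.
have e : (Rs v *m Rs v *m (W v)^T) j i = (W v *m Rs v *m Rs v) i j.
  transitivity ((Rs v *m Rs v *m (W v)^T)^T i j); first by rewrite trmxE.
  by rewrite !trmx_mul trmxK res_sym// !mulmxA.
by rewrite !mulmxA e; ring.
Qed.

(** The field is [tr R] times [W R]. Compared with [haff1] multiplied by [tr R], the derivative of
    the scalar factor adds [- 2 (tr R^2 - l tr R^3)]. *)
Lemma haff2 : E (fun v => t v * (M%:R - l * t v)) =
  E (fun v => n%:R * t v ^+ 2 - t v * (t v - l * s v)
              - (M%:R - l * t v) * t v ^+ 2 - 2 * (s v - l * r3 v)).
Proof.
have := @stein_l (fun v => t v *: (W v *m Rs v))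
  (fun i j v => \tr (dR i j v) *: (W v *m Rs v) + t v *: (delta_mx i j *m Rs v + W v *m dR i j v)).
move=> h; rewrite /E.
transitivity (\int[P]_w mdot (W (V w)) (t (V w) *: (W (V w) *m Rs (V w)))).
  by apply: eq_Rintegral => w _; rewrite mdotZr mdot_WR_W.
rewrite h; first last.
- move=> i j; have dRij := @dir_res_l i j.
  exact: (dir_scalemx (dir_trace dRij) (dir_mulmx (@dir_lsubmx_l i j) dRij)).
- by move=> i j; nmxd.
- by nmxd.
apply: eq_Rintegral => w _; move: (V w) => v.
rewrite (eq_bigr (fun i => \sum_j ((-2) * ((W v *m Rs v *m Rs v) i j * (W v *m Rs v) i j) +
  t v * (1 * (1%:M *m delta_mx i j *m Rs v) i j +
  (-1) * (1 * (W v *m Rs v *m (delta_mx i j)^T *m (W v *m Rs v)) i j +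
    1 * (W v *m Rs v *m (W v)^T *m delta_mx i j *m Rs v) i j))))); last first.
  move=> i _; apply: eq_bigr => j _.
  have := WdR v 1%:M i j; rewrite !mulmx1 => ->.
  by rewrite tr_dR mul1mx addmxE !scalemxE addmxE oppmxE addmxE !mul1r mulN1r mulrA.
rewrite sum2_linear sum2_linear sum2_linear sum_mul_delta sum_mul_deltaT sum_mul_delta.
rewrite -/(mdot _ _) mxtrace1 mdot_WR_WR// tr_WRW// mdot_WRR_WR// /t /s /r3 /rtr1.
by ring.
Qed.

(** The field is [W R R]; each of its two resolvents contributes one Frobenius product and one
    product of traces. *)
Lemma haff3 : E (fun v => t v - l * s v) =
  E (fun v => n%:R * s v - 2 * (s v - l * r3 v) - (M%:R - l * t v) * s v
              - (t v - l * s v) * t v).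
Proof.
have := @stein_l (fun v => W v *m Rs v *m Rs v)
  (fun i j v => (delta_mx i j *m Rs v + W v *m dR i j v) *m Rs v + W v *m Rs v *m dR i j v).
move=> h; rewrite /E.
transitivity (\int[P]_w mdot (W (V w)) (W (V w) *m Rs (V w) *m Rs (V w))).
  by apply: eq_Rintegral => w _; rewrite mdot_W_WRR.
rewrite h; first last.
- move=> i j; apply: dir_mulmx; last exact: dir_res_l.
  by apply: dir_mulmx; [exact: dir_lsubmx_l|exact: dir_res_l].
- by move=> i j; nmxd.
- by nmxd.
apply: eq_Rintegral => w _; move: (V w) => v.
rewrite (eq_bigr (fun i => \sum_j (1 * (1%:M *m delta_mx i j *m (Rs v *m Rs v)) i j +
  (-1) * (1 * (1 * (W v *m Rs v *m (delta_mx i j)^T *m (W v *m Rs v *m Rs v)) i j +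
               1 * (W v *m Rs v *m (W v)^T *m delta_mx i j *m (Rs v *m Rs v)) i j) +
          1 * (1 * (W v *m Rs v *m Rs v *m (delta_mx i j)^T *m (W v *m Rs v)) i j +
               1 * (W v *m Rs v *m Rs v *m (W v)^T *m delta_mx i j *m Rs v) i j))))); last first.
  move=> i _; apply: eq_bigr => j _.
  have -> : W v *m Rs v *m dR i j v = - (W v *m Rs v *m Rs v *m (delta_mx i j)^T *m (W v *m Rs v)
     + W v *m Rs v *m Rs v *m (W v)^T *m delta_mx i j *m Rs v).
    by rewrite /dR mulmxN mulmxDr mulmxDl mulmxDr !mulmxA.
  rewrite mulmxDl WdR mul1mx !mulmxA.
  by rewrite !(addmxE, oppmxE); ring.
rewrite !sum2_linear !sum_mul_delta !sum_mul_deltaT.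
rewrite mxtrace1 mdot_WRR_WR// [mdot (W v *m _) _]mdotC mdot_WRR_WR// tr_WRW// tr_WRRW// /t /s /r3 /rtr1 /rtr2.
by ring.
Qed.

Section noise.
Variable C : 'M[R]_N.
Hypothesis Csym : C^T = C.

Definition quad (H : 'M[R]_n) (v : vec) : R := \tr ((rsubmx v)^T *m (H *m rsubmx v *m C)).

Variable H : vec -> 'M[R]_n.
Hypotheses (nH : nice_mx H) (Hsym : forall v, (H v)^T = H v).
Hypothesis dH : forall i j, has_dir H (fun=> 0) i (rshift M j).

Let dHGC i j : has_dir (fun v => H v *m G v *m C) (fun v => H v *m delta_mx i j *m C) i (rshift M j).
Proof.
have := dir_mulmx (dir_mulmx (dH i j) (dir_rsubmx_r i j)) (dir_cstmx C i (rshift M j)).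
by move=> h v; have := h v; rewrite mul0mx add0r mulmx0 addr0.
Qed.

Lemma nice_quad : nice (fun v => quad (H v) v).
Proof. by rewrite /quad; nmxd. Qed.

(** The symmetry of [H] and [C] makes the two halves of the product rule equal. *)
Lemma dir_quad i j v : is_derive (0 : R) 1
  (fun x => quad (H (shift_mx i (rshift M j) v x)) (shift_mx i (rshift M j) v x))
  (2 * (H v *m G v *m C) i j).
Proof.
have := dir_trace (dir_mulmx (dir_trmx (dir_rsubmx_r i j)) (@dHGC i j)) v.
rewrite linearD/= trmx_delta.
have -> : \tr (delta_mx j i *m (H v *m G v *m C)) = (H v *m G v *m C) i j.
  by rewrite -[delta_mx j i]mul1mx tr_mul_delta mulmx1.
have -> : \tr ((rsubmx v)^T *m (H v *m delta_mx i j *m C)) = (H v *m G v *m C) i j.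
  rewrite !mulmxA tr_mul_delta.
  transitivity ((C *m ((rsubmx v)^T *m H v))^T i j); first by rewrite trmxE.
  by rewrite !trmx_mul trmxK Hsym Csym.
by rewrite mulr2n mulrDl mul1r.
Qed.

(** The field is [phi H G C]. Hypothesis [dH], constancy of [H] in the directions of [G], plays the
    role of conditioning on [W]. *)
Lemma stein_quad (phi : vec -> R) (phi' : 'I_n -> 'I_N -> vec -> R) :
  nice phi -> (forall i j, nice (phi' i j)) ->
  (forall i j v, is_derive (0 : R) 1 (fun x => phi (shift_mx i (rshift M j) v x)) (phi' i j v)) ->
  E (fun v => phi v * quad (H v) v) =
  E (fun v => \sum_i \sum_j phi' i j v * (H v *m G v *m C) i j + phi v * (\tr (H v) * \tr C)).
Proof.
move=> nphi nphi' dphi.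
have := @stein_r (fun v => phi v *: (H v *m G v *m C))
  (fun i j v => phi' i j v *: (H v *m G v *m C) + phi v *: (H v *m delta_mx i j *m C)).
move=> h; rewrite /E.
transitivity (\int[P]_w mdot (G (V w)) (phi (V w) *: (H (V w) *m G (V w) *m C))).
  by apply: eq_Rintegral => w _; rewrite mdotZr mdot_trC.
rewrite h; first last.
- by move=> i j; apply: dir_scalemx.
- by move=> i j; apply: nice_addmx; apply: nice_scalemx => //; nmxd.
- by apply: nice_scalemx => //; nmxd.
apply: eq_Rintegral => w _; move: (V w) => v.
rewrite -sum_mul_delta mulr_sumr -big_split/=; apply: eq_bigr => i _.
rewrite mulr_sumr -big_split/=; apply: eq_bigr => j _.
by rewrite addmxE !scalemxE.
Qed.

Lemma mean_quad : E (fun v => quad (H v) v) = \tr C * E (fun v => \tr (H v)).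
Proof.
have := @stein_quad (fun=> 1) (fun _ _ _ => 0) (nice_cst _ _ _) (fun _ _ => nice_cst _ _ _).
rewrite /E => h; transitivity (\int[P]_w (1 * quad (H (V w)) (V w))).
  by apply: eq_Rintegral => w _; rewrite mul1r.
rewrite h.
rewrite -RintegralZl//; last exact: (intble_nice sV (nice_mxtrace nH)).
apply: eq_Rintegral => w _.
rewrite big1 ?add0r ?mul1r 1?mulrC// => i _.
by rewrite big1// => j _; rewrite mul0r.
Qed.

End noise.

Section noise2.
Variable C : 'M[R]_N.
Hypothesis Csym : C^T = C.
Variable H : vec -> 'M[R]_n.
Hypotheses (nH : nice_mx H) (Hsym : forall v, (H v)^T = H v).
Hypothesis dH : forall i j, has_dir H (fun=> 0) i (rshift M j).

(** Integration by parts is used three times: with the quadratic form itself as scalar factor, which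
    leaves twice the form of [C^2] and [H^2] plus the form times [tr H tr C]; with factor [tr H] for
    the latter; and with factor 1 for the form of [C^2] and [H^2]. *)
Lemma sq_mean_quad : E (fun v => quad C (H v) v ^+ 2) =
  (\tr C) ^+ 2 * E (fun v => \tr (H v) ^+ 2) +
  2 * \tr (C *m C) * E (fun v => \tr (H v *m H v)).
Proof.
have nq := nice_quad C nH.
have nt : nice (fun v => \tr (H v)) by exact: nice_mxtrace.
have nHH : nice_mx (fun v => H v *m H v) by exact: nice_mulmx.
have dHH i j : has_dir (fun v => H v *m H v) (fun=> 0) i (rshift M j).
  have := dir_mulmx (dH i j) (dH i j).
  by move=> h v; have := h v; rewrite mul0mx mulmx0 addr0.
have dtr i j v : is_derive (0 : R) 1 (fun x => \tr (H (shift_mx i (rshift M j) v x))) 0.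
  by have := dir_trace (dH i j) v; rewrite linear0.
have nHGC : nice_mx (fun v => H v *m rsubmx v *m C) by nmxd.
have e1 := stein_quad C nH dH nq (fun i j => niceZ 2 (nHGC i j)) (dir_quad Csym Hsym dH).
have e2 := stein_quad C nH dH nt (fun _ _ => nice_cst _ _ 0) dtr.
have e3 := mean_quad (C *m C) nHH dHH.
have sqE v : mdot (H v *m rsubmx v *m C) (H v *m rsubmx v *m C) = quad (C *m C) (H v *m H v) v.
  rewrite mdot_trC /quad !trmx_mul Hsym Csym -!mulmxA mxtrace_mulC.
  by rewrite !mulmxA.
move: e1 e2 e3; rewrite /E => e1 e2 e3.
have itr := intble_nice sV nt.
have itr2 : P.-intble (fun w => \tr (H (V w)) ^+ 2).
  by have := intble_nice sV (niceM nt nt); under [in X in X -> _]eq_fun do rewrite -expr2.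
have itq := intble_nice sV (niceM nq nt).
have imd := intble_nice sV (nice_quad (C *m C) nHH).
transitivity (\int[P]_w (quad C (H (V w)) (V w) * quad C (H (V w)) (V w))).
  by apply: eq_Rintegral => w _; rewrite expr2.
rewrite e1.
transitivity (\int[P]_w (2 * quad (C *m C) (H (V w) *m H (V w)) (V w) +
   \tr C * (quad C (H (V w)) (V w) * \tr (H (V w))))).
  apply: eq_Rintegral => w _; rewrite -sqE; congr (_ + _); last by rewrite [RHS]mulrC -mulrA.
  rewrite /mdot mulr_sumr.
  apply: eq_bigr => i _; rewrite mulr_sumr; apply: eq_bigr => j _.
  by rewrite mulrA.
rewrite RintegralD//; last 2 first.
- exact: intbleZ.
- exact: intbleZ.
rewrite !RintegralZl// e3 addrC mulrA; congr (_ + _).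
rewrite [LHS](_ : _ = \tr C * \int[P]_w (\tr (H (V w)) * quad C (H (V w)) (V w))); last first.
  by congr (_ * _); apply: eq_Rintegral => w _; rewrite mulrC.
rewrite e2.
rewrite [X in _ * X = _](_ : _ = \tr C * \int[P]_w \tr (H (V w)) ^+ 2) ?mulrA ?expr2//.
rewrite -RintegralZl//; apply: eq_Rintegral => w _.
rewrite big1 ?add0r; first by rewrite expr2 mulrA mulrC.
by move=> i _; rewrite big1// => j _; rewrite mul0r.
Qed.

End noise2.

End expectation.

End blocks.

(** * Moment estimates *)

Section bounds.
Variable R : realType.

(** At [l = 0] the identities [haff1] to [haff3] read [(n - M - 1) x = M],
    [(n - M - 1) y = M x + 2 z] and [(n - M - 2) z = x + y]; the three bounds solve this system. The
    first is the mean trace of an inverse Wishart matrix. *)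
Definition bound1 (M n : nat) : R := M%:R / (n%:R - M%:R - 1).
Definition bound2 (M n : nat) : R :=
  (M%:R * bound1 M n + 2 * bound1 M n / (n%:R - M%:R - 2)) /
  (n%:R - M%:R - 1 - 2 / (n%:R - M%:R - 2)).
Definition bound3 (M n : nat) : R :=
  (bound1 M n + bound2 M n) / (n%:R - M%:R - 2).

(* The limit [l -> 0] of the bound on the second moment of the noise quadratic
   form around [c] times the trace. *)
Definition dev (M n : nat) (c : R) : R :=
  bound2 M n + 2 * bound3 M n - 2 * c * bound1 M n + c ^+ 2.

(** [x], [y], [z] stand for [E tr R], [E (tr R)^2], [E tr R^2]. Inserting the bound on [z] into the
    one on [y] moves [2 / (n - M - 2)] times [y] to the left; [M + 4 <= n] keeps this factor at most
    1 and the remaining coefficient positive. A lower bound on [x] is included because the mean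
    enters the deviation with a minus sign. *)
Lemma moment_system (M n : nat) (l x y z : R) : (M + 4 <= n)%N ->
  0 < l -> 0 <= x -> 0 <= y -> 0 <= z ->
  (n%:R - M%:R - 1) * x <= M%:R ->
  M%:R - l * (x + z + y) <= (n%:R - M%:R - 1) * x ->
  (n%:R - M%:R - 1) * y <= M%:R * x + 2 * z ->
  (n%:R - M%:R - 2) * z <= x + y ->
  [/\ x <= bound1 M n, bound1 M n - l * (bound1 M n + bound2 M n + bound3 M n) <= x,
      y <= bound2 M n & z <= bound3 M n].
Proof.
move=> Mn l0 x0 y0 z0 h1 h1' h2 h3.
have p4 : 4 <= n%:R - M%:R :> R by rewrite lerBrDr -natrD ler_nat addnC.
rewrite /bound3 /bound2; set m := bound1 M n.
move: p4 h1 h1' h2 h3; set p := n%:R - M%:R => p4 h1 h1' h2 h3.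
have p1 : 0 < p - 1 by lra.
have p2 : 0 < p - 2 by lra.
have pne1 : p - 1 != 0 by rewrite gt_eqF.
have pne2 : p - 2 != 0 by rewrite gt_eqF.
have q1 : 2 / (p - 2) <= 1 by rewrite ler_pdivrMr//; lra.
have q0 : 0 < p - 1 - 2 / (p - 2) by lra.
have xm : x <= m by rewrite /m /bound1 ler_pdivlMr// mulrC.
have M0 : 0 <= M%:R :> R by [].
have zb : z <= (x + y) / (p - 2) by rewrite ler_pdivlMr// mulrC.
set Y := (_ / (p - 1 - _)).
have yY : y <= Y.
  rewrite /Y ler_pdivlMr// mulrBr.
  have e : y * (p - 1) <= M%:R * m + 2 * ((m + y) / (p - 2)).
    rewrite mulrC (le_trans h2)// lerD ?ler_wpM2l//.
    by rewrite (le_trans zb)// ler_wpM2r ?invr_ge0 ?(ltW p2)// lerD2r.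
  have -> : 2 * m / (p - 2) = 2 * ((m + y) / (p - 2)) - y * (2 / (p - 2)) by field.
  by lra.
have zY : z <= (m + Y) / (p - 2).
  by rewrite (le_trans zb)// ler_wpM2r ?invr_ge0 ?(ltW p2)// lerD.
split=> //.
have : M%:R <= (p - 1) * x + l * (x + z + y) by lra.
have -> : M%:R = (p - 1) * m by rewrite /m /bound1 -/p mulrCA divff ?mulr1.
move=> h.
have : l * (x + z + y) <= (p - 1) * (l * (m + Y + (m + Y) / (p - 2))).
  apply: (@le_trans _ _ (1 * (l * (m + Y + (m + Y) / (p - 2))))).
    by rewrite mul1r ler_wpM2l ?(ltW l0)//; lra.
  rewrite ler_wpM2r//; last by lra.
  by rewrite mulr_ge0 ?(ltW l0)//; lra.
move=> h'; have : (p - 1) * m <= (p - 1) * (x + l * (m + Y + (m + Y) / (p - 2))).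
  by rewrite mulrDr; lra.
by rewrite ler_pM2l//; lra.
Qed.

(** The products of bounds arrive as hypotheses, so that only linear arithmetic remains. *)
Lemma deviation_arith (b1 b2 b3 t q c l a a2 a22 : R) :
  2 * q * a22 <= 2 * t ^+ 2 * b3 -> t ^+ 2 * a2 <= t ^+ 2 * b2 ->
  2 * c * t ^+ 2 * (b1 - l * (b1 + b2 + b3 *+ 2)) <= 2 * c * t ^+ 2 * a ->
  t ^+ 2 * a2 + 2 * q * a22 - 2 * (t * c) * (t * a) + (t * c) ^+ 2 <=
  t ^+ 2 * (b2 + 2 * b3 - 2 * c * b1 + c ^+ 2 + 2 * c * l * (b1 + b2 + b3 *+ 2)).
Proof. by move=> h1 h2 h3; lra. Qed.

End bounds.

Section moments.
Variables (R : realType) (n M N : nat) (l : R).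
Hypothesis l0 : 0 < l.
Hypothesis Mn : (M + 4 <= n)%N.
Local Notation vec := 'M[R]_(n, M + N).
Context d (T : measurableType d) (P : probability T R) (V : T -> vec).
Hypothesis sV : std_gauss P V.
Let E (f : vec -> R) := \int[P]_w f (V w).
Let t (v : vec) := rtr1 l (lsubmx v).
Let s (v : vec) := rtr2 l (lsubmx v).
Let r3 (v : vec) := rtr3 l (lsubmx v).

(** An identity [E f = E g] is exploited by adding [f - g] to the integrand, after which the
    comparison is pointwise. *)
Let le_E (f g a b : vec -> R) : E f = E g -> nice f -> nice g -> nice a -> nice b ->
  (forall v, a v + (f v - g v) <= b v) -> E a <= E b.
Proof.
move=> fg nf ng na nb h.
have -> : E a = \int[P]_w (a (V w) + (f (V w) - g (V w))).
  rewrite RintegralD//; last 2 first.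
  - exact: (intble_nice sV na).
  - by apply: intbleB; exact: intble_nice.
  rewrite RintegralB//; [|exact: (intble_nice sV nf)|exact: (intble_nice sV ng)].
  by rewrite [X in _ + (X - _)]fg subrr addr0.
apply: le_Rintegral => [//|||w _]; last exact: h.
- apply: intbleD; first exact: (intble_nice sV na).
  by apply: intbleB; exact: intble_nice.
- exact: (intble_nice sV nb).
Qed.

Let E_ge (f g a b : vec -> R) : E f = E g -> nice f -> nice g -> nice a -> nice b ->
  (forall v, b v <= a v + (f v - g v)) -> E b <= E a.
Proof.
move=> fg nf ng na nb h; apply: (le_E (esym fg) ng nf nb na) => v.
by have := h v; lra.
Qed.

Let nt : nice t. Proof. exact: nice_rtr1. Qed.
Let ns : nice s. Proof. exact: nice_rtr2. Qed.
Let nr3 : nice r3. Proof. exact: nice_rtr3. Qed.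
Let nt2 : nice (fun v => t v ^+ 2).
Proof. by under eq_fun do rewrite expr2; exact: niceM. Qed.

Ltac nn := repeat first [exact: nt | exact: ns | exact: nr3 | exact: nt2 | exact: nice_cst
  | apply: niceB | apply: niceD | apply: niceM].

Let Ec k : E (fun=> k) = k.
Proof. by rewrite /E Rintegral_cst1. Qed.

Let EZ k f : nice f -> E (fun v => k * f v) = k * E f.
Proof. by move=> nf; rewrite /E RintegralZl//; exact: (intble_nice sV nf). Qed.

Let ED f g : nice f -> nice g -> E (fun v => f v + g v) = E f + E g.
Proof.
move=> nf ng; rewrite /E RintegralD//; first exact: (intble_nice sV nf).
exact: (intble_nice sV ng).
Qed.

Let t0 v : 0 <= t v. Proof. exact: rtr1_ge0. Qed.
Let s0 v : 0 <= s v. Proof. exact: rtr2_ge0. Qed.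
Let r30 v : 0 <= r3 v. Proof. exact: rtr3_ge0. Qed.

Let E0 f : (forall v, 0 <= f v) -> 0 <= E f.
Proof. by move=> h; apply: Rintegral_ge0. Qed.

(** Solved for their leading terms, the three identities carry every factor [l] with a favourable
    sign, since traces of powers of the resolvent are nonnegative; these terms are dropped, except
    in the lower bound on [E t], where they form the error. *)
Lemma resolvent_moments :
  [/\ E t <= bound1 R M n,
      bound1 R M n - l * (bound1 R M n + bound2 R M n + bound3 R M n) <= E t,
      E (fun v => t v ^+ 2) <= bound2 R M n & E s <= bound3 R M n].
Proof.
pose p : R := n%:R - M%:R.
apply: moment_system => //; try exact: E0.
- by apply: E0 => v; exact: sqr_ge0.
- rewrite -[leRHS]Ec -EZ//; apply: (le_E (haff1 l0 sV)); nn => v.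
  have := mulr_ge0 (ltW l0) (t0 v); have := mulr_ge0 (ltW l0) (s0 v).
  have := mulr_ge0 (ltW l0) (sqr_ge0 (t v)); by rewrite -/(t v) -/(s v) /p expr2; nra.
- have -> : M%:R - l * (E t + E s + E (fun v => t v ^+ 2)) =
     E (fun v => M%:R + (- l) * (t v + s v + t v ^+ 2)).
    rewrite ED; [|by nn..]; rewrite Ec EZ; last by nn.
    by rewrite ED; [|by nn..]; rewrite ED//; ring.
  rewrite -EZ//; apply: (E_ge (haff1 l0 sV)); nn => v.
  by rewrite -/(t v) -/(s v) /p expr2; nra.
- have -> : M%:R * E t + 2 * E s = E (fun v => M%:R * t v + 2 * s v).
    by rewrite ED; [|by nn..]; rewrite !EZ.
  rewrite -EZ//; apply: (le_E (haff2 l0 sV)); nn => v.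
  have := mulr_ge0 (ltW l0) (sqr_ge0 (t v)); have := mulr_ge0 (ltW l0) (mulr_ge0 (t0 v) (s0 v)).
  have := mulr_ge0 (ltW l0) (mulr_ge0 (t0 v) (sqr_ge0 (t v))).
  have := mulr_ge0 (ltW l0) (r30 v).
  by rewrite -/(t v) -/(s v) -/(r3 v) /p !expr2; nra.
- have -> : E t + E (fun v => t v ^+ 2) = E (fun v => t v + t v ^+ 2) by rewrite ED.
  rewrite -EZ//; apply: (le_E (haff3 l0 sV)); nn => v.
  have := mulr_ge0 (ltW l0) (s0 v); have := mulr_ge0 (ltW l0) (mulr_ge0 (t0 v) (s0 v)).
  have := mulr_ge0 (ltW l0) (r30 v).
  by rewrite -/(t v) -/(s v) -/(r3 v) /p !expr2; nra.
Qed.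

Variable C : 'M[R]_N.
Hypotheses (Csym : C^T = C) (trCC : \tr (C *m C) <= \tr C ^+ 2).

Let H (v : vec) := hat l (lsubmx v).

Let nH : nice_mx H.
Proof.
apply: nice_mulmx; last by apply: nice_trmx; exact: nice_lsubmx.
apply: nice_mulmx; last exact: nice_res.
by apply: nice_mulmx; [exact: nice_lsubmx|exact: nice_res].
Qed.

Let dH i j : has_dir H (fun=> 0) i (rshift M j).
Proof.
have dW := @dir_lsubmx_r R n M N i j; have dR := @dir_res_r R n M N l l0 i j.
have := dir_mulmx (dir_mulmx (dir_mulmx dW dR) dR) (dir_trmx dW).
by move=> h v; have := h v; rewrite !(trmx0, mul0mx, mulmx0, addr0).
Qed.

Lemma quad_deviation c : 0 <= c ->
  E (fun v => (quad C (H v) v - \tr C * c) ^+ 2) <=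
  \tr C ^+ 2 * (dev M n c + 2 * c * l * (bound1 R M n + bound2 R M n + bound3 R M n *+ 2)).
Proof.
move=> c0; have [h1 h2 h3 h4] := resolvent_moments.
have Hsym v : (H v)^T = H v by exact: hat_sym.
have nq := nice_quad C nH.
have nq2 : nice (fun v => quad C (H v) v ^+ 2).
  by under eq_fun do rewrite expr2; exact: niceM.
have ntH : nice (fun v => \tr (H v)) by exact: nice_mxtrace.
have eq1 : E (fun v => (quad C (H v) v - \tr C * c) ^+ 2) =
    E (fun v => quad C (H v) v ^+ 2) - 2 * (\tr C * c) * E (fun v => quad C (H v) v) + (\tr C * c) ^+ 2.
  transitivity (E (fun v => quad C (H v) v ^+ 2 + ((- (2 * (\tr C * c))) * quad C (H v) v + (\tr C * c) ^+ 2))).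
    by apply: eq_Rintegral => w _; ring.
  rewrite ED; [|exact: nq2|by apply: niceD; [exact: niceZ|exact: nice_cst]].
  rewrite ED; [|exact: niceZ|exact: nice_cst].
  by rewrite EZ// Ec; ring.
have e2 := sq_mean_quad sV Csym nH Hsym dH.
have e1 := mean_quad sV C nH dH.
rewrite eq1 [E (fun v => quad _ _ _ ^+ 2)]e2 [E (fun v => quad _ _ _)]e1.
set a2 := \int[P]_w _; set a22 := \int[P]_w _; set a1 := \int[P]_w _.
have b2 : a2 <= bound2 R M n.
  apply: le_trans h3; apply: le_Rintegral => [//|||].
  - by have := intble_nice sV (niceM ntH ntH); under eq_fun do rewrite -expr2.
  - exact: (intble_nice sV nt2).
  - by move=> w _; rewrite lerXn2r ?nnegrE ?tr_hat_ge0 ?rtr1_ge0 ?tr_hat_le.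
have b22 : a22 <= bound3 R M n.
  apply: le_trans h4; apply: le_Rintegral => [//|||].
  - exact: (intble_nice sV (nice_mxtrace (nice_mulmx nH nH))).
  - exact: (intble_nice sV ns).
  - by move=> w _; exact: tr_hat2_le.
have a22_ge0 : 0 <= a22.
  apply: Rintegral_ge0 => w _.
  by rewrite -{2}[H _]Hsym -mdot_tr mdot_ge0.
have b1 : E t - l * E s <= a1.
  rewrite -mulNr -EZ// -ED//; last exact: niceZ.
  apply: le_Rintegral => [//|||].
  - exact: (intble_nice sV (niceD nt (niceZ (- l) ns))).
  - exact: (intble_nice sV ntH).
  - by move=> w _; rewrite tr_WRRW// mulNr.
have k1 : bound1 R M n - l * (bound1 R M n + bound2 R M n + bound3 R M n *+ 2) <= a1.
  have := ler_wpM2l (ltW l0) h4; rewrite mulr2n; lra.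
have k2 : 2 * \tr (C *m C) * a22 <= 2 * \tr C ^+ 2 * bound3 R M n.
  rewrite -[leLHS]mulrA -[leRHS]mulrA ler_wpM2l//.
  apply: (@le_trans _ _ (\tr C ^+ 2 * a22)); first by rewrite ler_wpM2r.
  by rewrite ler_wpM2l// sqr_ge0.
have k3 : \tr C ^+ 2 * a2 <= \tr C ^+ 2 * bound2 R M n by rewrite ler_wpM2l// sqr_ge0.
have cc : 0 <= 2 * c * \tr C ^+ 2 by rewrite mulr_ge0 ?sqr_ge0 ?mulr_ge0.
have k4 := ler_wpM2l cc k1.
exact: deviation_arith.
Qed.

End moments.

(** * Removal of the regularisation *)

Section limit.
Variable R : realType.

Definition derivable_mx m p (x : R) (F : R -> 'M[R]_(m, p)) :=
  forall i j, derivable (fun y => F y i j) x 1.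

Lemma derivable_mulmx m p q (x : R) (F : R -> 'M[R]_(m, p)) (G : R -> 'M[R]_(p, q)) :
  derivable_mx x F -> derivable_mx x G -> derivable_mx x (fun y => F y *m G y).
Proof.
move=> dF dG i j; have -> : (fun y => (F y *m G y) i j) = (fun y => \sum_k F y i k * G y k j).
  by apply/funext => y; rewrite mxE.
by apply: derivable_bigsum => k; apply: derivableM.
Qed.

Lemma derivable_cstmx m p (x : R) (A : 'M[R]_(m, p)) : derivable_mx x (fun=> A).
Proof. by move=> i j; exact: derivable_cst. Qed.

Lemma cvg_quad_hat n M N (C : 'M[R]_N) (v : 'M[R]_(n, M + N)) :
  (lsubmx v)^T *m lsubmx v \in unitmx ->
  quad C (hat k.+1%:R^-1 (lsubmx v)) v @[k --> \oo] --> quad C (hat 0 (lsubmx v)) v.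
Proof.
set W := lsubmx v => uB.
pose S (y : R) := reg y W.
(* [invmx] is defined by cases on invertibility. The adjugate formula has no cases, is
   differentiable at 0 because the determinant is nonzero there, and agrees with [res] wherever
   [S y] is invertible. *)
pose Rt (y : R) : 'M[R]_M := (\det (S y))^-1 *: \adj (S y).
have uS0 : S 0 \in unitmx by rewrite /S /reg (_ : 0%:M = 0) ?addr0//; apply/matrixP => i j; rewrite !mxE mul0rn.
have dS : derivable_mx 0 S.
  move=> i j; have -> : (fun y => S y i j) = (fun y => (i == j)%:R * y + (W^T *m W) i j).
    apply/funext => y; rewrite /S /reg addmxE addrC; congr (_ + _).
    by rewrite mxE mulr_natl.
  by case: (is_derive_affine ((i == j)%:R : R) ((W^T *m W) i j) 0).
have dRt : derivable_mx 0 Rt.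
  move=> i j; have -> : (fun y => Rt y i j) = (fun y => (\det (S y))^-1) * (fun y => cofactor (S y) j i).
    by apply/funext => y; rewrite /Rt !mxE.
  apply: derivableM; last exact: derivable_cofactor.
  by apply: derivableV; [rewrite -unitfE -unitmxE|exact: derivable_det].
pose F y := quad C (W *m Rt y *m Rt y *m W^T) v.
have dF : derivable F 0 1.
  apply: derivable_bigsum => i.
  suff h : derivable_mx 0 (fun y => (rsubmx v)^T *m (W *m Rt y *m Rt y *m W^T *m rsubmx v *m C)).
    exact: h.
  apply: derivable_mulmx; first exact: derivable_cstmx.
  do 3 (apply: derivable_mulmx; last exact: derivable_cstmx).
  apply: derivable_mulmx => //; apply: derivable_mulmx => //; exact: derivable_cstmx.
have FE y : S y \in unitmx -> F y = quad C (hat y W) v.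
  by move=> uS; rewrite /F /Rt /hat /res /invmx -/(S y) uS.
rewrite -(FE 0)//.
have -> : (fun k : nat => quad C (hat k.+1%:R^-1 W) v) = F \o (fun k => k.+1%:R^-1).
  by apply/funext => k /=; rewrite FE// /S reg_unit// invr_gt0.
have cF : {for (0 : R), continuous F}.
  by apply: differentiable_continuous; apply/derivable1_diffP.
exact: (cvg_comp _ _ cvg_harmonic cF).
Qed.

(** Lagrange's identity: the defect is half of a double sum of squares. *)
Lemma cauchy_schwarz (I : finType) (a b : I -> R) :
  (\sum_i a i * b i) ^+ 2 <= (\sum_i a i ^+ 2) * (\sum_i b i ^+ 2).
Proof.
have : 0 <= \sum_i \sum_j (a i * b j - a j * b i) ^+ 2.
  by apply: sumr_ge0 => i _; apply: sumr_ge0 => j _; exact: sqr_ge0.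
set A := \sum_i a i ^+ 2; set B := \sum_i b i ^+ 2; set D := \sum_i a i * b i.
suff -> : \sum_i \sum_j (a i * b j - a j * b i) ^+ 2 = 2 * (A * B) - 2 * D ^+ 2 by lra.
have h1 : \sum_i \sum_j a i ^+ 2 * b j ^+ 2 = A * B.
  by rewrite /A big_distrl/=; apply: eq_bigr => i _; rewrite big_distrr.
have h2 : \sum_i \sum_j a j ^+ 2 * b i ^+ 2 = A * B by rewrite exchange_big.
have h3 : \sum_i \sum_j (a i * b i) * (a j * b j) = D ^+ 2.
  by rewrite expr2 /D big_distrl/=; apply: eq_bigr => i _; rewrite big_distrr.
transitivity (\sum_i \sum_j (a i ^+ 2 * b j ^+ 2 + a j ^+ 2 * b i ^+ 2
    - 2 * ((a i * b i) * (a j * b j)))).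
  by apply: eq_bigr => i _; apply: eq_bigr => j _; ring.
transitivity (A * B + A * B - 2 * D ^+ 2); last by ring.
rewrite -{1}h1 -h2 -h3 -big_split/= mulr_sumr -sumrB; apply: eq_bigr => i _.
by rewrite -big_split/= mulr_sumr -sumrB.
Qed.

(** A null vector [u] of [W^T W] satisfies [u R = u / l], and the Frobenius norm of [R] dominates
    its effect on any vector. *)
Lemma rtr2_singular n M (W : 'M[R]_(n, M)) (l : R) : 0 < l ->
  W^T *m W \notin unitmx -> l ^- 2 <= rtr2 l W.
Proof.
move=> l0 nu.
have [u u0 uB] : exists2 u : 'rV[R]_M, u != 0 & u *m (W^T *m W) = 0.
  have : kermx (W^T *m W) != 0 by rewrite kermx_eq0 row_free_unit.
  by move=> /rowV0Pn[u /sub_kermxP uB u0]; exists u.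
have uR : u *m res l W = l^-1 *: u.
  have : u *m reg l W = l *: u by rewrite /reg mulmxDr uB add0r mul_mx_scalar.
  move/(congr1 (mulmx^~ (res l W))); rewrite -mulmxA mulmxV ?reg_unit// mulmx1 -scalemxAl => e.
  by rewrite [X in _ = _ *: X]e scalerA mulVf ?scale1r// gt_eqF.
rewrite rtr2_mdot//.
have uu : 0 < mdot u u by exact: mdot_gt0.
rewrite -(ler_pM2r uu).
have -> : l ^- 2 * mdot u u = mdot (u *m res l W) (u *m res l W).
  by rewrite uR mdotZr mdotC mdotZr mulrA -expr2 exprVn.
have sq m p (A : 'M[R]_(m, p)) : mdot A A = \sum_i \sum_j A i j ^+ 2.
  by apply: eq_bigr => i _; apply: eq_bigr => j _; rewrite expr2.
rewrite [leLHS]sq [mdot u u]sq !big_ord1 mulrC [mdot _ _]sq exchange_big/= mulr_sumr.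
apply: ler_sum => j _; rewrite mxE; exact: cauchy_schwarz.
Qed.

Section estimate.
Variables (n M N : nat).
Local Notation vec := 'M[R]_(n, M + N).
Context d (T : measurableType d) (P : probability T R) (V : T -> vec).
Hypothesis sV : std_gauss P V.
Hypothesis Mn : (M + 4 <= n)%N.
Let W w := lsubmx (V w).

Let nice_gram : nice_mx (fun v : vec => (lsubmx v)^T *m lsubmx v).
Proof. by apply: nice_mulmx; [apply: nice_trmx|]; exact: nice_lsubmx. Qed.

Let mdet : mfun (fun v : vec => \det ((lsubmx v)^T *m lsubmx v)).
Proof. by apply: mfun_det => i j; case: (nice_gram i j). Qed.

Definition singular := [set w | \det ((W w)^T *m W w) = 0].

Lemma measurable_singular : measurable singular.
Proof.
have h := mfun_comp mdet sV.1.
by rewrite -[X in measurable X]setTI; apply: (h measurableT [set 0]).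
Qed.

Lemma singularP w : singular w <-> ((W w)^T *m W w \notin unitmx).
Proof.
rewrite unitmxE unitfE negbK; split => [->|/eqP//].
by rewrite eqxx.
Qed.

(** By [rtr2_singular] and Markov's inequality the probability is at most [l^2] times [bound3], for
    every [l > 0], and [bound3] does not depend on [l]. *)
Lemma probability_singular : P singular = 0%E.
Proof.
have mS := measurable_singular.
have bd l : 0 < l -> (P singular <= (l ^+ 2 * bound3 R M n)%:E)%E.
  move=> l0.
  have n2 : nice (fun v : vec => rtr2 l (lsubmx v)) by exact: nice_rtr2.
  have [_ _ _ h] := resolvent_moments l0 Mn sV.
  apply: (@le_trans _ _ ((l ^+ 2) * \int[P]_w rtr2 l (W w))%:E); last first.
    by rewrite lee_fin ler_wpM2l// sqr_ge0.
  rewrite -Rintegral_indic// lee_fin -RintegralZl//; last exact: (intble_nice sV n2).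
  apply: le_Rintegral => [//|||w _].
  - exact: integrable_indic.
  - by apply: intbleZ; exact: (intble_nice sV n2).
  - rewrite indicE; case: (boolP (w \in singular)) => [/set_mem/singularP sw|_] /=.
      have := rtr2_singular l0 sw.
      by rewrite mulrC -ler_pdivrMr ?exprn_gt0// mul1r.
    by rewrite mulr_ge0 ?sqr_ge0// rtr2_ge0.
apply/eqP; rewrite eq_le measure_ge0 andbT.
(* [bound3] vanishes for [M = 0], so its sign is settled before it serves as a divisor in the choice
   of [l], which makes [l^2] times [bound3] equal to [e]. *)
have [b0|b0] := leP (bound3 R M n) 0.
  apply: le_trans (bd 1 ltr01) _.
  by rewrite lee_fin expr1n mul1r.
apply/lee_addgt0Pr => e e0; rewrite add0e.
pose l := Num.sqrt (e / bound3 R M n).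
have l0 : 0 < l by rewrite sqrtr_gt0 divr_gt0.
apply: le_trans (bd l l0) _.
by rewrite lee_fin sqr_sqrtr ?divfK ?gt_eqF// divr_ge0// ltW.
Qed.

Variable C : 'M[R]_N.
Hypotheses (Csym : C^T = C) (trCC : \tr (C *m C) <= \tr C ^+ 2).

Let nq l : 0 < l -> nice (fun v : vec => quad C (hat l (lsubmx v)) v).
Proof.
move=> l0; apply: nice_quad; apply: nice_mulmx; last by apply: nice_trmx; exact: nice_lsubmx.
apply: nice_mulmx; last exact: nice_res.
by apply: nice_mulmx; [exact: nice_lsubmx|exact: nice_res].
Qed.

Lemma estimate_deviation (c e : R) (D : T -> R) : 0 <= c -> 0 < e ->
  measurable_fun setT D ->
  (forall w, ~ singular w -> D w = quad C (hat 0 (W w)) (V w)) ->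
  (P [set w | (e <= `|D w - \tr C * c|)%R] <= (\tr C ^+ 2 * dev M n c / e ^+ 2)%:E)%E.
Proof.
move=> c0 e0 mD DE.
have mS := measurable_singular.
pose A := [set w | (e <= `|D w - \tr C * c|)%R].
have mA : measurable A.
  by apply: measurable_superlevel; apply: measurableT_comp => //; exact: measurable_funB.
have mAS : measurable (A `\` singular) by exact: measurableD.
have -> : P [set w | (e <= `|D w - \tr C * c|)%R] = P (A `\` singular).
  rewrite -/A (measureDI P mA mS) (@subset_measure0 _ _ _ P (A `&` singular) singular) ?adde0//.
    exact: measurableI.
  exact: probability_singular.
pose l (k : nat) : R := k.+1%:R^-1.
have l0 k : 0 < l k by rewrite invr_gt0.
pose B := A `\` singular.
(* The indicator of [B] makes [f k] converge at every point: at singular points nothing is known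
   about the forms or about [D]. *)
pose f k w := \1_B w * (quad C (hat (l k) (W w)) (V w) - \tr C * c) ^+ 2.
have mB : measurable_fun setT (\1_B : T -> R) by exact: measurable_indic.
have mf k : measurable_fun setT (f k).
  apply: measurable_funM => //; apply: measurable_funX; apply: measurable_funB => //.
  by have [h _ _] := nq (l0 k); exact: (mfun_comp h sV.1).
pose K := bound1 R M n + bound2 R M n + bound3 R M n *+ 2.
have If k : (\int[P]_w (f k w)%:E <= (\tr C ^+ 2 * (dev M n c + 2 * c * l k * K))%:E)%E.
  have i2 : P.-intble (fun w => (quad C (hat (l k) (W w)) (V w) - \tr C * c) ^+ 2).
    have h := niceB (nq (l0 k)) (nice_cst _ _ (\tr C * c)).
    by have := intble_nice sV (niceM h h); under eq_fun do rewrite -expr2.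
  apply: (@le_trans _ _ (\int[P]_w ((quad C (hat (l k) (W w)) (V w) - \tr C * c) ^+ 2)%:E)%E).
    apply: ge0_le_integral => //.
    - by move=> w _; rewrite lee_fin mulr_ge0 ?sqr_ge0.
    - exact/measurable_EFinP.
    - by case/integrableP: i2.
    - move=> w _; rewrite lee_fin ler_piMl ?sqr_ge0//.
  rewrite -EFin_Rintegral// lee_fin.
  exact: (quad_deviation (l0 k) Mn sV Csym trCC c0).
have fat : (\int[P]_w limn_einf (fun k => (f k w)%:E) <= limn_einf (fun k => \int[P]_w (f k w)%:E))%E.
  apply: fatou => //; first by move=> k; exact/measurable_EFinP.
  by move=> k w _; rewrite lee_fin mulr_ge0 ?sqr_ge0.
have B_cvg : (\tr C ^+ 2 * (dev M n c + 2 * c * l k * K))%:E @[k --> \oo] -->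
    (\tr C ^+ 2 * dev M n c)%:E.
  apply: cvg_EFin; first by near=> k.
  have -> : \tr C ^+ 2 * dev M n c = \tr C ^+ 2 * (dev M n c + 2 * c * 0 * K) by ring.
  apply: cvgMl_tmp; apply: cvgD; first exact: cvg_cst.
  by apply: cvgMr_tmp; apply: cvgMl_tmp; exact: cvg_harmonic.
have lim_le : (limn_einf (fun k => \int[P]_w (f k w)%:E) <= (\tr C ^+ 2 * dev M n c)%:E)%E.
  rewrite limn_einf_lim -(cvg_lim _ B_cvg)//; apply: lee_lim.
  - exact: is_cvg_einfs.
  - by apply/cvg_ex; eexists; exact: B_cvg.
  - near=> k; apply: le_trans (If k).
    by apply: ereal_inf_lbound; exists k => //=.
have e20 : 0 < e ^+ 2 by rewrite exprn_gt0.
rewrite EFinM lee_pdivlMr//.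
apply: le_trans (le_trans fat lim_le).
have -> : (P B * (e ^+ 2)%:E = \int[P]_w (e ^+ 2 * \1_B w)%:E)%E.
  under eq_integral do rewrite EFinM.
  rewrite ge0_integralZl//; last 2 first.
  - exact/measurable_EFinP.
  - by rewrite lee_fin ltW.
  by rewrite integral_indic ?setIT// muleC.
have limE w : limn_einf (fun k => (f k w)%:E) = (\1_B w * (D w - \tr C * c) ^+ 2)%:E.
  suff cv : (f k w)%:E @[k --> \oo] --> (\1_B w * (D w - \tr C * c) ^+ 2)%:E.
    by rewrite (cvg_limn_einf_sup cv).1.
  apply: cvg_EFin; first by near=> k.
  rewrite /f indicE; case: (boolP (w \in _)) => [/set_mem[Aw Sw]|_] /=; last first.
    by under eq_fun do rewrite mul0r; rewrite mul0r; exact: cvg_cst.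
  rewrite DE//; apply: cvgMl_tmp; under eq_fun do rewrite expr2.
  have h : quad C (hat (l k) (W w)) (V w) - \tr C * c @[k --> \oo] -->
     quad C (hat 0 (W w)) (V w) - \tr C * c.
    apply: cvgB; last exact: cvg_cst.
    by apply: cvg_quad_hat; apply/negPn/negP => /singularP.
  by rewrite expr2; exact: cvgM.
under [leRHS]eq_integral do rewrite limE.
apply: ge0_le_integral => //.
- by move=> w _; rewrite lee_fin mulr_ge0// ltW.
- by apply/measurable_EFinP; exact: measurable_funM.
- apply/measurable_EFinP; apply: measurable_funM => //.
  by apply: measurable_funX; exact: measurable_funB.
move=> w _; rewrite lee_fin indicE; case: (boolP (w \in _)) => [/set_mem[Aw Sw]|_] /=.
  rewrite mulr1 mul1r -(real_normK (num_real (D w - _))).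
  by rewrite lerXn2r// nnegrE// ltW.
by rewrite mulr0 mul0r.
Unshelve. all: by end_near.
Qed.

End estimate.

End limit.

(** * Positive definite matrices *)

Section posdef_theory.
Variable R : realType.

Lemma diag_quad k (B : 'M[R]_k) i :
  B i i = ((delta_mx 0 i : 'rV[R]_k) *m B *m (delta_mx 0 i : 'rV[R]_k)^T) 0 0.
Proof. by rewrite -rowE trmx_delta -colE !mxE. Qed.

Lemma posdef_congr k (K A : 'M[R]_k) : K \in unitmx -> posdef A ->
  posdef (K *m A *m K^T).
Proof.
move=> uK [As Ap]; split; first by rewrite !trmx_mul trmxK As mulmxA.
move=> u u0; have := Ap (u *m K); rewrite trmx_mul !mulmxA; apply.
by apply: contra u0 => /eqP e; rewrite -(mulmxK uK u) e mul0mx.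
Qed.

Lemma posdef_inv k (A : 'M[R]_k) : posdef A -> posdef (invmx A).
Proof.
move=> pA; have uA := posdef_unit pA; have As := pA.1.
have uV : invmx A \in unitmx by rewrite unitmx_inv.
have := posdef_congr uV pA.
by rewrite trmx_inv As mulVmx// mul1mx.
Qed.

Lemma posdef_add k (A B : 'M[R]_k) : posdef A -> B^T = B ->
  (forall u : 'rV[R]_k, 0 <= (u *m B *m u^T) 0 0) -> posdef (A + B).
Proof.
move=> [As Ap] Bs Bp; split; first by rewrite linearD/= As Bs.
by move=> u u0; rewrite mulmxDr mulmxDl addmxE ltr_wpDr// Ap.
Qed.

Lemma posdef_psd k (A : 'M[R]_k) (u : 'rV[R]_k) : posdef A -> 0 <= (u *m A *m u^T) 0 0.
Proof.
by move=> [_ Ap]; have [->|/Ap/ltW//] := eqVneq u 0; rewrite !mul0mx mxE.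
Qed.

Lemma psd_unit_posdef k (A : 'M[R]_k) : A^T = A -> A \in unitmx ->
  (forall u : 'rV[R]_k, 0 <= (u *m A *m u^T) 0 0) -> posdef A.
Proof.
move=> As uA Ap; split=> // u u0; rewrite lt_neqAle Ap andbT eq_sym.
apply: contra u0 => /eqP q0.
set v := u *m A; have [v0|v0] := eqVneq v 0.
  by rewrite -(mulmxK uA u) -/v v0 mul0mx.
have a0 : 0 < (v *m v^T) 0 0 by rewrite -mdot_row mdot_gt0.
have b0 := Ap v; set a := (v *m v^T) 0 0 in a0; set b := (v *m A *m v^T) 0 0 in b0.
(* If [u A u^T = 0], moving from [u] by [- s v] with [v = u A] gives the form the value
   [- 2 s a + s^2 b], negative for [s = a / (b + 1)]. Adding 1 keeps the divisor positive when
   [b = 0]. *)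
have := Ap (u - (a / (b + 1)) *: v).
set s := a / (b + 1).
have -> : ((u - s *: v) *m A *m (u - s *: v)^T) 0 0 = (u *m A *m u^T) 0 0 - 2 * s * a + s ^+ 2 * b.
  have e1 : A *m u^T = v^T by rewrite /v trmx_mul As.
  have -> : (u - s *: v)^T = u^T - s *: v^T by rewrite linearB/= linearZ.
  rewrite !mulmxBl !mulmxBr -!scalemxAl -!scalemxAr -/v scalerA.
  rewrite -[v *m A *m u^T]mulmxA e1 !(addmxE, oppmxE, scalemxE) -/a -/b; ring.
rewrite q0 /s => h; exfalso; move: h; apply/negP; rewrite -ltNge.
have bp : 0 < b + 1 by rewrite ltr_wpDl.
have -> : 0 - 2 * (a / (b + 1)) * a + (a / (b + 1)) ^+ 2 * b = - (a ^+ 2 * (b + 2) / (b + 1) ^+ 2).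
  by field; rewrite gt_eqF.
rewrite oppr_lt0 divr_gt0// ?exprn_gt0// mulr_gt0 ?exprn_gt0// ltr_wpDl//.
Qed.

(** Block elimination: [L] clears the first row and column, and leaves the Schur complement [S],
    positive definite because congruence preserves positivity; induction applies to [S]. *)
Lemma posdef_factor k (A : 'M[R]_k) : posdef A ->
  exists2 K, K \in unitmx & K *m A *m K^T = 1%:M.
Proof.
elim: k A => [A _|k IH].
  by exists 1%:M; rewrite ?unitmx1//; apply/matrixP => -[].
rewrite -[k.+1]/(1 + k)%N => A pA.
pose a := A 0 0; pose b := dlsubmx A; pose r := (Num.sqrt a)^-1.
have a0 : 0 < a.
  have d0 : (delta_mx 0 0 : 'rV[R]_(1 + k)) != 0.
    by apply/eqP => /matrixP/(_ 0 0); rewrite !mxE/= => /eqP; rewrite oner_eq0.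
  by have := pA.2 _ d0; rewrite -diag_quad.
have s0 : Num.sqrt a != 0 by rewrite gt_eqF// sqrtr_gt0.
have AE : A = block_mx a%:M b^T b (drsubmx A).
  rewrite -[LHS](submxK A); congr block_mx.
    by rewrite [LHS]mx11_scalar !mxE; congr (A _ _)%:M; apply/val_inj.
  by rewrite /b trmx_dlsub pA.1.
pose L : 'M[R]_(1 + k) := block_mx 1%:M 0 (- a^-1 *: b) 1%:M.
have uL : L \in unitmx by rewrite unitmxE det_lblock !det1 mulr1 unitr1.
pose S := drsubmx A - a^-1 *: (b *m b^T).
have LAL : L *m A *m L^T = block_mx a%:M 0 0 S.
  rewrite AE /L tr_block_mx !mulmx_block !(trmx1, trmx0, mul1mx, mulmx1, mul0mx, mulmx0, addr0, add0r).
  have e : - a^-1 *: b *m a%:M + b = 0.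
    by rewrite mul_mx_scalar scalerA mulrN mulfV ?gt_eqF// scaleN1r addNr.
  rewrite e mul0mx add0r; congr block_mx; last by rewrite scaleNr mulNmx -scalemxAl addrC.
  by apply: trmx_inj; rewrite linearD/= trmx_mul !trmxK tr_scalar_mx e trmx0.
have pS : posdef S.
  have := posdef_congr uL pA; rewrite LAL => -[Bs Bp]; split.
    by move: Bs; rewrite tr_block_mx => /eq_block_mx[].
  move=> u u0; have := Bp (row_mx 0 u).
  rewrite tr_row_mx mul_row_block mul_row_col !(mul0mx, mulmx0, add0r, trmx0); apply.
  by apply: contra u0 => /eqP; rewrite -row_mx0 => /eq_row_mx[_ ->].
have [K uK KS] := IH S pS.
exists (block_mx r%:M 0 0 K *m L).
  rewrite unitmx_mul uL andbT unitmxE det_ublock det_scalar1 unitrM -unitmxE uK andbT unitfE.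
  by rewrite invr_eq0.
rewrite trmx_mul !mulmxA -[_ *m L *m A]mulmxA -[_ *m (L *m A) *m L^T]mulmxA LAL.
rewrite tr_block_mx !mulmx_block !(trmx0, mul0mx, mulmx0, addr0, add0r) KS tr_scalar_mx.
rewrite -!scalar_mxM (_ : r * a * r = 1) -?scalar_mx_block//.
by rewrite /r -{2}(sqr_sqrtr (ltW a0)); field.
Qed.

Variables (M N : nat) (A : 'M[R]_(M, N)) (Cx : 'M[R]_N) (Cz : 'M[R]_M).
Hypotheses (pCx : posdef Cx) (pCz : posdef Cz).

Definition C_YY : 'M[R]_M := A *m Cx *m A^T + Cz.

Lemma posdef_C_YY : posdef C_YY.
Proof.
rewrite /C_YY addrC; apply: posdef_add => //.
  by rewrite !trmx_mul trmxK pCx.1 mulmxA.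
by move=> u; have := posdef_psd (u *m A) pCx; rewrite trmx_mul !mulmxA.
Qed.

Let S := A^T *m invmx Cz *m A + invmx Cx.

Let pS : posdef S.
Proof.
rewrite /S addrC; apply: posdef_add; first exact: posdef_inv.
  by rewrite !trmx_mul trmxK trmx_inv pCz.1 mulmxA.
by move=> u; have := posdef_psd (u *m A^T) (posdef_inv pCz); rewrite trmx_mul trmxK !mulmxA.
Qed.

Let SCx : S *m Cx *m A^T = A^T *m invmx Cz *m C_YY.
Proof.
rewrite /S /C_YY !mulmxDl mulVmx ?posdef_unit// mul1mx mulmxDr !mulmxA; congr (_ + _).
by rewrite mulmxKV ?posdef_unit.
Qed.

(** By [SCx], [S Cx A^T = A^T Cz^-1 C_YY]; inverting [S] on one side and [C_YY] on the other matches
    the two classical forms of the estimator. *)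
Lemma Theta_starE : (Theta_star A Cx Cz)^T = Cx *m A^T *m invmx C_YY.
Proof.
have uS := posdef_unit pS; have uY := posdef_unit posdef_C_YY.
rewrite /Theta_star trmxK -/S; apply: (can_inj (mulKmx uS)).
by rewrite !mulmxA mulmxV// mul1mx SCx mulmxK.
Qed.

(** Woodbury's identity: [C_EE] is the inverse of the positive definite matrix [S]. *)
Lemma posdef_C_EE : posdef (C_EE A Cx Cz).
Proof.
have uS := posdef_unit pS; have uY := posdef_unit posdef_C_YY.
suff -> : C_EE A Cx Cz = invmx S by exact: posdef_inv.
apply: (can_inj (mulKmx uS)); rewrite mulmxV// /C_EE -/C_YY mulmxBr !mulmxA SCx.
by rewrite mulmxK// /S mulmxDl mulVmx ?posdef_unit// addrAC subrr add0r.
Qed.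

Lemma C_EE_cross : Cx *m A^T - (Theta_star A Cx Cz)^T *m C_YY = 0.
Proof. by rewrite Theta_starE mulmxKV ?subrr// posdef_unit//; exact: posdef_C_YY. Qed.

Lemma C_EE_Theta : C_EE A Cx Cz = Cx - (Theta_star A Cx Cz)^T *m A *m Cx.
Proof. by rewrite Theta_starE. Qed.

Lemma trace_posdef_gt0 k (B : 'M[R]_k) : (0 < k)%N -> posdef B -> 0 < \tr B.
Proof.
move=> k0 [_ Bp]; rewrite /mxtrace (bigD1 (Ordinal k0))//=.
have d i : 0 < B i i.
  rewrite diag_quad Bp//; apply/eqP => /matrixP/(_ 0 i); rewrite !mxE !eqxx => /eqP.
  by rewrite oner_eq0.
by rewrite ltr_wpDr// sumr_ge0// => i _; rewrite ltW.
Qed.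

Lemma trace_psd_ge0 k (B : 'M[R]_k) :
  (forall u : 'rV[R]_k, 0 <= (u *m B *m u^T) 0 0) -> 0 <= \tr B.
Proof.
move=> Bp; apply: sumr_ge0 => i _.
by rewrite diag_quad.
Qed.

Lemma trace_C_EE_le : \tr (C_EE A Cx Cz) <= \tr Cx.
Proof.
rewrite /C_EE -/C_YY linearB/= gerBl; apply: trace_psd_ge0 => u.
have := posdef_psd (u *m Cx *m A^T) (posdef_inv posdef_C_YY).
by rewrite !trmx_mul trmxK pCx.1 !mulmxA.
Qed.

End posdef_theory.

(** Cauchy-Schwarz for the columns of [L] gives [C_ij^2 <= C_ii C_jj]; summing over [i] and [j]
    gives the claim. *)
Lemma tr_gram_sq_le (R : realType) m k (L : 'M[R]_(m, k)) :
  \tr (L^T *m L *m (L^T *m L)) <= \tr (L^T *m L) ^+ 2.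
Proof.
set C := L^T *m L.
have Cs : C^T = C by rewrite /C trmx_mul trmxK.
have CE i j : C i j = \sum_p L p i * L p j by rewrite mxE; apply: eq_bigr => p _; rewrite mxE.
rewrite -{2}Cs -mdot_tr expr2 /mxtrace big_distrl/=; apply: ler_sum => i _.
rewrite big_distrr/=; apply: ler_sum => j _; rewrite -expr2 !CE.
under [X in _ <= X * _]eq_bigr do rewrite -expr2.
under [X in _ <= _ * X]eq_bigr do rewrite -expr2.
exact: cauchy_schwarz.
Qed.

(** * Independence *)

Section independence_integral.
Context d d1 (T : measurableType d) (T1 : measurableType d1) (R : realType).
Variables (P : probability T R) (v : T -> T1).
Hypothesis mv : measurable_fun setT v.
Local Notation leb := (@lebesgue_measure R).

Lemma Rintegral_ind (b : R) : 0 <= b -> \int[leb]_x ind 0 b x = b.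
Proof.
move=> b0; rewrite indE /Rintegral integral_indic// setIT.
have := @lebesgue_measure_itv R `]0, b]; rewrite /= lte_fin => ->.
by case: ltP (b0) => [_ _|b0' _]; [rewrite oppr0 adde0|apply/eqP; rewrite eq_le b0 b0'].
Qed.

(** [h (v w)] is the length of []0, h (v w)]]. Fubini then leaves indicators of superlevel sets, on
    which independence of events acts. *)
Lemma layer_cake (U : T -> R) (h : T1 -> R) :
  measurable_fun setT U -> (forall w, `|U w| <= 1) ->
  measurable_fun setT h -> (forall y, 0 <= h y <= 1) ->
  \int[P]_w (U w * h (v w)) =
  \int[leb]_s ((0 < s)%R%:R * \int[P]_w (U w * \1_[set y | s <= h y] (v w))).
Proof.
move=> mU U1 mh h01.
pose f (z : T * measurableTypeR R) := U z.1 * ind 0 (h (v z.1)) z.2.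
have fE w s : f (w, s) = (0 < s)%R%:R * (U w * \1_[set y | s <= h y] (v w)).
  rewrite /f /ind indicE/= mulrCA; congr (_ * _); rewrite -natrM mulnb; congr (_ && _)%:R.
  by apply/idP/idP; rewrite inE.
have mf : measurable_fun setT f.
  apply: measurable_funM; first exact: (measurableT_comp mU measurable_fst).
  have m1 : measurable_fun setT (fun z : T * measurableTypeR R => (0 < z.2)%R).
    by apply: measurable_fun_ltr => //; exact: measurable_snd.
  have m2 : measurable_fun setT (fun z : T * measurableTypeR R => (z.2 <= h (v z.1))%R).
    apply: measurable_fun_ler; first exact: measurable_snd.
    by apply: (measurableT_comp mh); apply: (measurableT_comp mv); exact: measurable_fst.
  have -> : (fun z : T * measurableTypeR R => ind 0 (h (v z.1)) z.2) =
      fun z => if (0 < z.2) && (z.2 <= h (v z.1)) then 1 else 0.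
    by apply/funext => z; rewrite /ind; case: ifP.
  by apply: measurable_fun_ifT => //; exact: measurable_and.
have hi : leb.-intble (ind 0 1 : measurableTypeR R -> R).
  by rewrite indE; exact: integrable_indic_itv.
have fh w s : `|f (w, s)| <= ind 0 1 s.
  rewrite /f normrM -[leRHS]mul1r ler_pM//=.
  have /andP[_ h1] := h01 (v w); rewrite /ind ger0_norm// ler_nat.
  by case: (0 < s) => //=; case: leP => //= /le_trans/(_ h1) ->.
have := @Rfubini_dom _ _ _ _ _ P leb f _ mf hi fh.
have <- : \int[P]_w (U w * h (v w)) = \int[P]_w \int[leb]_s f (w, s).
  apply: eq_Rintegral => w _; rewrite /f/= RintegralZl//.
    by rewrite Rintegral_ind//; case/andP: (h01 (v w)).
  by rewrite indE; exact: integrable_indic_itv.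
move=> ->; apply: eq_Rintegral => s _.
under eq_Rintegral do rewrite fE.
rewrite RintegralZl//; apply: (@intble_bounded _ _ _ P _ 1) => [|w].
  apply: measurable_funM => //; apply: (measurableT_comp _ mv).
  by apply: measurable_indic; exact: measurable_superlevel.
by rewrite normrM -[leRHS]mulr1 ler_pM// norm_indic.
Qed.

Variables (U : T -> R) (k : R).
Hypotheses (mU : measurable_fun setT U) (U1 : forall w, `|U w| <= 1).
Hypothesis indep : forall B, measurable B ->
  \int[P]_w (U w * \1_B (v w)) = k * \int[P]_w \1_B (v w).

(** [h] is mapped affinely into [[0, 1]], where [layer_cake] reduces both sides to superlevel sets.
    It is applied with weight [U] and again with the constant weight [k], which is allowed because
    [|k| <= 1]. *)
Lemma Rintegral_indep (h : T1 -> R) :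
  measurable_fun setT h -> (forall y, `|h y| <= 1) ->
  \int[P]_w (U w * h (v w)) = k * \int[P]_w h (v w).
Proof.
move=> mh h1.
have i1 (f : T -> R) K : measurable_fun setT f -> (forall w, `|f w| <= K) -> P.-intble f.
  exact: intble_bounded.
have mhv : measurable_fun setT (fun w => h (v w)) by exact: measurableT_comp.
pose g y := (h y + 1) / 2.
have mg : measurable_fun setT g by apply: measurable_funM => //; exact: measurable_funD.
have g01 y : 0 <= g y <= 1 by have := h1 y; rewrite ler_norml /g => /andP[? ?]; apply/andP; split; lra.
have hg y : h y = 2 * g y - 1 by rewrite /g; field.
have UE : \int[P]_w U w = k.
  have := indep measurableT; rewrite indicT.
  by under eq_Rintegral do rewrite mulr1; rewrite Rintegral_cst1 mulr1.
have k1 : `|k| <= 1.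
  rewrite -UE; apply: le_trans (Rintegral_abs_le (g := fun=> 1) _ _ _) _ => //.
    exact: (i1 _ 1).
  by rewrite Rintegral_cst1.
have gE : \int[P]_w (U w * g (v w)) = k * \int[P]_w g (v w).
  rewrite -RintegralZl//; last first.
    apply: (i1 _ 1); first exact: measurableT_comp.
    by move=> w; have /andP[? ?] := g01 (v w); rewrite ger0_norm.
  rewrite (layer_cake mU U1 mg g01) (layer_cake (measurable_cst k) (fun=> k1) mg g01).
  apply: eq_Rintegral => s _; congr (_ * _).
  have mB : measurable [set y | s <= g y] by exact: measurable_superlevel.
  rewrite indep// RintegralZl//; apply: (i1 _ 1).
    apply: (measurableT_comp _ mv); exact: measurable_indic.
  by move=> w; exact: norm_indic.
have mgv : measurable_fun setT (fun w => g (v w)) by exact: measurableT_comp.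
have gn w : `|g (v w)| <= 1 by have /andP[? ?] := g01 (v w); rewrite ger0_norm.
transitivity (\int[P]_w (2 * (U w * g (v w)) - U w)).
  by apply: eq_Rintegral => w _; rewrite hg; ring.
rewrite RintegralB//; last 2 first.
- apply: intbleZ; apply: (i1 _ 1); first exact: measurable_funM.
  by move=> w; rewrite normrM -[leRHS]mulr1 ler_pM.
- exact: (i1 _ 1).
rewrite RintegralZl//; last first.
  apply: (i1 _ 1); first exact: measurable_funM.
  by move=> w; rewrite normrM -[leRHS]mulr1 ler_pM.
have -> : \int[P]_w h (v w) = 2 * \int[P]_w g (v w) - 1.
  transitivity (\int[P]_w (2 * g (v w) - 1)); first by apply: eq_Rintegral => w _; rewrite hg.
  rewrite RintegralB ?RintegralZl ?Rintegral_cst1//; try exact: (i1 _ 1).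
  by apply: intbleZ; exact: (i1 _ 1).
by rewrite gE UE; ring.
Qed.

End independence_integral.

(** The sines of the addition formula are written as shifted cosines, since the hypotheses below
    speak of cosines with an arbitrary phase. *)
Lemma cosD_shift (R : realType) (a b : R) :
  cos (a + b) = cos a * cos b - cos (a + - (pi / 2)) * cos (b + - (pi / 2)).
Proof.
have h (x : R) : cos (x + - (pi / 2)) = sin x.
  by rewrite cosB cos_pihalf sin_pihalf mulr0 add0r mulr1.
by rewrite !h cosD.
Qed.

Section independent_cos.
Context d d1 (T : measurableType d) (T1 : measurableType d1) (R : realType).
Variables (P : probability T R) (v : T -> T1) (U : T -> R) (g : T -> R) (f : T1 -> R) (k e : R).
Hypotheses (mv : measurable_fun setT v) (mU : measurable_fun setT U).
Hypotheses (mg : measurable_fun setT g) (mf : measurable_fun setT f).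
Hypothesis U1 : forall w, `|U w| <= 1.
Hypothesis indep : forall B c, measurable B ->
  \int[P]_w (U w * \1_B (v w) * cos (g w + c)) = k * cos c * \int[P]_w \1_B (v w).
Hypothesis fe : forall c, \int[P]_w cos (f (v w) + c) = e * cos c.

(** Each product in the addition formula factorises by independence; the one with shifted phases
    contributes the factor [cos (- pi / 2) = 0]. *)
Lemma Rintegral_indep_cos c :
  \int[P]_w (U w * cos (f (v w) + g w + c)) = k * e * cos c.
Proof.
have step c1 c2 : \int[P]_w (U w * cos (g w + c1) * cos (f (v w) + c2)) =
    k * cos c1 * (e * cos c2).
  rewrite -fe; apply: (@Rintegral_indep _ _ _ _ _ P v mv (fun w => U w * cos (g w + c1)) (k * cos c1)
     _ _ _ (fun y => cos (f y + c2))).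
  - by apply: measurable_funM => //; apply: measurable_cosf; exact: measurable_funD.
  - by move=> w; rewrite normrM -[leRHS]mulr1 ler_pM// cos_max.
  - move=> B mB; rewrite -indep//.
    by apply: eq_Rintegral => w _; rewrite mulrAC.
  - by apply: measurable_cosf; exact: measurable_funD.
  - by move=> y; exact: cos_max.
transitivity (\int[P]_w (U w * cos (g w + c) * cos (f (v w) + 0) -
    U w * cos (g w + (c - pi / 2)) * cos (f (v w) + - (pi / 2)))).
  apply: eq_Rintegral => w _; rewrite addr0.
  have -> : cos (f (v w) + g w + c) = cos (f (v w)) * cos (g w + c) -
      cos (f (v w) + - (pi / 2)) * cos (g w + (c - pi / 2)).
    by rewrite -addrA [LHS]cosD_shift addrA.
  ring.
have mi c1 c2 : P.-intble (fun w => U w * cos (g w + c1) * cos (f (v w) + c2)).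
  apply: (@intble_bounded _ _ _ P _ 1) => [|w].
    apply: measurable_funM; first apply: measurable_funM => //.
      by apply: measurable_cosf; exact: measurable_funD.
    apply: measurable_cosf; apply: measurable_funD => //; exact: measurableT_comp.
  by rewrite !normrM -[leRHS]mulr1 ler_pM// ?cos_max// -[leRHS]mulr1 ler_pM// cos_max.
rewrite RintegralB// !step cos0 cosN cos_pihalf; ring.
Qed.

End independent_cos.

Section mutual.
Context d d1 (T : measurableType d) (T1 : measurableType d1) (R : realType).
Variables (P : probability T R) (n : nat) (V : 'I_n -> {RV P >-> T1}).
Hypothesis Vindep : mutually_independent V.
Variables (f : 'I_n -> T1 -> R) (e : 'I_n -> R).
Hypothesis mf : forall i, measurable_fun setT (f i).
Hypothesis fe : forall i c, \int[P]_w cos (f i (V i w) + c) = e i * cos c.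

Let ind_prod (B : 'I_n -> set T1) w : R := \prod_i \1_(B i) (V i w).

Let mind B i : measurable (B i) -> measurable_fun setT (fun w => \1_(B i) (V i w) : R).
Proof.
move=> mB; apply: (measurableT_comp _ (measurable_funPT (V i))).
exact: measurable_indic.
Qed.

Let mprod B : (forall i, measurable (B i)) -> measurable_fun setT (ind_prod B).
Proof. by move=> mB; apply: measurable_prod_fun => i; exact: mind. Qed.

Let norm_prod B w : `|ind_prod B w| <= 1.
Proof.
rewrite /ind_prod; apply: (big_ind (fun x => `|x| <= 1)); first by rewrite normr1.
  by move=> x y x1 y1; rewrite normrM -[leRHS]mulr1 ler_pM.
by move=> i _; exact: norm_indic.
Qed.

Let indep_prod B : (forall i, measurable (B i)) ->
  \int[P]_w ind_prod B w = \prod_i \int[P]_w \1_(B i) (V i w).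
Proof.
move=> mB; apply: EFin_inj.
transitivity (P (\bigcap_i (V i @^-1` B i))).
  rewrite -Rintegral_indic; last first.
    by apply: fin_bigcap_measurable => // i _; exact: measurable_funPTI.
  congr EFin; apply: eq_Rintegral => w _; rewrite /ind_prod indicE.
  case: (boolP (w \in _)) => [/set_mem h|/negP h].
    by rewrite big1// => i _; rewrite indicE mem_set//; exact: h.
  have [i Bi] : exists i, ~ B i (V i w).
    by apply: contrapT => /forallNP h1; apply: h; rewrite inE => i _; apply: contrapT; exact: h1.
  by rewrite (bigD1 i)//= indicE memNset// mul0r.
rewrite Vindep// (big_morph EFin EFinM (erefl _)).
by apply: eq_bigr => i _; rewrite Rintegral_indic_RV.
Qed.

(** Indices outside [r] may carry indicator constraints. This freedom drives the induction: the
    event that tests independence from the new index [k] is put back into the family, as [B']. *)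
Let cos_sum (r : seq 'I_n) : uniq r -> forall B c, (forall i, measurable (B i)) ->
  (forall i, i \in r -> B i = setT) ->
  \int[P]_w (ind_prod B w * cos (\sum_(i <- r) f i (V i w) + c)) =
  \prod_i \int[P]_w \1_(B i) (V i w) * \prod_(i <- r) e i * cos c.
Proof.
elim: r => [_ B c mB _|k r IH /= /andP[kr ur] B c mB Br].
  rewrite -indep_prod// big_nil mulr1 mulrC -RintegralZl//.
    by apply: eq_Rintegral => w _; rewrite big_nil add0r mulrC.
  by apply: (@intble_bounded _ _ _ P _ 1); [exact: mprod|exact: norm_prod].
under eq_Rintegral do rewrite big_cons.
rewrite big_cons [e k * _]mulrC mulrA.
apply: (@Rintegral_indep_cos _ _ _ _ _ P (V k) (ind_prod B) (fun w => \sum_(i <- r) f i (V i w)) (f k)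
  (\prod_i \int[P]_w \1_(B i) (V i w) * \prod_(i <- r) e i)) => //.
- exact: mprod.
- by apply: measurable_sum_fun => i; exact: measurableT_comp.
move=> D c' mD; pose B' i := if i == k then D else B i.
have mB' i : measurable (B' i) by rewrite /B'; case: eqP.
have B'r i : i \in r -> B' i = setT.
  move=> ir; rewrite /B'; case: eqP => [ik|_]; first by rewrite -ik ir in kr.
  by apply: Br; rewrite inE ir orbT.
have Bk : B k = setT by apply: Br; rewrite inE eqxx.
have BE (F : 'I_n -> set T1 -> R) : F k setT = 1 ->
    \prod_i F i (B' i) = \prod_i F i (B i) * F k D.
  move=> Fk; rewrite (bigD1 k)//= [in RHS](bigD1 k)//= Bk Fk mul1r mulrC /B' eqxx.
  by congr (_ * _); apply: eq_bigr => i /negbTE ->.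
transitivity (\int[P]_w (ind_prod B' w * cos (\sum_(i <- r) f i (V i w) + c'))).
  apply: eq_Rintegral => w _; congr (_ * _).
  by rewrite /ind_prod (BE (fun i D => \1_D (V i w)))// indicT.
rewrite (IH ur B' c' mB' B'r) (BE (fun i D => \int[P]_w \1_D (V i w))).
  by rewrite mulrAC -!mulrA; congr (_ * _); rewrite mulrCA [in RHS]mulrC -mulrA.
by rewrite indicT Rintegral_cst1.
Qed.

Lemma mutual_cos c : \int[P]_w cos (\sum_i f i (V i w) + c) = (\prod_i e i) * cos c.
Proof.
have h := @cos_sum _ (index_enum_uniq _) (fun=> setT) c (fun=> measurableT) (fun _ _ => erefl).
rewrite -[RHS]mul1r mulrA -[X in X * _ * _](_ : \prod_(i < n) \int[P]_w \1_setT (V i w) = 1).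
  rewrite -h; apply: eq_Rintegral => w _.
  by rewrite /ind_prod [X in _ = X * _]big1 ?mul1r// => i _; rewrite indicT.
by rewrite big1// => i _; rewrite indicT Rintegral_cst1.
Qed.

End mutual.

(** * Gaussian vectors through their linear forms *)

Section gaussian_vectors.
Context d (T : measurableType d) (R : realType) (P : probability T R).
Variables (k : nat) (V : {RV P >-> k.-tuple R}).
Hypotheses (gV : gaussian_vector V) (zV : zero_mean V).

Definition lin (a : 'cV[R]_k) (v : k.-tuple R) : R := (a^T *m colv v) 0 0.

Lemma linE a v : lin a v = \sum_i a i 0 * tnth v i.
Proof. by rewrite /lin mxE; apply: eq_bigr => i _; rewrite !mxE. Qed.

Lemma measurable_lin a : measurable_fun setT (lin a).
Proof.
rewrite (_ : lin a = fun v => \sum_i a i 0 * tnth v i); last by apply/funext => v; rewrite linE.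
apply: measurable_sum_fun => i; apply: measurable_funM => //; exact: measurable_tnth.
Qed.

Let mV : measurable_fun setT V. Proof. exact: measurable_funPT. Qed.

Let mlin a : measurable_fun setT (fun w => lin a (V w)).
Proof. exact: (measurableT_comp (measurable_lin a) mV). Qed.

Let coord i w : lin (delta_mx i 0) (V w) = tnth (V w) i.
Proof.
by rewrite /lin trmx_delta -rowE !mxE.
Qed.

Let intble_lin a : P.-intble (fun w => lin a (V w)).
Proof. by have [m [s h]] := gV a; exact: (gaussian_intble1 (mlin a) h). Qed.

Let coord_intble i : P.-intble (fun w => tnth (V w) i).
Proof. by have := intble_lin (delta_mx i 0); under [X in EFin \o X]eq_fun do rewrite coord. Qed.

Let coord_mean i : \int[P]_w tnth (V w) i = 0.
Proof. by have := zV i; rewrite unlock /Rintegral => ->. Qed.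

Lemma lin_mean a : \int[P]_w lin a (V w) = 0.
Proof.
under eq_Rintegral do rewrite linE.
rewrite Rintegral_sum => [|i _]; last by apply: intbleZ.
by rewrite big1// => i _; rewrite RintegralZl// coord_mean mulr0.
Qed.

Lemma intble_lin_sq a : P.-intble (fun w => lin a (V w) * lin a (V w)).
Proof. by have [m [s h]] := gV a; exact: (gaussian_intble2 (mlin a) h (lin_mean a)). Qed.

Let coord_intble2 i j : P.-intble (fun w => tnth (V w) i * tnth (V w) j).
Proof.
have mt i' : measurable_fun setT (fun w => tnth (V w) i').
  by have := mlin (delta_mx i' 0); under eq_fun do rewrite coord.
have sq i' : P.-intble (fun w => tnth (V w) i' * tnth (V w) i').
  by have := intble_lin_sq (delta_mx i' 0); under [X in EFin \o X]eq_fun do rewrite coord.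
apply: (intble_le _ _ (intbleD (sq i) (sq j))); first exact: measurable_funM.
move=> w; rewrite normrM [leRHS]ger0_norm ?addr_ge0// -?expr2 ?sqr_ge0//.
rewrite -(real_normK (num_real (tnth (V w) i))) -(real_normK (num_real (tnth (V w) j))).
have := sqr_ge0 (`|tnth (V w) i| - `|tnth (V w) j|).
have := normr_ge0 (tnth (V w) i); have := normr_ge0 (tnth (V w) j); nra.
Qed.

Let cov_mxE i j : cov_mx V i j = \int[P]_w (tnth (V w) i * tnth (V w) j).
Proof.
have e0 i0 : fine 'E_P[fun w => tnth (V w) i0]%E = 0 by rewrite zV.
rewrite mxE unlock !e0 /Rintegral unlock; congr fine; apply: eq_integral => w _ /=.
by congr EFin; rewrite -[LHS]/((_ - 0) * (_ - 0)) !subr0.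
Qed.

Lemma lin_sq_mean a : \int[P]_w (lin a (V w) * lin a (V w)) = (a^T *m cov_mx V *m a) 0 0.
Proof.
transitivity (\int[P]_w \sum_j \sum_i (a i 0 * a j 0) * (tnth (V w) i * tnth (V w) j)).
  apply: eq_Rintegral => w _; rewrite linE big_distrr/=; apply: eq_bigr => j _.
  by rewrite big_distrl/=; apply: eq_bigr => i _; ring.
rewrite Rintegral_sum => [|j _]; last first.
  by apply: intble_sum => i _; apply: intbleZ; exact: coord_intble2.
rewrite mxE; apply: eq_bigr => j _; rewrite Rintegral_sum => [|i _]; last by apply: intbleZ; exact: coord_intble2.
rewrite mxE big_distrl/=; apply: eq_bigr => i _.
by rewrite RintegralZl ?coord_intble2// -cov_mxE trmxE; ring.
Qed.

Lemma lin_cos a c :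
  \int[P]_w cos (lin a (V w) + c) = expR (- ((a^T *m cov_mx V *m a) 0 0 / 2)) * cos c.
Proof.
have [m [s h]] := gV a.
by rewrite -lin_sq_mean (gaussian_variance (mlin a) h (lin_mean a)) (gaussian_cos (mlin a) h (lin_mean a)).
Qed.

Lemma cov_mx_posdef : cov_mx V \in unitmx -> posdef (cov_mx V).
Proof.
move=> uC; apply: psd_unit_posdef => //.
  by apply/matrixP => i j; rewrite mxE !cov_mxE; apply: eq_Rintegral => w _; rewrite mulrC.
move=> u; have := lin_sq_mean u^T; rewrite trmxK => <-.
by apply: Rintegral_ge0 => w _; rewrite -expr2 sqr_ge0.
Qed.

End gaussian_vectors.

Section independent_pair.
Context d (T : measurableType d) (R : realType) (Q : probability T R).
Variables (N M : nat) (X : {RV Q >-> N.-tuple R}) (Z : {RV Q >-> M.-tuple R}).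
Hypotheses (gX : gaussian_vector X) (gZ : gaussian_vector Z).
Hypotheses (zX : zero_mean X) (zZ : zero_mean Z) (XZ : independent2 X Z).

(** Independence enters through events in both variables: for each event of [Z] it factors out the
    cosine of the form in [X], and the resulting identities are what [Rintegral_indep_cos] requires
    for the form in [Z]. *)
Lemma lin_pair_cos a b c :
  \int[Q]_w cos (lin b (Z w) + lin a (X w) + c) =
  expR (- (((a^T *m cov_mx X *m a) 0 0 + (b^T *m cov_mx Z *m b) 0 0) / 2)) * cos c.
Proof.
have mX : measurable_fun setT X by exact: measurable_funPT.
have mZ : measurable_fun setT Z by exact: measurable_funPT.
have mi B : measurable B -> measurable_fun setT (fun w => \1_B (Z w) : R).
  by move=> mB; apply: (measurableT_comp _ mZ); exact: measurable_indic.
under eq_Rintegral do rewrite -[cos _]mul1r.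
rewrite mulrDl opprD expRD.
apply: (@Rintegral_indep_cos _ _ _ _ _ Q Z (fun=> 1) (fun w => lin a (X w)) (lin b)) => //.
- exact: (measurableT_comp (measurable_lin a) mX).
- exact: measurable_lin.
- by move=> w; rewrite normr1.
- move=> B c' mB; under eq_Rintegral do rewrite mul1r.
  rewrite -(lin_cos gX zX) mulrC.
  apply: (@Rintegral_indep _ _ _ _ _ Q X mX (fun w => \1_B (Z w)) (\int[Q]_w \1_B (Z w)) _ _ _
    (fun x => cos (lin a x + c'))) => //.
  + exact: mi.
  + by move=> w; exact: norm_indic.
  + move=> C mC; apply: EFin_inj; rewrite EFinM !Rintegral_indic_RV// muleC -XZ//.
    rewrite -Rintegral_indic; last by apply: measurableI; exact: measurable_funPTI.
    congr EFin; apply: eq_Rintegral => w _.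
    rewrite !indicE -natrM mulnb; congr (nat_of_bool _)%:R.
    apply/idP/idP => [/andP[/set_mem h1 /set_mem h2]|/set_mem[h1 h2]]; first by rewrite inE.
    by apply/andP; split; rewrite inE.
  + by apply: measurable_cosf; apply: measurable_funD => //; exact: measurable_lin.
  + by move=> y; exact: cos_max.
- by move=> c'; exact: lin_cos.
Qed.

End independent_pair.

Section second_moment.
Context d (T : measurableType d) (R : realType) (P : probability T R) (m p : nat).
Variable V : T -> 'M[R]_(m, p).
Hypothesis sV : std_gauss P V.

Lemma std_second_moment i j i' j' :
  P.-intble (fun w => V w i j * V w i' j') /\
  \int[P]_w (V w i j * V w i' j') = ((i' == i) && (j' == j))%:R.
Proof.
split; first exact: (intble_nice sV (niceM (nice_entry _ i j) (nice_entry _ i' j'))).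
have h v : is_derive (0 : R) 1 (fun x => shift_mx i j v x i' j') ((i' == i) && (j' == j))%:R.
  have -> : (fun x => shift_mx i j v x i' j') = (fun x => ((i' == i) && (j' == j))%:R * x + v i' j').
    by apply/funext => x; rewrite shift_mxE addrC mulrC.
  exact: is_derive_affine.
by rewrite (stein_mx sV (nice_entry _ i' j') (nice_cst _ _ _) h) Rintegral_cst1.
Qed.

End second_moment.

(** * Whitened samples *)

(** In use [D = 1 - H A], so that the left side is the variance of [p Y + q (X - H Y)]; the right
    side sorts it by blocks. *)
Lemma quad_expand (R : realType) (M N : nat) (A : 'M[R]_(M, N)) (Cx : 'M[R]_N)
    (Cz : 'M[R]_M) (D : 'M[R]_N) (H : 'M[R]_(N, M)) (p : 'rV[R]_M) (q : 'rV[R]_N) :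
  ((p *m A + q *m D) *m Cx *m (p *m A + q *m D)^T) 0 0 +
    ((p - q *m H) *m Cz *m (p - q *m H)^T) 0 0 =
  (p *m (A *m Cx *m A^T + Cz) *m p^T) 0 0 + (p *m (A *m Cx *m D^T - Cz *m H^T) *m q^T) 0 0 +
  ((q *m (D *m Cx *m A^T - H *m Cz) *m p^T) 0 0 +
   (q *m (D *m Cx *m D^T + H *m Cz *m H^T) *m q^T) 0 0).
Proof.
have -> : (p *m A + q *m D)^T = A^T *m p^T + D^T *m q^T by rewrite linearD/= !trmx_mul.
have -> : (p - q *m H)^T = p^T - H^T *m q^T by rewrite linearB/= trmx_mul.
rewrite !(mulmxDl, mulmxDr, mulmxN, mulNmx, opprK, opprD) !(mulmxA, mulNmx, mulmxN, opprK).
rewrite !(addmxE, oppmxE); ring.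
Qed.

Section standardized.
Variables (R : realType) (M N : nat).
Variables (A : 'M[R]_(M, N)) (Cx : 'M[R]_N) (Cz : 'M[R]_M) (K : 'M[R]_M) (J : 'M[R]_N).
Variable Th : 'M[R]_(M, N).

(* The error x - Theta_*^T y of the optimal estimator is uncorrelated with the
   observation y; K and J whiten the two blocks. *)
Definition whiten (p : N.-tuple R * M.-tuple R) : 'M[R]_(1, M + N) :=
  row_mx ((K *m colv p.2)^T) ((J *m (colv p.1 - Th^T *m colv p.2))^T).

Lemma measurable_mulmx d (T : measurableType d) k m p (a : T -> 'M[R]_(p, k)) (v : T -> 'M[R]_(k, m)) :
  measurable_mx a -> measurable_mx v -> measurable_mx (fun w => a w *m v w).
Proof.
move=> ma mv i j; under eq_fun do rewrite mxE.
by apply: measurable_sum_fun => l; apply: measurable_funM; [exact: ma|exact: mv].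
Qed.

Lemma measurable_lin_mx d (T : measurableType d) k m p (a : 'M[R]_(p, k)) (v : T -> 'M[R]_(k, m)) :
  measurable_mx v -> measurable_mx (fun w => a *m v w).
Proof. by move=> mv; apply: measurable_mulmx => // i j; exact: measurable_cst. Qed.

Lemma measurable_colv d (T : measurableType d) k (v : T -> k.-tuple R) :
  measurable_fun setT v -> measurable_mx (fun w => colv (v w)).
Proof.
move=> mv i j; under eq_fun do rewrite mxE.
exact: (measurableT_comp (measurable_tnth i) mv).
Qed.

Lemma measurable_whiten : measurable_mx whiten.
Proof.
have m2 : measurable_mx (fun p : N.-tuple R * M.-tuple R => colv p.2).
  by apply: measurable_colv; exact: measurable_snd.
have m1 : measurable_mx (fun p : N.-tuple R * M.-tuple R => colv p.1).
  by apply: measurable_colv; exact: measurable_fst.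
move=> i k; rewrite /whiten -(splitK k); case: (fintype.split k) => j /=.
  under eq_fun do rewrite row_mxEl trmxE; exact: measurable_lin_mx.
under eq_fun do rewrite row_mxEr trmxE; apply: measurable_lin_mx => a b.
under eq_fun do rewrite addmxE oppmxE; apply: measurable_funB => //.
exact: measurable_lin_mx.
Qed.

Lemma mdot_row_mx m p q (a b : 'M[R]_(m, p)) (a' b' : 'M[R]_(m, q)) :
  mdot (row_mx a a') (row_mx b b') = mdot a b + mdot a' b'.
Proof.
rewrite /mdot -big_split/=; apply: eq_bigr => i _; rewrite big_split_ord/=.
by congr (_ + _); apply: eq_bigr => j _; rewrite ?row_mxEl ?row_mxEr.
Qed.

Hypotheses (pCx : posdef Cx) (pCz : posdef Cz).
Hypothesis orth : Cx *m A^T = Th^T *m C_YY A Cx Cz.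
Hypotheses (KB : K *m C_YY A Cx Cz *m K^T = 1%:M).
Hypothesis JC : J *m (Cx - Th^T *m A *m Cx) *m J^T = 1%:M.

Let coefX (t : 'M[R]_(1, M + N)) : 'cV[R]_N :=
  (lsubmx t *m K *m A + rsubmx t *m J *m (1%:M - Th^T *m A))^T.
Let coefZ (t : 'M[R]_(1, M + N)) : 'cV[R]_M :=
  (lsubmx t *m K - rsubmx t *m J *m Th^T)^T.

Lemma colvK k (v : 'cV[R]_k) : colv (tuplev v) = v.
Proof. by apply/matrixP => i j; rewrite mxE tnth_mktuple (ord1 j). Qed.

Let whiten_lin t x z :
  mdot t (whiten (x, observation A x z)) = lin (coefZ t) z + lin (coefX t) x.
Proof.
rewrite -[t]hsubmxK mdot_row_mx hsubmxK !mdot_tr !trmxK /lin /coefX /coefZ !trmxK /= /observation colvK.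
set a := lsubmx t; set b := rsubmx t; set u := colv x; set w := colv z.
rewrite ![\tr _]big_ord1.
rewrite !(mulmxDl, mulmxDr, mulmxN, mulNmx, mulmx1) !(mulmxA, mulNmx, mulmxN) -[ord0]/(0 : 'I_1) !(addmxE, oppmxE); ring.
Qed.

(** The mixed blocks [h1] and [h2] vanish since the error is uncorrelated with the observation; the
    diagonal blocks are the covariances of observation and error, which [K] and [J] turn into
    identities. *)
Let coef_var t : ((coefX t)^T *m Cx *m coefX t) 0 0 + ((coefZ t)^T *m Cz *m coefZ t) 0 0 = mdot t t.
Proof.
have -> : mdot t t = mdot (lsubmx t) (lsubmx t) + mdot (rsubmx t) (rsubmx t).
  by rewrite -mdot_row_mx hsubmxK.
rewrite !mdot_row /coefX /coefZ !trmxK.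
set a := lsubmx t; set b := rsubmx t; set D := 1%:M - Th^T *m A.
have DE : D *m Cx = Cx - Th^T *m A *m Cx by rewrite /D mulmxBl mul1mx.
have h1 : D *m Cx *m A^T - Th^T *m Cz = 0.
  by rewrite DE mulmxBl orth /C_YY mulmxDr !mulmxA addrAC addrK subrr.
have h2 : A *m Cx *m D^T - Cz *m Th^T^T = 0.
  apply: trmx_inj; rewrite trmx0 linearB/= !trmx_mul !trmxK pCx.1 pCz.1 mulmxA; exact: h1.
have h3 : D *m Cx *m D^T + Th^T *m Cz *m Th^T^T = Cx - Th^T *m A *m Cx.
  have -> : D^T = 1%:M - A^T *m Th by rewrite /D linearB/= trmx1 trmx_mul trmxK.
  rewrite mulmxBr mulmx1 mulmxA (eqP (_ : D *m Cx *m A^T == Th^T *m Cz)) ?trmxK ?subrK//.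
  by rewrite -subr_eq0 h1.
rewrite quad_expand h1 h2 h3 !mulmx0 !mul0mx [in X in _ + X + _]mxE addr0 [in X in _ + (X + _)]mxE add0r.
rewrite -/(C_YY A Cx Cz) !trmx_mul !mulmxA.
have e k (u : 'rV[R]_k) (L C : 'M[R]_k) : L *m C *m L^T = 1%:M -> u *m L *m C *m L^T *m u^T = u *m u^T.
  by move=> h; rewrite -(mulmxA u) -(mulmxA u) h mulmx1.
by rewrite !e.
Qed.

Section law.
Context d (T : measurableType d) (Q : probability T R).
Variables (X : {RV Q >-> N.-tuple R}) (Z : {RV Q >-> M.-tuple R}).
Hypotheses (gX : gaussian_vector X) (gZ : gaussian_vector Z).
Hypotheses (zX : zero_mean X) (zZ : zero_mean Z) (XZ : independent2 X Z).
Hypotheses (CX : cov_mx X = Cx) (CZ : cov_mx Z = Cz).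

Let pair w := (X w, observation A (X w) (Z w)).

Lemma measurable_observation : measurable_fun setT pair.
Proof.
have mX : measurable_fun setT X by exact: measurable_funPT.
have mZ : measurable_fun setT Z by exact: measurable_funPT.
apply/measurable_fun_pair => //; apply/measurable_fun_tnthP => i.
rewrite /observation (_ : _ \o _ = fun w => (A *m colv (X w)) i 0 + colv (Z w) i 0).
  apply: measurable_funD; last exact: measurable_colv.
  by apply: measurable_lin_mx; exact: measurable_colv.
by apply/funext => w /=; rewrite tnth_mktuple addmxE.
Qed.

Lemma std_whiten : std_gauss Q (whiten \o pair).
Proof.
split=> [i j|t c].
  exact: (measurableT_comp (measurable_whiten i j) measurable_observation).
rewrite /= /pair; under eq_Rintegral do rewrite whiten_lin.
by rewrite (lin_pair_cos gX gZ zX zZ XZ) CX CZ coef_var.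
Qed.

Context d' (T' : measurableType d') (P : probability T' R) (n : nat).
Variable S : 'I_n -> {RV P >-> (N.-tuple R * M.-tuple R)%type}.
Hypothesis iid : iid_samples A X Z S.

Definition whiten_data w : 'M[R]_(n, M + N) := \matrix_(i, j) whiten (S i w) 0 j.

(** Each row has the law of one whitened pair, transported from the space of [X] and [Z] to that of
    the samples. By [mutual_cos] the row factors multiply, and their exponents add up to the squared
    norm of [t]. *)
Lemma std_whiten_data : std_gauss P whiten_data.
Proof.
case: iid => indS lawS.
have mS i : measurable_fun setT (S i) by exact: measurable_funPT.
split=> [i j|t c].
  under eq_fun do rewrite mxE.
  exact: (measurableT_comp (measurable_whiten 0 j) (mS i)).
pose f i p := mdot (row i t) (whiten p).
have mf i : measurable_fun setT (f i).
  apply: measurable_sum_fun => k; apply: measurable_sum_fun => j.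
  by apply: measurable_funM => //; exact: measurable_whiten.
have fe i c' : \int[P]_w cos (f i (S i w) + c') = expR (- (mdot (row i t) (row i t) / 2)) * cos c'.
  have mfc : measurable_fun setT (fun p => cos (f i p + c')).
    by apply: measurable_cosf; exact: measurable_funD.
  have h := Rintegral_law (nu := pushforward Q pair) (mS i) (lawS i) mfc.
  have h' := Rintegral_law (nu := pushforward Q pair) measurable_observation (fun _ _ => erefl) mfc.
  rewrite [LHS](h measurable_observation) -(h' measurable_observation).
  exact: std_whiten.2.
have rowE : mdot t t = \sum_i mdot (row i t) (row i t).
  by apply: eq_bigr => i _; rewrite /mdot big_ord1; apply: eq_bigr => j _; rewrite !mxE.
have -> : expR (- (mdot t t / 2)) = \prod_i expR (- (mdot (row i t) (row i t) / 2)).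
  by rewrite rowE mulr_suml -sumrN expR_sum.
rewrite -(mutual_cos indS mf fe); apply: eq_Rintegral => w _; congr (cos (_ + _)).
apply: eq_bigr => i _; rewrite /f /mdot big_ord1; apply: eq_bigr => j _.
by rewrite !mxE.
Qed.

Let whiten_dataE w i j : whiten_data w i j = whiten (S i w) 0 j.
Proof. by rewrite mxE. Qed.

Lemma lsub_whiten_data w : lsubmx (whiten_data w) = data_Y (fun i => S i w) *m K^T.
Proof.
apply/matrixP => i j; rewrite [LHS]mxE whiten_dataE /whiten row_mxEl trmxE !mxE.
by apply: eq_bigr => k _; rewrite !mxE mulrC.
Qed.

Lemma rsub_whiten_data w : rsubmx (whiten_data w) =
  (data_X (fun i => S i w) - data_Y (fun i => S i w) *m Th) *m J^T.
Proof.
apply/matrixP => i j; rewrite [LHS]mxE whiten_dataE /whiten row_mxEr trmxE [LHS]mxE [RHS]mxE.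
apply: eq_bigr => k _; rewrite mulrC trmxE; congr (_ * _).
rewrite !(addmxE, oppmxE) !mxE; congr (_ - _); apply: eq_bigr => l _.
by rewrite !mxE mulrC.
Qed.

End law.

End standardized.

(** * Least squares and excess risk *)

Section least_squares_solution.
Variables (R : realType) (n M N : nat).
Variables (bY : 'M[R]_(n, M)) (bX : 'M[R]_(n, N)).

Lemma sqnormF_mdot m k (B : 'M[R]_(m, k)) : sqnormF B = mdot B B.
Proof. by apply: eq_bigr => i _; apply: eq_bigr => j _; rewrite expr2. Qed.

Lemma mdotDr m k (a b c : 'M[R]_(m, k)) : mdot a (b + c) = mdot a b + mdot a c.
Proof. by rewrite !mdot_trC mulmxDr linearD. Qed.

Lemma mdot_sqD m k (a b : 'M[R]_(m, k)) :
  mdot (a + b) (a + b) = mdot a a + 2 * mdot a b + mdot b b.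
Proof. rewrite mdotDr ![mdot (a + b) _]mdotC !mdotDr (mdotC b a); ring. Qed.

(** The residual of [T0] is orthogonal to the range of [bY], so by Pythagoras a minimiser has the
    same fitted values as [T0], and an invertible Gram matrix makes it equal to [T0]. *)
Lemma least_squaresE Theta : (0 < n)%N -> bY^T *m bY \in unitmx ->
  least_squares bY bX Theta -> Theta = invmx (bY^T *m bY) *m bY^T *m bX.
Proof.
move=> n0 uG LS; set T0 := invmx _ *m _ *m _.
have res0 : bY^T *m (bY *m T0 - bX) = 0.
  by rewrite mulmxBr /T0 !mulmxA mulmxV// mul1mx subrr.
have := LS T0; rewrite ler_pM2l ?invr_gt0 ?ltr0n// !sqnormF_mdot.
have -> : bY *m Theta - bX = bY *m (Theta - T0) + (bY *m T0 - bX).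
  by rewrite mulmxBr addrA subrK.
rewrite mdot_sqD [mdot (bY *m (Theta - T0)) (bY *m T0 - bX)]mdot_trC trmx_mul -mulmxA res0.
rewrite mulmx0 linear0 mulr0 addr0 gerDr => h.
have /eqP d0 : bY *m (Theta - T0) == 0.
  by apply: contraLR h => d0; rewrite -ltNge mdot_gt0.
apply/eqP; rewrite -subr_eq0; apply/eqP.
by rewrite -(mulKmx uG (Theta - T0)) -mulmxA d0 !mulmx0.
Qed.

End least_squares_solution.

Section excess_risk.
Context d (T : measurableType d) (R : realType) (Q : probability T R).
Variables (N M : nat) (X : {RV Q >-> N.-tuple R}) (Z : {RV Q >-> M.-tuple R}).
Variable A : 'M[R]_(M, N).
Hypotheses (gX : gaussian_vector X) (gZ : gaussian_vector Z).
Hypotheses (zX : zero_mean X) (zZ : zero_mean Z) (XZ : independent2 X Z).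
Hypotheses (uX : cov_mx X \in unitmx) (uZ : cov_mx Z \in unitmx).
Let Cx := cov_mx X.
Let Cz := cov_mx Z.
Let Th := Theta_star A Cx Cz.
Let B := C_YY A Cx Cz.
Let CE := C_EE A Cx Cz.

Let pCx : posdef Cx. Proof. exact: cov_mx_posdef. Qed.
Let pCz : posdef Cz. Proof. exact: cov_mx_posdef. Qed.

Variables (K : 'M[R]_M) (J : 'M[R]_N).
Hypotheses (uK : K \in unitmx) (uJ : J \in unitmx).
Hypotheses (KB : K *m B *m K^T = 1%:M) (JC : J *m CE *m J^T = 1%:M).

Let orth : Cx *m A^T = Th^T *m B.
Proof. by apply/eqP; rewrite -subr_eq0; apply/eqP; exact: C_EE_cross. Qed.

Let JC' : J *m (Cx - Th^T *m A *m Cx) *m J^T = 1%:M.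
Proof. by rewrite -C_EE_Theta. Qed.

Let pair w := (X w, observation A (X w) (Z w)).

Let sV : std_gauss Q (whiten K J Th \o pair).
Proof. by have := std_whiten pCx pCz orth KB JC' gX gZ zX zZ XZ; exact. Qed.

Lemma BE : B = invmx K *m (invmx K)^T.
Proof.
apply: (can_inj (mulKmx uK)); apply: (can_inj (mulmxK (_ : K^T \in unitmx))).
  by rewrite unitmx_tr.
by rewrite KB mulmxA mulmxV// mul1mx trmx_inv mulVmx// unitmx_tr.
Qed.

(** The whitened observation has the identity as second-moment matrix, so the expectation is the
    squared Frobenius norm of [L]; [BE] restores [B]. *)
Lemma excess_riskE Theta :
  excess_risk A X Z Theta = (\tr ((Theta - Th)^T *m B *m (Theta - Th)))%:E.
Proof.
pose L := (Theta - Th)^T *m invmx K.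
pose V w := whiten K J Th (pair w).
have e w : sqnorm2 (Theta^T *m colv (observation A (X w) (Z w)) - Th^T *m colv (observation A (X w) (Z w)))
    = \sum_i \sum_j \sum_k (L i j * L i k) * (V w 0 (lshift N j) * V w 0 (lshift N k)).
  apply: eq_bigr => i _; set y := colv _.
  have -> : (Theta^T *m y - Th^T *m y) i 0 = \sum_j L i j * V w 0 (lshift N j).
    rewrite -mulmxBl -linearB/= -[y](mulKmx uK) (mulmxA _ (invmx K)) -/L mxE.
    by apply: eq_bigr => j _; rewrite /V /whiten row_mxEl trmxE.
  rewrite expr2 big_distrl/=; apply: eq_bigr => j _; rewrite big_distrr/=.
  by apply: eq_bigr => k _; ring.
have ii i : Q.-intble (fun w => \sum_j \sum_k (L i j * L i k) * (V w 0 (lshift N j) * V w 0 (lshift N k))).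
  apply: intble_sum => j _; apply: intble_sum => k _; apply: intbleZ.
  by case: (std_second_moment sV 0 (lshift N j) 0 (lshift N k)).
rewrite /excess_risk unlock /=; under eq_integral do rewrite e.
rewrite -EFin_Rintegral; last exact: intble_sum.
congr EFin; rewrite Rintegral_sum//.
have -> : \tr ((Theta - Th)^T *m B *m (Theta - Th)) = mdot L L.
  by rewrite mdot_tr /L trmx_mul trmxK BE !mulmxA.
apply: eq_bigr => i _; rewrite Rintegral_sum => [|j _]; last first.
  apply: intble_sum => k _; apply: intbleZ.
  by case: (std_second_moment sV 0 (lshift N j) 0 (lshift N k)).
apply: eq_bigr => j _; rewrite Rintegral_sum => [|k _]; last first.
  by apply: intbleZ; case: (std_second_moment sV 0 (lshift N j) 0 (lshift N k)).
rewrite (bigD1 j)//= big1 => [|k kj].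
  rewrite addr0; have [h1 h2] := std_second_moment sV 0 (lshift N j) 0 (lshift N j).
  by rewrite RintegralZl// h2 !eqxx mulr1.
have [h1 h2] := std_second_moment sV 0 (lshift N j) 0 (lshift N k).
by rewrite RintegralZl// h2 (inj_eq (@lshift_inj _ _)) (negbTE kj) andbF mulr0.
Qed.

Context d' (T' : measurableType d') (P : probability T' R) (n : nat).
Variable S : 'I_n -> {RV P >-> (N.-tuple R * M.-tuple R)%type}.
Hypothesis iid : iid_samples A X Z S.
Variable hatTheta : T' -> 'M[R]_(M, N).
Hypothesis mhat : measurable_mx hatTheta.
Hypothesis LS : forall w, least_squares (data_Y (fun i => S i w)) (data_X (fun i => S i w)) (hatTheta w).
Hypothesis Mn : (M + 4 <= n)%N.

Let V := whiten_data K J Th S.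
(** [C_EE] is [J^-1 J^-T]; [C] has the same factors in the opposite order. It is a Gram matrix with
    the same trace, and it is what appears in the risk. *)
Let C := invmx J^T *m (invmx J^T)^T.
Let D w := \tr ((hatTheta w - Th)^T *m B *m (hatTheta w - Th)).

Let uKT : K^T \in unitmx. Proof. by rewrite unitmx_tr. Qed.
Let uJT : J^T \in unitmx. Proof. by rewrite unitmx_tr. Qed.

(** The normal equations give [hatTheta - Th = (Y^T Y)^-1 Y^T (X - Y Th)], in whitened coordinates
    [K^T R W^T G J^-T]. In the risk, [K B K^T = 1] removes the covariance of the fresh observation
    and a cyclic shift collects the factors of [J] into [C]. *)
Let risk_quad w : (lsubmx (V w))^T *m lsubmx (V w) \in unitmx ->
  D w = quad C (hat 0 (lsubmx (V w))) (V w).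
Proof.
have [WE GE] := (lsub_whiten_data K J Th S w, rsub_whiten_data K J Th S w).
rewrite /V WE; set bY := data_Y _ in WE GE *; set bX := data_X _ in GE *.
move=> uW; set W := bY *m K^T.
have n0 : (0 < n)%N by apply: leq_trans Mn; rewrite addnS.
have uG : bY^T *m bY \in unitmx.
  move: uW; rewrite trmx_mul trmxK mulmxA -(mulmxA K) unitmx_mul unitmx_mul.
  by rewrite uK uKT andbT.
have R0 : res 0 W = invmx (W^T *m W).
  by rewrite /res /reg (_ : 0%:M = 0) ?addr0//; apply/matrixP => i j; rewrite !mxE mul0rn.
have DE : hatTheta w - Th = K^T *m res 0 W *m W^T *m rsubmx (whiten_data K J Th S w) *m invmx J^T.
  rewrite GE (least_squaresE n0 uG (LS w)) -/bY -/bX.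
  rewrite [_ *m (_ *m J^T)]mulmxA mulmxK// R0.
  have -> : K^T *m invmx (W^T *m W) *m W^T = invmx (bY^T *m bY) *m bY^T.
    apply: (can_inj (mulKmx uG)); rewrite [RHS]mulmxA mulmxV// mul1mx.
    apply: (can_inj (mulKmx uK)).
    have -> : K *m (bY^T *m bY *m (K^T *m invmx (W^T *m W) *m W^T)) =
       (W^T *m W) *m invmx (W^T *m W) *m W^T by rewrite /W trmx_mul trmxK !mulmxA.
    by rewrite mulmxV// mul1mx /W trmx_mul trmxK.
  by rewrite mulmxBr -[_ *m (bY *m Th)]mulmxA (mulmxA bY^T) mulKmx.
rewrite /D DE /quad /C /hat; set G := rsubmx _; set Rs := res 0 W.
have Rsym : Rs^T = Rs by rewrite /Rs R0 trmx_inv trmx_mul trmxK.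
rewrite !trmx_mul Rsym !trmxK.
rewrite -!mulmxA mxtrace_mulC -!mulmxA.
congr (\tr _); congr (_ *m _); congr (_ *m _); congr (_ *m _).
have h p (E : 'M[R]_(M, p)) : K *m (B *m (K^T *m E)) = E by rewrite !mulmxA KB mul1mx.
by rewrite h.
Qed.

Let trC : \tr C = \tr CE.
Proof.
rewrite /C mxtrace_mulC; congr (\tr _).
apply: (can_inj (mulKmx uJ)); apply: (can_inj (mulmxK uJT)); rewrite JC.
by rewrite -trmx_inv trmxK !mulmxA mulmxV// mul1mx trmx_inv mulVmx.
Qed.

Lemma risk_deviation (c e : R) : 0 <= c -> 0 < e ->
  (P [set w | (e <= `|D w - \tr CE * c|)%R] <= (\tr CE ^+ 2 * dev M n c / e ^+ 2)%:E)%E.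
Proof.
move=> c0 e0; rewrite -trC.
have sVd : std_gauss P V.
  exact: (std_whiten_data pCx pCz orth KB JC' gX gZ zX zZ XZ (erefl _) (erefl _) iid).
apply: (estimate_deviation sVd Mn) => //.
- by rewrite /C trmx_mul trmxK.
- by have := tr_gram_sq_le (invmx J^T)^T; rewrite trmxK.
- have md : measurable_mx (fun w => hatTheta w - Th).
    by move=> i j; under eq_fun do rewrite addmxE oppmxE; exact: measurable_funB.
  have h : measurable_mx (fun w => (hatTheta w - Th)^T *m B *m (hatTheta w - Th)).
    apply: measurable_mulmx => //; apply: measurable_mulmx; last by move=> i j; exact: measurable_cst.
    by move=> i j; under eq_fun do rewrite trmxE; exact: md.
  by apply: measurable_sum_fun => i; exact: h.
- move=> w sw; apply: risk_quad; apply/negPn/negP => /singularP; exact.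
Qed.

End excess_risk.

(** * Proportional asymptotics *)

Section dev_limit.
Variables (R : realType) (n : nat -> nat) (gamma : R).
Hypothesis gamma01 : 0 < gamma < 1.
Hypothesis ratio : (M%:R / (n M)%:R : R) @[M --> \oo] --> gamma.
Let x M : R := M%:R / (n M)%:R.
Let y M : R := (n M)%:R^-1.
Let c := gamma / (1 - gamma).

Let g1 : 0 < 1 - gamma. Proof. by rewrite subr_gt0; case/andP: gamma01. Qed.

(** Division by zero returns 0, so a positive limit of the ratio excludes [n M = 0] eventually. *)
Let n_neq0 : \forall M \near \oo, (0 < n M)%N.
Proof.
have g0 : 0 < gamma by case/andP: gamma01.
near=> M; have : 0 < x M by near: M; exact: (cvgr_gt _ ratio _ g0).
by rewrite /x; case: (n M) => //; rewrite invr0 mulr0 ltxx.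
Unshelve. all: by end_near. Qed.

Let y0 : y M @[M --> \oo] --> 0.
Proof.
have h : x M * M%:R^-1 @[M --> \oo] --> gamma * 0.
  apply: cvgM ratio _.
  have := @cvg_harmonic R; rewrite -(cvg_shiftS (fun M : nat => M%:R^-1 : R)); exact.
rewrite mulr0 in h; apply: cvg_trans h; apply: near_eq_cvg.
near=> M; rewrite /x /y mulrAC divff ?mul1r// pnatr_eq0 -lt0n.
by near: M; exists 1%N.
Unshelve. all: by end_near. Qed.

Let den (k : nat -> R) (k0 : k M @[M --> \oo] --> 0) : 1 - x M - k M @[M --> \oo] --> 1 - gamma.
Proof.
rewrite -[X in _ --> X]subr0; apply: cvgB k0; apply: cvgB ratio; exact: cvg_cst.
Qed.

Lemma sample_size_large : \forall M \near \oo, (M + 4 <= n M)%N.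
Proof.
have k0 : 4 * y M @[M --> \oo] --> (0 : R).
  by rewrite -(mulr0 4); apply: cvgM y0; exact: cvg_cst.
near=> M.
have n0 : (0 < n M)%N by near: M; exact: n_neq0.
have : 0 < 1 - x M - 4 * y M by near: M; exact: (cvgr_gt _ (den k0) _ g1).
have nR : 0 < (n M)%:R :> R by rewrite ltr0n.
rewrite -(pmulr_rgt0 _ nR) /x /y.
have -> : (n M)%:R * (1 - M%:R / (n M)%:R - 4 * (n M)%:R^-1) = (n M)%:R - (M%:R + 4) :> R.
  by field; rewrite gt_eqF.
by rewrite subr_gt0 -natrD ltr_nat => /ltnW.
Unshelve. all: by end_near. Qed.

(** After division by [n] the bounds are rational functions of [M / n] and [1 / n]. Their limits are
    [c], [gamma c / (1 - gamma) = c^2] and 0, and [c^2 - 2 c c + c^2] cancels. *)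
Lemma cvg_dev : dev M (n M) c @[M --> \oo] --> 0.
Proof.
have y20 : 2 * y M @[M --> \oo] --> (0 : R).
  by rewrite -(mulr0 2); apply: cvgM y0; exact: cvg_cst.
pose b1 M := x M / (1 - x M - y M).
have b1c : b1 M @[M --> \oo] --> c.
  by apply: cvgM ratio _; apply: cvgV; [by rewrite gt_eqF|exact: den].
pose r M := y M / (1 - x M - 2 * y M).
have rc : r M @[M --> \oo] --> (0 : R).
  rewrite -(mul0r (1 - gamma)^-1).
  by apply: cvgM y0 _; apply: cvgV; [by rewrite gt_eqF|exact: den].
pose b2 M := (x M * b1 M + 2 * b1 M * r M * y M) / (1 - x M - (y M + 2 * r M * y M)).
have ryc : 2 * r M * y M @[M --> \oo] --> (0 : R).
  rewrite -(mulr0 (2 * 0)); apply: cvgM y0; apply: cvgM rc; exact: cvg_cst.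
have b2c : b2 M @[M --> \oo] --> c ^+ 2.
  have -> : c ^+ 2 = (gamma * c + c * 0) / (1 - gamma).
    by rewrite /c; field; rewrite gt_eqF.
  apply: cvgM.
    apply: cvgD; first exact: cvgM ratio b1c.
    have -> : (fun M => 2 * b1 M * r M * y M) = (fun M => b1 M * (2 * r M * y M)).
      by apply/funext => M; ring.
    exact: cvgM b1c ryc.
  apply: cvgV; first by rewrite gt_eqF.
  apply: den; rewrite -[X in _ --> X](addr0 0); exact: cvgD y0 ryc.
pose b3 M := (b1 M + b2 M) * r M.
have b3c : b3 M @[M --> \oo] --> (0 : R).
  by rewrite -(mulr0 (c + c ^+ 2)); apply: cvgM rc; exact: cvgD.
have lim : b2 M + 2 * b3 M - 2 * c * b1 M + c ^+ 2 @[M --> \oo] --> (0 : R).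
  have -> : 0 = c ^+ 2 + 2 * 0 - 2 * c * c + c ^+ 2 by ring.
  apply: cvgD; last exact: cvg_cst.
  apply: cvgB; last by apply: cvgM b1c; exact: cvg_cst.
  by apply: cvgD b2c _; apply: cvgM b3c; exact: cvg_cst.
apply: cvg_trans lim; apply: near_eq_cvg; near=> M.
have n0 : (0 < n M)%N by near: M; exact: n_neq0.
have Mn : (M + 4 <= n M)%N by near: M; exact: sample_size_large.
have nR : 0 < (n M)%:R :> R by rewrite ltr0n.
have MnR : M%:R + 4 <= (n M)%:R :> R by rewrite -natrD ler_nat.
have e1 : bound1 R M (n M) = b1 M.
  rewrite /bound1 /b1 /x /y; field; rewrite ?gt_eqF//=; lra.
have er : ((n M)%:R - M%:R - 2)^-1 = r M.
  rewrite /r /x /y; field; rewrite ?gt_eqF//=; lra.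
(* This keeps the denominator of [bound2] away from 0, as the field identity requires. *)
have r1 : 0 <= r M <= 1 / 2.
  rewrite -er; apply/andP; split; first by rewrite invr_ge0; lra.
  rewrite div1r lef_pV2 ?posrE; lra.
have e2 : bound2 R M (n M) = b2 M.
  rewrite /bound2 /b2 e1 er /x /y; field; rewrite ?gt_eqF//=; lra.
by rewrite /dev /bound3 e1 e2 er.
Unshelve. all: by end_near. Qed.

End dev_limit.

(** The whitening matrices are chosen inside and leave no trace in the bound, which depends on the
    model only through the trace of [C_EE], [M] and [n]. *)
Lemma risk_concentration dO dT (Omega : measurableType dO) (T : measurableType dT)
    (R : realType) (Q : probability Omega R) (P : probability T R) (N M n : nat)
    (A : 'M[R]_(M, N)) (X : {RV Q >-> N.-tuple R}) (Z : {RV Q >-> M.-tuple R})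
    (S : 'I_n -> {RV P >-> (N.-tuple R * M.-tuple R)%type}) (hatTheta : T -> 'M[R]_(M, N)) :
  gaussian_vector X -> gaussian_vector Z -> zero_mean X -> zero_mean Z ->
  independent2 X Z -> cov_mx X \in unitmx -> cov_mx Z \in unitmx ->
  iid_samples A X Z S -> measurable_mx hatTheta ->
  (forall w, least_squares (data_Y (fun i => S i w)) (data_X (fun i => S i w)) (hatTheta w)) ->
  (M + 4 <= n)%N ->
  exists D : T -> R, (forall w, excess_risk A X Z (hatTheta w) = (D w)%:E) /\
    forall c e, 0 <= c -> 0 < e ->
    (P [set w | (e <= `|D w - \tr (C_EE A (cov_mx X) (cov_mx Z)) * c|)%R] <=
     (\tr (C_EE A (cov_mx X) (cov_mx Z)) ^+ 2 * dev M n c / e ^+ 2)%:E)%E.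
Proof.
move=> gX gZ zX zZ XZ uX uZ iid mhat LS Mn.
have pX := cov_mx_posdef gX zX uX; have pZ := cov_mx_posdef gZ zZ uZ.
have [K uK KB] := posdef_factor (posdef_C_YY A pX pZ).
have [J uJ JC] := posdef_factor (posdef_C_EE A pX pZ).
eexists; split=> [w|c e c0 e0].
  exact: (excess_riskE gX gZ zX zZ XZ uX uZ uK KB JC).
exact: (risk_deviation gX gZ zX zZ XZ uX uZ uK uJ KB JC iid mhat LS Mn c0 e0).
Qed.

Lemma cvg_probability0 (R : realType) (p : nat -> \bar R) (b : nat -> R) :
  (forall M, 0 <= p M)%E -> (\forall M \near \oo, (p M <= (b M)%:E)%E) ->
  b M @[M --> \oo] --> 0 -> p M @[M --> \oo] --> 0%E.
Proof.
move=> p0 pb b0; apply: (@squeeze_cvge _ _ _ _ (fun=> 0%E) _ (fun M => (b M)%:E)).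
- by apply: filterS pb => M ->; rewrite p0.
- exact: cvg_cst.
- by apply: cvg_EFin => //; exact: nearW.
Qed.

(** The target moves with [M] and the Chebyshev bound is proportional to the squared trace of
    [C_EE]. Convergence is therefore stated in absolute terms when the traces of the covariances of
    [X] are bounded, and relative to the trace of [C_EE] when the dimensions [N M] are positive,
    which makes that trace positive. *)
Theorem proposition5p13 (R : realType) (N n : nat -> nat) (gamma : R)
  (dO : nat -> measure_display) (Omega : forall M, measurableType (dO M))
  (Q : forall M, probability (Omega M) R)
  (X : forall M, {RV Q M >-> (N M).-tuple R})
  (Z : forall M, {RV Q M >-> M.-tuple R})
  (A : forall M, 'M[R]_(M, N M))
  (dT : nat -> measure_display) (T : forall M, measurableType (dT M))
  (P : forall M, probability (T M) R)
  (S : forall M, 'I_(n M) -> {RV P M >-> ((N M).-tuple R * M.-tuple R)%type})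
  (hatTheta : forall M, T M -> 'M[R]_(M, N M)) :
  0 < gamma < 1 ->
  (M%:R / (n M)%:R : R) @[M --> \oo] --> gamma ->
  (forall M, gaussian_vector (X M) /\ gaussian_vector (Z M)) ->
  (forall M, zero_mean (X M) /\ zero_mean (Z M)) ->
  (forall M, independent2 (X M) (Z M)) ->
  (forall M, cov_mx (X M) \in unitmx /\ cov_mx (Z M) \in unitmx) ->
  (forall M, iid_samples (A M) (X M) (Z M) (S M)) ->
  (forall M i j, measurable_fun setT (fun w => hatTheta M w i j)) ->
  (forall M w, least_squares (data_Y (fun i => S M i w))
                             (data_X (fun i => S M i w)) (hatTheta M w)) ->
  let trE M := \tr (C_EE (A M) (cov_mx (X M)) (cov_mx (Z M))) in
  let risk M w := excess_risk (A M) (X M) (Z M) (hatTheta M w) in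
  ((exists K : R, forall M, \tr (cov_mx (X M)) <= K) ->
     cvg_in_probability P risk (fun M => trE M * (gamma / (1 - gamma)))) /\
  ((forall M, (0 < N M)%N) ->
     cvg_in_probability P (fun M w => ((trE M)^-1)%:E * risk M w)%E
       (fun _ => gamma / (1 - gamma))).

Proof.
move=> gamma01 ratio gauss mean0 indep inv iid mhat LS trE risk.
set c := gamma / (1 - gamma).
have c0 : 0 <= c.
  by case/andP: gamma01 => g0 g1; rewrite divr_ge0 ?ltW// subr_gt0.
have pX M : posdef (cov_mx (X M)).
  by apply: cov_mx_posdef; [exact: (gauss M).1|exact: (mean0 M).1|exact: (inv M).1].
have pZ M : posdef (cov_mx (Z M)).
  by apply: cov_mx_posdef; [exact: (gauss M).2|exact: (mean0 M).2|exact: (inv M).2].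
have conc M : (M + 4 <= n M)%N -> exists D : T M -> R,
    (forall w, risk M w = (D w)%:E) /\ forall c e, 0 <= c -> 0 < e ->
    (P M [set w | (e <= `|D w - trE M * c|)%R] <= (trE M ^+ 2 * dev M (n M) c / e ^+ 2)%:E)%E.
  move=> Mn; have [gX gZ] := gauss M; have [zX zZ] := mean0 M; have [uX uZ] := inv M.
  exact: (risk_concentration gX gZ zX zZ (indep M) uX uZ (iid M) (mhat M) (LS M) Mn).
have devc := cvg_dev gamma01 ratio.
split=> [[K hK] e e0|N0 e e0].
  have tr0 M : 0 <= trE M.
    by apply: trace_psd_ge0 => u; apply: posdef_psd; exact: posdef_C_EE.
  have trK M : trE M <= K.
    by apply: le_trans (hK M); exact: trace_C_EE_le.
  apply: (@cvg_probability0 _ _ (fun M => K ^+ 2 / e ^+ 2 * `|dev M (n M) c|)) => [//||].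
    near=> M; have [|D [DE h]] := conc M; first by near: M; exact: (sample_size_large gamma01 ratio).
    rewrite (_ : [set w | _] = [set w | (e <= `|D w - trE M * c|)%R]); last first.
      by apply/seteqP; split => w /=; rewrite DE -EFinB abse_EFin lee_fin.
    apply: le_trans (h c e c0 e0) _; rewrite lee_fin mulrAC.
    (* With [dev] replaced by its absolute value, the squared trace may be enlarged to [K ^+ 2]. *)
    apply: (@le_trans _ _ (trE M ^+ 2 / e ^+ 2 * `|dev M (n M) c|)).
      by rewrite ler_wpM2l ?ler_norm// divr_ge0 ?sqr_ge0.
    rewrite ler_wpM2r// ler_wpM2r ?invr_ge0 ?sqr_ge0// lerXn2r ?nnegrE//.
    exact: le_trans (trK M).
  rewrite -(mulr0 (K ^+ 2 / e ^+ 2)); apply: cvgM; first exact: cvg_cst.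
  by rewrite -(normr0 R); apply: cvg_norm.
have tr0 M : 0 < trE M.
  by apply: trace_posdef_gt0 => //; exact: posdef_C_EE.
apply: (@cvg_probability0 _ _ (fun M => dev M (n M) c / e ^+ 2)) => [//||].
  near=> M; have [|D [DE h]] := conc M; first by near: M; exact: (sample_size_large gamma01 ratio).
  (* Dividing by the trace turns the threshold [e] into [e * trE M], so that the squared trace
     cancels in the Chebyshev bound. *)
  have absE w : `|D w - trE M * c| = trE M * `|(trE M)^-1 * D w - c|.
    rewrite -[X in _ = X * _](gtr0_norm (tr0 M)) -normrM mulrBr mulVKf//.
    by rewrite gt_eqF.
  rewrite (_ : [set w | _] = [set w | (e * trE M <= `|D w - trE M * c|)%R]); last first.
    by apply/seteqP; split => w /=; rewrite DE -EFinM -EFinB abse_EFin lee_fin absE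
      [e * _]mulrC ler_pM2l.
  apply: le_trans (h c (e * trE M) c0 (mulr_gt0 e0 (tr0 M))) _; rewrite lee_fin.
  rewrite le_eqVlt; apply/orP; left; apply/eqP.
  by rewrite exprMn; field; rewrite (gt_eqF e0) (gt_eqF (tr0 M)).
rewrite -(mul0r (e ^- 2)); apply: cvgM => //; exact: cvg_cst.
Unshelve. all: by end_near. Qed.
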